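(* Let $n=2$ or $n=3$, let $L>0$, $\Omega=[0,L]^{n-1}\subset\mathbb{R}^{n-1}$, and let $f$ be a bistable or combustion nonlinearity (as specified in the context). Let the shear profile $b:\Omega\to\mathbb{R}$ be H\''older continuous with exponent $p\in(0,1)$ and have zero mean, $\frac{1}{|\Omega|}\int_\Omega b(y)\,dy=0$. Let $\chi$ be the solution of $-\Delta_{\tilde x}\chi=b$ in $\Omega$ with zero Neumann boundary condition on $\partial\Omega$ and $\int_\Omega\chi\,dy=0$. Let $c(\delta)$ be the speed of the traveling front in the shear flow $\delta b$, and let $(U,c_0)$ be the traveling front profile and speed for $\delta=0$. Then there is a constant $\delta_0>0$, depending (with $\Omega$, $p$ fixed) only on $U$ and on the H\''older norm $\|b\|_p$ if $n=3$, respectively only on $U$ and on the maximum norm $\|b\|_\infty$ if $n=2$, such that for $0<\delta\le\delta_0$ $$c(\delta)=c_0+\frac{c_0\,\delta^2}{2|\Omega|}\int_\Omega|\nabla\chi|^2\,dy+O(\delta^3),$$ i.e. the difference between $c(\delta)$ and $c_0+\frac{c_0\delta^2}{2|\Omega|}\int_\Omega|\nabla\chi|^2dy$ is bounded in absolute value by $M\delta^3$ for all $0<\delta\le\delta_0$, with $M$ independent of $\delta$. Specifically, when $b\not\equiv0$, $\delta_0$ can be taken of the form $$\delta_0^2=\min\left(\frac{1}{2|\alpha|},\ \frac{1}{2C\|b\|^2}\right),\qquad \alpha=-\frac{1}{2|\Omega|}\int_\Omega|\nabla\chi|^2\,dy,$$ where $\|b\|=\|b\|_p$ if $n=3$, $\|b\|=\|b\|_\infty$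 if $n=2$, and $C>0$ is a constant independent of $b$ and $\delta$.
   Context: Write $x=(x_1,\tilde x)\in D=\mathbb{R}\times\Omega$, $\Omega=[0,L]^{n-1}$. The equation is $$u_t=\Delta_x u+\delta\, b(\tilde x)\,\partial_{x_1}u+f(u)\quad\text{in } D,$$ with zero Neumann boundary condition on $\mathbb{R}\times\partial\Omega$, where $\delta>0$. The nonlinearity $f$ is one of the following. (1) Combustion: for some $\mu\in(0,1)$, $f(u)=0$ for $u\in[0,\mu]$, $f(u)>0$ for $u\in(\mu,1)$, $f(1)=0$, $f\in C^2([0,1])$. (2) Bistable: $f(u)=u(1-u)(u-\mu)$ with $\mu\in(0,1/2)$. A traveling front is a solution $u(x,t)=\Phi(x_1+ct,\tilde x)$ with $\Phi\to0$ as its first argument tends to $-\infty$ and $\Phi\to1$ as its first argument tends to $+\infty$. It is a known fact that such a front exists with a unique speed $c=c(\delta)$ (the profile is unique up to translation in its first argument). For $\delta=0$ the front is $U=U(x_1+c_0t)$, with $U''-c_0U'+f(U)=0$, $U(-\infty)=0$, $U(+\infty)=1$, $U'>0$, and $U$ approaches $0$ and $1$ at exponential rates. $\|b\|_p$ is the standard H\''older norm with exponent $p$ on $\Omega$, and $\|b\|_\infty$ is the maximum norm on $\Omega$. *)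

(* Defs.v *)
From HB Require Import structures.
From mathcomp Require Import all_boot all_order all_algebra.
From mathcomp Require Import all_classical all_reals all_analysis.

Set Implicit Arguments.
Unset Strict Implicit.
Unset Printing Implicit Defensive.

Import Order.TTheory GRing.Theory Num.Theory.
Import numFieldNormedType.Exports.

Local Open Scope classical_set_scope.
Local Open Scope ring_scope.

Section relative_derivatives.
Context {R : realType} {V : normedModType R}.
Implicit Types (A : set V) (v x : V) (u : V -> R).

(* The increments h are restricted to those for which x + h v stays in A, so
   that at a boundary point of A this is the one-sided derivative: only the
   values of u on A matter. *)
Definition rel_quotient A v u x : set_system R :=
  h^-1 * (u (h *: v + x) - u x) @[h --> within [set h : R | A (h *: v + x)] 0^'].

Definition rel_derivable A v u x : Prop := cvg (rel_quotient A v u x).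

Definition rel_derive A v u x : R := lim (rel_quotient A v u x).

(* C^k regularity up to the boundary of A, in the directions of E *)
Fixpoint Ck_on (k : nat) A (E : set V) u : Prop :=
  {within A, continuous u} /\
  if k is k'.+1 then
    forall v, E v -> (forall x, A x -> rel_derivable A v u x) /\
                     Ck_on k' A E (rel_derive A v u)
  else True.

End relative_derivatives.

Section cells.
Context {R : realType}.
Implicit Types (L : R) (k m : nat).

(* The product of [0, L] in the coordinates of J and of the whole line in the
   other ones. *)
Definition cell L k (J : {pred 'I_k}) : set 'rV[R]_k :=
  [set x | forall i, i \in J -> 0 <= x ord0 i <= L].

Definition box L {m} : set 'rV[R]_m := cell L predT.

Definition cylinder L {m} : set 'rV[R]_m.+1 := cell L (predC1 ord0).

Definition cross_section m (x : 'rV[R]_m.+1) : 'rV[R]_m :=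
  \row_j x ord0 (lift ord0 j).

Definition unit_vec k (i : 'I_k) : 'rV[R]_k := delta_mx ord0 i.

Definition unit_vecs k : set 'rV[R]_k := range (@unit_vec k).

Definition partial k (A : set 'rV[R]_k) (i : 'I_k) (u : 'rV[R]_k -> R) :
    'rV[R]_k -> R :=
  rel_derive A (unit_vec i) u.

Definition laplacian k (A : set 'rV[R]_k) (u : 'rV[R]_k -> R)
    (x : 'rV[R]_k) : R :=
  \sum_i partial A i (partial A i u) x.

Definition sqr_gradient k (A : set 'rV[R]_k) (u : 'rV[R]_k -> R)
    (x : 'rV[R]_k) : R :=
  \sum_i partial A i u x ^+ 2.

(* On the faces x_i = 0 and x_i = L the partial derivative in direction i is,
   up to sign, the normal derivative. *)
Definition neumann L k (J : {pred 'I_k}) (u : 'rV[R]_k -> R) : Prop :=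
  forall i x, i \in J -> cell L J x -> x ord0 i = 0 \/ x ord0 i = L ->
    partial (cell L J) i u x = 0.

(* Lebesgue integral over [0, L]^m, as an iterated integral; it is only
   applied to functions that are continuous on the box. *)
Fixpoint box_integral L m : ('rV[R]_m -> R) -> R :=
  match m return ('rV[R]_m -> R) -> R with
  | 0 => fun g => g 0
  | m'.+1 => fun g =>
      \int[@lebesgue_measure R]_(t in `[0, L])
         box_integral L (fun y : 'rV[R]_m' => g (row_mx t%:M y))
  end.

Definition box_volume L m : R := L ^+ m.

(* Euclidean distance: the library norm on 'rV is the maximum norm. *)
Definition eucl_dist k (x y : 'rV[R]_k) : R :=
  Num.sqrt (\sum_i (x ord0 i - y ord0 i) ^+ 2).

Definition holder_continuous L m (p : R) (b : 'rV[R]_m -> R) : Prop :=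
  exists K : R, forall x y, box L x -> box L y ->
    `|b x - b y| <= K * eucl_dist x y `^ p.

Definition max_norm L m (b : 'rV[R]_m -> R) : R :=
  sup [set `|b y| | y in box L].

Definition holder_norm L m (p : R) (b : 'rV[R]_m -> R) : R :=
  max_norm L b +
  sup [set r | exists x y, [/\ box L x, box L y, x <> y &
                               r = `|b x - b y| / eucl_dist x y `^ p]].

End cells.

Section fronts.
Context {R : realType}.
Implicit Types (f U : R -> R) (L c delta p : R) (m : nat).

Definition combustion f : Prop :=
  exists2 mu : R, 0 < mu < 1 &
    [/\ forall u : R, 0 <= u <= mu -> f u = 0,
        forall u, mu < u < 1 -> 0 < f u,
        f 1 = 0 &
        Ck_on 2 (`[0, 1] : set R^o) [set 1] f].

Definition bistable f : Prop :=
  exists2 mu : R, 0 < mu < 2^-1 & forall u : R, f u = u * (1 - u) * (u - mu).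

(* The exponential rate of approach is a genuine condition: for combustion
   nonlinearities with f'(1) = 0 it fails at +oo. *)
Definition planar_front f (c0 : R) U : Prop :=
  [/\ forall s : R, derivable U s 1 /\ derivable (derive1 U) s 1,
      forall s : R, derive1n 2 U s - c0 * derive1 U s + f (U s) = 0,
      U s @[s --> -oo] --> (0 : R) /\ U s @[s --> +oo] --> (1 : R),
      forall s : R, 0 < derive1 U s &
      exists K : R, exists2 lambda : R, 0 < lambda &
        (forall s : R, s <= 0 -> `|U s| <= K * expR (lambda * s)) /\
        (forall s : R, 0 <= s -> `|1 - U s| <= K * expR (- (lambda * s)))].

Definition shear_solution L m f delta (b : 'rV[R]_m -> R)
    (u : 'rV[R]_m.+1 -> R -> R) : Prop :=
  let D := @cylinder R L m in
  [/\ forall t, Ck_on 2 D (@unit_vecs R m.+1) (u ^~ t),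
      forall t x, D x ->
        derivable (u x) t 1 /\
        derive1 (u x) t = laplacian D (u ^~ t) x
                      + delta * b (cross_section x) * partial D ord0 (u ^~ t) x
                      + f (u x t) &
      forall t, neumann L (predC1 ord0) (u ^~ t)].

(* Values lie in [0, 1], where f is defined; the limits are uniform over the
   (compact) cross-section. *)
Definition shear_front L m f delta (b : 'rV[R]_m -> R) c
    (Phi : 'rV[R]_m.+1 -> R) : Prop :=
  let D := @cylinder R L m in
  [/\ shear_solution L f delta b
        (fun x t => Phi (x + (c * t) *: unit_vec ord0)),
      forall x, D x -> 0 <= Phi x <= 1,
      forall eps : R, 0 < eps -> \forall s \near -oo,
        forall x, D x -> x ord0 ord0 = s -> `|Phi x| < eps &
      forall eps : R, 0 < eps -> \forall s \near +oo,
        forall x, D x -> x ord0 ord0 = s -> `|Phi x - 1| < eps].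

(* c delta is the (unique) speed of the fronts in the shear flow delta b *)
Definition shear_front_speed L m f (b : 'rV[R]_m -> R) (c : R -> R) : Prop :=
  forall delta : R, 0 < delta ->
    forall c' : R, (exists Phi, shear_front L f delta b c' Phi) <-> c' = c delta.

Definition cell_problem L m (b chi : 'rV[R]_m -> R) : Prop :=
  let Omega := @box R L m in
  [/\ Ck_on 2 Omega (@unit_vecs R m) chi,
      forall y, Omega y -> - laplacian Omega chi y = b y,
      neumann L predT chi &
      box_integral L chi = 0].

Definition mean_energy L m (chi : 'rV[R]_m -> R) : R :=
  (2 * box_volume L m)^-1 * box_integral L (sqr_gradient (box L) chi).

Definition quadratic_expansion L m (chi : 'rV[R]_m -> R) (c0 : R) (c : R -> R)
    (delta0 : R) : Prop :=
  exists M : R, forall delta : R, 0 < delta -> delta <= delta0 ->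
    `|c delta - (c0 + c0 * delta ^+ 2 * mean_energy L chi)| <= M * delta ^+ 3.

Definition shear_norm (n : nat) L p (b : 'rV[R]_n.-1 -> R) : R :=
  if n == 3 then holder_norm L p b else max_norm L b.

End fronts.

(* Main.v *)
Require Import Defs.
From HB Require Import structures.
From mathcomp Require Import all_boot all_order all_algebra.
From mathcomp Require Import all_classical all_reals all_analysis.
From mathcomp Require Import measurable_realfun ring lra.
Import Order.TTheory GRing.Theory Num.Theory.
Import numFieldNormedType.Exports.
Local Open Scope classical_set_scope.
Local Open Scope ring_scope.

(** The speed of a front can be read off from approximate fronts.  Let [v]
    connect 0 to 1 and satisfy the travelling wave equation with the speed [cs]
    up to an error of at most [r] times its slope in the direction of
    propagation.  Then the speed of the front differs from [cs] by at most [r],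
    for otherwise the front and [v] would be a strict sub- and a strict
    supersolution of the same equation, and sliding one along the other until
    they touch gives a contradiction ([sliding], [speed_bound]).  Sliding needs
    a reaction term that is non-increasing near 0 and near 1; for a combustion
    nonlinearity this rests on f'(1) < 0, which the exponential convergence of
    the planar front implies ([combustion_slope]).

    It remains to find such a [v] with r = O(delta^3).  Put g = |grad chi|^2,
    and let [m0] be the mean of [g], so that the claim is
    c(delta) = c0 + c0 delta^2 m0 / 2 + O(delta^3).  The choice is
    v = V (x_1 + delta chi) + delta^2 w.  In the equation for
    V (x_1 + delta chi) the terms of order delta are
    delta (b + Laplacian chi) V' = 0, and the term of order delta^2 is
    delta^2 g V''.  The mean of [g] acts as additional diffusion: [V] is taken
    to be the planar front for the diffusion coefficient 1 + delta^2 m0, which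
    is [U] stretched by the square root of this number, and moves with the
    speed cs = c0 (1 + delta^2 m0)^(1/2); its expansion is the claim
    ([planar_front_profile], [sqrt_expansion]).

    The oscillating part delta^2 (g - m0) V'' is cancelled by the corrector [w].
    Up to any given accuracy, g - m0 is a finite combination of Neumann
    eigenfunctions of the cross-section with eigenvalues lam > 0, and for each
    of them one has to solve
      W'' - cs W' + (f'(V) - lam) W = - V''
    on the line.  As V' is a positive solution of nearly the same equation with
    lam = 0, it is a strict supersolution for lam > 0, and the equation has a
    solution with |W| + |W'| <= C V' / lam ([corrector_solution],
    [mode_corrector]).  All errors are thus measured in units of V', which also
    bounds the higher derivatives of [V] and varies by a bounded factor over
    bounded distances ([log_derivative_bound], [log_derivative_harnack]).  The
    size of [w] is controlled by the sum of the coefficients of g - m0 divided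
    by their eigenvalues, and this sum stays bounded when the accuracy tends to
    0 ([mode_approximable1], [mode_approximable2]): the coefficients come from
    Fejer means of a Lipschitz function, and decay accordingly.  With the
    accuracy delta the error becomes O(delta^3) ([test_residual],
    [test_speed]).

    This requires delta to be small, but when delta is bounded away from 0 the
    same comparison with w = 0 gives the error O(delta^2), which is as good.
    Hence the expansion holds on every bounded interval of values of delta
    ([expansion_of_speed]), whatever its length. *)

(** * Derivatives along a direction inside a set *)

Section one_variable.
Context {R : realType}.
Implicit Types (f df : R -> R) (x : R).

Lemma derivative_continuous (f : R -> R) (x d : R) :
  is_derive x 1 f d -> {for x, continuous f}.
Proof.
by move=> [fx _]; apply/differentiable_continuous/derivable1_diffP.
Qed.

Lemma mean_value_between f df (a b : R) :
  (forall x, Num.min a b <= x <= Num.max a b -> is_derive x 1 f (df x)) ->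
  exists2 c, Num.min a b <= c <= Num.max a b & f b - f a = df c * (b - a).
Proof.
have H x y : x <= y -> (forall z, x <= z <= y -> is_derive z 1 f (df z)) ->
    exists2 c, x <= c <= y & f y - f x = df c * (y - x).
  move=> xy fdf; have [||c] := @MVT_segment R f df x y xy.
  - by move=> z; rewrite in_itv/= => /andP[/ltW ? /ltW ?]; apply: fdf; apply/andP.
  - apply: continuous_in_subspaceT => z; rewrite inE/= in_itv/= => xzy.
    exact: derivative_continuous (fdf z xzy).
  - by rewrite in_itv/= => cxy E; exists c.
have [ab|/ltW ba] := leP a b; first exact: H.
by move=> /(H b a ba)[c cba E]; exists c => //; rewrite -opprB E; ring.
Qed.

Lemma mean_value f df (a b : R) : (forall x, is_derive x 1 f (df x)) ->
  exists2 c, Num.min a b <= c <= Num.max a b & f b - f a = df c * (b - a).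
Proof. by move=> fdf; apply: mean_value_between => x _. Qed.

Lemma derivative_le f df (a b k : R) : (forall x, is_derive x 1 f (df x)) ->
  a <= b -> (forall x, a <= x <= b -> df x <= k) -> f b - f a <= k * (b - a).
Proof.
move=> fdf ab dk; have [c] := mean_value f df a b fdf.
rewrite (min_idPl ab) (max_idPr ab) => cab ->.
by rewrite ler_wpM2r ?subr_ge0// dk.
Qed.

Lemma derivative_ge f df (a b k : R) : (forall x, is_derive x 1 f (df x)) ->
  a <= b -> (forall x, a <= x <= b -> k <= df x) -> k * (b - a) <= f b - f a.
Proof.
move=> fdf ab dk; have [c] := mean_value f df a b fdf.
rewrite (min_idPl ab) (max_idPr ab) => cab ->.
by rewrite ler_wpM2r ?subr_ge0// dk.
Qed.

Lemma derivative_lipschitz f df (a b k : R) :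
  (forall x, is_derive x 1 f (df x)) ->
  (forall x, Num.min a b <= x <= Num.max a b -> `|df x| <= k) ->
  `|f b - f a| <= k * `|b - a|.
Proof.
move=> fdf dk; have [c cab ->] := mean_value f df a b fdf.
by rewrite normrM ler_wpM2r ?normr_ge0// dk.
Qed.

End one_variable.

Lemma within_continuousP {R : realType} {V : normedModType R} (A : set V) (u : V -> R) :
  {within A, continuous u} <-> forall x, A x -> forall e, 0 < e ->
    exists2 r : R, 0 < r & forall y, A y -> `|x - y| < r -> `|u x - u y| < e.
Proof.
split.
  move=> /subspace_continuousP cu x Ax e e0.
  have := cu x Ax; move=> /cvgrPdist_lt/(_ e e0); rewrite near_withinE.
  move=> /nbhs_normP[r /= r0 H]; exists r => // y Ay xy; exact: H.
move=> H; apply/subspace_continuousP => x Ax; apply/cvgrPdist_lt => e e0.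
rewrite near_withinE; have [r r0 K] := H x Ax e e0.
by apply/nbhs_normP; exists r => //= y xy Ay; exact: K.
Qed.

Section relative_derivative_rules.
Context {R : realType} {V : normedModType R} (A : set V) (v : V).
Implicit Types (u w : V -> R) (x : V) (d e : R).

(** The filter of small non-zero increments that stay in [A]; [rel_quotient]
    is the image of this filter. *)
Definition increments x : set_system R := within [set h | A (h *: v + x)] 0^'.

Global Instance increments_filter x : Filter (increments x).
Proof. exact: within_filter. Qed.

Definition is_rel_derive u x d : Prop :=
  h^-1 * (u (h *: v + x) - u x) @[h --> increments x] --> d.

Lemma near_increments (P : R -> Prop) x (e : R) : 0 < e ->
  (forall h, h != 0 -> `|h| < e -> A (h *: v + x) -> P h) ->
  \forall h \near increments x, P h.
Proof.
move=> e0 H; rewrite /increments near_withinE /dnbhs near_withinE.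
near=> h => hn0 Ah; apply: (H h hn0 _ Ah).
by near: h; exists e => //= y /=; rewrite sub0r normrN.
Unshelve. all: end_near. Qed.

Lemma increments0 x : h @[h --> increments x] --> (0 : R).
Proof.
apply/cvgrPdist_lt => e e0; apply: (near_increments _ x _ e0) => h _ he _.
by rewrite sub0r normrN.
Qed.

Lemma increments_near (P : R -> Prop) x :
  (\forall h \near increments x, P h) ->
  exists2 e : R, 0 < e &
    forall h, h != 0 -> `|h| < e -> A (h *: v + x) -> P h.
Proof.
rewrite /increments near_withinE /dnbhs near_withinE.
move=> [e /= e0 H]; exists e => // h hn0 he Ah.
by apply: H => //=; rewrite sub0r normrN.
Qed.

Lemma increments_neq0 x : \forall h \near increments x, h != 0.
Proof. by apply: (near_increments _ x _ ltr01) => h. Qed.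

Lemma increments_mem x : \forall h \near increments x, A (h *: v + x).
Proof. by apply: (near_increments _ x _ ltr01) => h. Qed.

Lemma is_rel_derive_continuous u x d : is_rel_derive u x d ->
  u (h *: v + x) @[h --> increments x] --> u x.
Proof.
move=> ud.
have : h * (h^-1 * (u (h *: v + x) - u x)) + u x @[h --> increments x]
   --> 0 * d + u x.
  by apply: cvgD; [apply: cvgM => //; exact: increments0|exact: cvg_cst].
rewrite mul0r add0r; apply: cvg_trans; apply: near_eq_cvg.
near=> h; rewrite mulrA divff ?mul1r ?subrK//.
by near: h; exact: increments_neq0.
Unshelve. all: end_near. Qed.

Lemma is_rel_derive_ext u w x d : A x -> (forall y, A y -> u y = w y) ->
  is_rel_derive u x d -> is_rel_derive w x d.
Proof.
move=> Ax uw; apply: cvg_trans; apply: near_eq_cvg; near=> h.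
rewrite (uw _ Ax) uw//; near: h; exact: increments_mem.
Unshelve. all: end_near. Qed.

Lemma is_rel_derive_quotient u x d (q : R -> R) :
  q h @[h --> increments x] --> d ->
  (forall h, h^-1 * (u (h *: v + x) - u x) = q h) -> is_rel_derive u x d.
Proof. by move=> qd E; rewrite /is_rel_derive (_ : (fun _ => _) = q)//; exact/funext. Qed.

Lemma is_rel_derive_eq u x d e : is_rel_derive u x d -> d = e ->
  is_rel_derive u x e.
Proof. by move=> ? <-. Qed.

Lemma is_rel_derive_cst a x : is_rel_derive (fun=> a) x 0.
Proof.
rewrite /is_rel_derive (_ : (fun _ => _) = fun=> 0); first exact: cvg_cst.
by apply/funext => h; rewrite subrr mulr0.
Qed.

Lemma is_rel_deriveD u w x d e : is_rel_derive u x d -> is_rel_derive w x e ->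
  is_rel_derive (fun y => u y + w y) x (d + e).
Proof.
move=> ud we; apply: (is_rel_derive_quotient _ _ _ _ (cvgD ud we)) => h /=.
by ring.
Qed.

Lemma is_rel_deriveZ u x d k : is_rel_derive u x d ->
  is_rel_derive (fun y => k * u y) x (k * d).
Proof.
move=> ud.
apply: (is_rel_derive_quotient _ _ _ _ (cvgM (cvg_cst k) ud)) => h /=; ring.
Qed.

Lemma is_rel_deriveB u w x d e : is_rel_derive u x d -> is_rel_derive w x e ->
  is_rel_derive (fun y => u y - w y) x (d - e).
Proof.
move=> ud we; have := is_rel_deriveD _ _ _ _ _ ud (is_rel_deriveZ _ _ _ (-1) we).
rewrite mulN1r; congr is_rel_derive; apply/funext => y; ring.
Qed.

Lemma is_rel_deriveM u w x d e : is_rel_derive u x d -> is_rel_derive w x e ->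
  is_rel_derive (fun y => u y * w y) x (d * w x + u x * e).
Proof.
move=> ud we.
have wc := is_rel_derive_continuous _ _ _ we.
apply: (is_rel_derive_quotient _ _ _ _
  (cvgD (cvgM ud wc) (cvgM (cvg_cst (u x)) we))) => h /=.
by ring.
Qed.

Lemma is_rel_derive_sum (I : Type) (r : seq I) (P : pred I)
    (F : I -> V -> R) (dF : I -> R) x :
  (forall i, P i -> is_rel_derive (F i) x (dF i)) ->
  is_rel_derive (fun y => \sum_(i <- r | P i) F i y) x
    (\sum_(i <- r | P i) dF i).
Proof.
move=> FdF; elim: r => [|i r IH].
  rewrite big_nil (_ : (fun _ => _) = fun=> 0); first exact: is_rel_derive_cst.
  by apply/funext => y; rewrite big_nil.
rewrite big_cons; case: ifP => Pi.
  rewrite (_ : (fun _ => _) = fun y => F i y + \sum_(j <- r | P j) F j y).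
    by apply: is_rel_deriveD => //; exact: FdF.
  by apply/funext => y; rewrite big_cons Pi.
rewrite (_ : (fun _ => _) = fun y => \sum_(j <- r | P j) F j y)//.
by apply/funext => y; rewrite big_cons Pi.
Qed.

Lemma is_rel_derive_comp (f : R -> R) u x d e : is_derive (u x) 1 f e ->
  is_rel_derive u x d -> is_rel_derive (fun y => f (u y)) x (e * d).
Proof.
move=> /is_derive1_caratheodory[g [fE cg gE]] ud.
have uc := is_rel_derive_continuous _ _ _ ud.
have gu : g (u (h *: v + x)) @[h --> increments x] --> e.
  by rewrite -gE; apply: (cvg_comp _ _ uc); exact: cg.
apply: (is_rel_derive_quotient _ _ _ _ (cvgM gu ud)) => h /=.
by rewrite fE; ring.
Qed.

End relative_derivative_rules.

Arguments is_rel_derive {R V} A v u x d.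
Arguments is_rel_derive_eq {R V A v u x d e}.
Arguments is_rel_derive_continuous {R V A v u x d}.

Section directions.
Context {R : realType} {V : normedModType R} (A : set V).
Implicit Types (u p : V -> R) (v x : V).

Lemma is_rel_deriveN_dir v u x d :
  is_rel_derive A v u x d -> is_rel_derive A (- v) u x (- d).
Proof.
move=> ud; apply/cvgrPdist_lt => e e0.
move/cvgrPdist_lt : ud => /(_ e e0) /increments_near[eta eta0 H].
apply: (near_increments _ _ _ _ _ eta0) => h hn0 he Ah.
have := H (- h); rewrite oppr_eq0 normrN scaleNr -scalerN => /(_ hn0 he Ah).
by rewrite -normrN; congr (`|_| < _); rewrite invrN; ring.
Qed.

Lemma is_rel_derive_line v u x d (a b t : R) : a < t < b ->
  (forall s, a <= s <= b -> A (s *: v + x)) ->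
  is_rel_derive A v u (t *: v + x) d ->
  is_derive t 1 (fun s => u (s *: v + x)) d.
Proof.
move=> /andP[at_ tb] Aab ud.
suff H : h^-1 *: (((fun s => u (s *: v + x)) \o shift t) (h *: 1) -
    u (t *: v + x)) @[h --> 0^'] --> d.
  by apply: DeriveDef; [apply/cvg_ex; exists d|exact: cvg_lim].
apply/cvgrPdist_lt => e e0.
move/cvgrPdist_lt : ud => /(_ e e0) /increments_near[eta eta0 H].
near=> h.
have hn0 : h != 0 by near: h; exact: nbhs_dnbhs_neq.
have E : (h *: 1 + t) *: v + x = h *: v + (t *: v + x) :> V.
  by rewrite [h *: 1]mulr1 scalerDl addrA.
rewrite /= E; apply: H => //.
- near: h; apply: nbhs_dnbhs; exists eta => //= y /=.
  by rewrite sub0r normrN.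
- rewrite -E; apply: Aab; rewrite [h *: 1]mulr1.
  have : `|h| < Num.min (t - a) (b - t).
    near: h; apply: nbhs_dnbhs; exists (Num.min (t - a) (b - t)) => /=.
      by rewrite lt_min !subr_gt0 at_ tb.
    by move=> y /=; rewrite sub0r normrN.
  rewrite lt_min => /andP[]; rewrite !ltr_norml => /andP[? _] /andP[_ ?].
  by apply/andP; split; lra.
Unshelve. all: end_near. Qed.

Lemma min_first_order v u x d (eta : R) : 0 < eta ->
  (forall s, 0 <= s <= eta -> A (s *: v + x)) ->
  (forall y, A y -> u x <= u y) ->
  is_rel_derive A v u x d -> 0 <= d.
Proof.
move=> eta0 Aeta umin ud; rewrite leNgt; apply/negP => d0.
move/cvgrPdist_lt : ud => /(_ (- d)); rewrite oppr_gt0.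
move=> /(_ d0) /increments_near[e e0 H].
pose h := Num.min eta (e / 2).
have h0 : 0 < h by rewrite lt_min eta0 divr_gt0.
have he : h < e by rewrite gt_min; apply/orP; right; lra.
have Ah : A (h *: v + x) by apply: Aeta; rewrite ltW//= ge_min lexx.
have := H h (lt0r_neq0 h0); rewrite gtr0_norm// => /(_ he Ah).
rewrite ltr_norml => /andP[+ _].
have : 0 <= h^-1 * (u (h *: v + x) - u x).
  by apply: mulr_ge0; [rewrite invr_ge0 ltW|rewrite subr_ge0 umin].
by lra.
Qed.

Lemma rel_continuous_at_right v u x d (eta : R) : 0 < eta ->
  (forall s, 0 <= s <= eta -> A (s *: v + x)) ->
  is_rel_derive A v u x d -> u (h *: v + x) @[h --> 0^'+] --> u x.
Proof.
move=> eta0 Aeta /is_rel_derive_continuous uc; apply/cvgrPdist_lt => e e0.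
move/cvgrPdist_lt : uc => /(_ e e0) /increments_near[r r0 H].
near=> h.
have h0 : 0 < h by near: h; exact: nbhs_right_gt.
apply: H; first exact: lt0r_neq0.
  by rewrite gtr0_norm//; near: h; exact: nbhs_right_lt.
by apply: Aeta; rewrite ltW//=; near: h; exact: nbhs_right_le.
Unshelve. all: end_near. Qed.

(** At a minimum where the first derivative vanishes, the one-sided second
    derivative is non-negative: otherwise the first derivative would be
    negative on a short inward segment, and the mean value theorem would give
    a smaller value there.  This covers boundary points with a Neumann
    condition. *)
Lemma min_second_order v u p x d (eta : R) : 0 < eta ->
  (forall s, 0 <= s <= eta -> A (s *: v + x)) ->
  (forall y, A y -> u x <= u y) ->
  (forall y, A y -> is_rel_derive A v u y (p y)) ->
  is_rel_derive A v p x d -> p x = 0 -> 0 <= d.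
Proof.
move=> eta0 Aeta umin up pd px0; rewrite leNgt; apply/negP => d0.
move/cvgrPdist_lt : pd => /(_ (- d)); rewrite oppr_gt0.
move=> /(_ d0) /increments_near[e e0 H].
have pneg h : 0 < h -> h < e -> h <= eta -> p (h *: v + x) < 0.
  move=> h0 he heta.
  have Ah : A (h *: v + x) by apply: Aeta; rewrite ltW.
  have := H h (lt0r_neq0 h0); rewrite gtr0_norm// => /(_ he Ah).
  rewrite px0 subr0 ltr_norml => /andP[+ _] => K.
  have {}K : h^-1 * p (h *: v + x) < 0 by lra.
  by move: K; rewrite pmulr_rlt0 ?invr_gt0.
pose b := Num.min (eta / 2) (e / 2).
have b0 : 0 < b by rewrite lt_min !divr_gt0.
have be : b < e by rewrite gt_min; apply/orP; right; lra.
have beta_ : b < eta by rewrite gt_min; apply/orP; left; lra.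
have A0 : A x by have := Aeta 0; rewrite scale0r add0r; apply; rewrite lexx ltW.
have Dt t : 0 < t -> t <= b ->
    is_derive t 1 (fun s => u (s *: v + x)) (p (t *: v + x)).
  move=> t0 tb; apply: (@is_rel_derive_line v u x _ 0 eta) => //.
    by rewrite t0; lra.
  by apply: up; apply: Aeta; rewrite ltW//=; lra.
have D0b t : t \in `]0, b[%R ->
    is_derive t 1 (fun s => u (s *: v + x)) (p (t *: v + x)).
  by rewrite in_itv/= => /andP[t0 tb]; apply: Dt => //; exact: ltW.
have cont : {within `[0, b], continuous (fun s => u (s *: v + x))}.
  apply/continuous_within_itvP => //; split.
  - by move=> t /D0b; exact: derivative_continuous.
  - rewrite scale0r add0r.
    exact: rel_continuous_at_right eta0 Aeta (up _ A0).
  - apply: cvg_at_left_filter.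
    exact: derivative_continuous (Dt _ b0 (lexx _)).
have [c] := MVT b0 D0b cont.
rewrite in_itv/= => /andP[c_gt0 cb]; rewrite scale0r add0r subr0 => E.
have : u x <= u (b *: v + x) by apply: umin; apply: Aeta; rewrite !ltW.
have : p (c *: v + x) * b < 0 by rewrite nmulr_rlt0 ?pneg//; lra.
by lra.
Qed.

End directions.

(** * Comparison of fronts on the cylinder *)

Section cells_geometry.
Context {R : realType}.
Implicit Types (L : R) (k m : nat).

Lemma coord_line k (i j : 'I_k) (h : R) (x : 'rV[R]_k) :
  (h *: unit_vec i + x) ord0 j = (if j == i then h else 0) + x ord0 j.
Proof.
by rewrite !mxE eqxx /=; case: (j == i); rewrite ?mulr1 ?mulr0.
Qed.

Lemma coord_lineN k (i j : 'I_k) (h : R) (x : 'rV[R]_k) :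
  (h *: - unit_vec i + x) ord0 j = (if j == i then - h else 0) + x ord0 j.
Proof.
by rewrite !mxE eqxx /=; case: (j == i); rewrite ?mulrN ?mulr1 ?mulr0 ?oppr0.
Qed.

Lemma cell_forward L k (J : {pred 'I_k}) (i : 'I_k) (x : 'rV[R]_k) :
  cell L J x -> (i \in J -> x ord0 i < L) ->
  exists2 eta : R, 0 < eta &
    forall s, 0 <= s <= eta -> cell L J (s *: unit_vec i + x).
Proof.
move=> Jx iL; have [iJ|iJ] := boolP (i \in J); last first.
  exists 1 => // s _ j jJ; rewrite coord_line.
  have /negPf-> : j != i by apply: contraNneq iJ => <-.
  by rewrite add0r; exact: Jx.
exists (L - x ord0 i); first by rewrite subr_gt0 iL.
move=> s /andP[s0 sL] j jJ; rewrite coord_line.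
have /andP[x0 xL] := Jx _ jJ.
by case: eqP => [ji|_]; [subst j; lra|rewrite add0r x0].
Qed.

Lemma cell_backward L k (J : {pred 'I_k}) (i : 'I_k) (x : 'rV[R]_k) :
  cell L J x -> (i \in J -> 0 < x ord0 i) ->
  exists2 eta : R, 0 < eta &
    forall s, 0 <= s <= eta -> cell L J (s *: - unit_vec i + x).
Proof.
move=> Jx iL; have [iJ|iJ] := boolP (i \in J); last first.
  exists 1 => // s _ j jJ; rewrite coord_lineN.
  have /negPf-> : j != i by apply: contraNneq iJ => <-.
  by rewrite add0r; exact: Jx.
exists (x ord0 i); first by rewrite iL.
move=> s /andP[s0 sL] j jJ; rewrite coord_lineN.
have /andP[x0 xL] := Jx _ jJ.
by case: eqP => [ji|_]; [subst j; lra|rewrite add0r x0].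
Qed.

(** At an inner point both directions along the coordinate are admissible; on
    a face only one is, and the Neumann condition [p x = 0] makes up for the
    other one. *)
Lemma cell_min_derivatives L k (J : {pred 'I_k}) (i : 'I_k) u p x d : 0 < L ->
  cell L J x -> (forall y, cell L J y -> u x <= u y) ->
  (forall y, cell L J y -> is_rel_derive (cell L J) (unit_vec i) u y (p y)) ->
  is_rel_derive (cell L J) (unit_vec i) p x d ->
  (i \in J -> x ord0 i = 0 \/ x ord0 i = L -> p x = 0) ->
  p x = 0 /\ 0 <= d.
Proof.
move=> L0 Jx umin up pd pN.
have px0 : p x = 0.
  have [/andP[iJ /orP xi]|] := boolP
      ((i \in J) && ((x ord0 i == 0) || (x ord0 i == L))).
    by apply: pN => //; case: xi => /eqP; [left|right].
  rewrite negb_and negb_or => H.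
  have lt_i : i \in J -> 0 < x ord0 i < L.
    move=> iJ; move: H; rewrite iJ/= => /andP[x0 xL].
    have /andP[? ?] := Jx _ iJ.
    by rewrite !lt_neqAle xL eq_sym x0; apply/andP.
  have [e1 e10 F] := cell_forward _ _ _ _ _ Jx
    (fun iJ => proj2 (andP (lt_i iJ))).
  have [e2 e20 B] := cell_backward _ _ _ _ _ Jx
    (fun iJ => proj1 (andP (lt_i iJ))).
  apply/eqP; rewrite eq_le; apply/andP; split; last first.
    exact: min_first_order e10 F umin (up _ Jx).
  rewrite -oppr_ge0.
  exact: min_first_order e20 B umin (is_rel_deriveN_dir _ _ _ _ _ (up _ Jx)).
split => //.
have [xL|xL] := boolP ((i \in J) ==> (x ord0 i < L)).
  have [e1 e10 F] := cell_forward _ _ _ _ _ Jx (implyP xL).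
  exact: min_second_order e10 F umin up pd px0.
have x0 : i \in J -> 0 < x ord0 i.
  move=> iJ; move: xL; rewrite iJ/= -leNgt; exact: lt_le_trans.
have [e2 e20 B] := cell_backward _ _ _ _ _ Jx x0.
apply: (@min_second_order R _ _ _ u (fun y => - p y) _ _ _ e20 B umin) => //.
- by move=> y Jy; apply: is_rel_deriveN_dir; exact: up.
- have := is_rel_deriveN_dir _ _ _ _ _ (is_rel_deriveZ _ _ _ _ _ (-1) pd).
  rewrite mulN1r opprK; apply: is_rel_derive_ext => // y _; ring.
- by rewrite px0 oppr0.
Qed.

Lemma cylinder_shift L m (t : R) (x : 'rV[R]_m.+1) :
  cylinder L x -> cylinder L (t *: unit_vec ord0 + x).
Proof.
move=> Dx i iJ; rewrite coord_line.
by have /negPf-> : i != ord0 by []; rewrite add0r; exact: Dx.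
Qed.

Lemma cross_section_shift m (t : R) (x : 'rV[R]_m.+1) :
  cross_section (t *: unit_vec ord0 + x) = cross_section x.
Proof.
apply/rowP => j; rewrite !mxE/= mulr0 add0r//.
Qed.

Lemma cross_section_box L m (x : 'rV[R]_m.+1) :
  cylinder L x -> box L (cross_section x).
Proof. by move=> Dx i _; rewrite mxE; apply: Dx. Qed.

Lemma compact_slab L m (a b : R) :
  compact [set x : 'rV[R]_m.+1 | cylinder L x /\ a <= x ord0 ord0 <= b].
Proof.
pose B (i : 'I_m.+1) : set R := if i == ord0 then `[a, b]%classic
  else `[0, L]%classic.
have -> : [set x : 'rV[R]_m.+1 | cylinder L x /\ a <= x ord0 ord0 <= b] =
    [set x : 'rV[R]_m.+1 | forall i, B i (x ord0 i)].
  apply/seteqP; split=> x /=.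
    move=> [Dx x0] i; rewrite /B; case: eqP => [->|/eqP i0]; rewrite /= in_itv//=.
    exact: Dx.
  move=> H; split; last by have := H ord0; rewrite /B eqxx/= in_itv.
  move=> i; rewrite inE => i0; have := H i.
  by rewrite /B (negPf i0)/= in_itv.
apply: rV_compact => i; rewrite /B; case: ifP => _; exact: segment_compact.
Qed.

End cells_geometry.

Section comparison.
Context {R : realType} (L : R) (m : nat).
Local Notation D := (@cylinder R L m).
Local Notation e0 := (@unit_vec R m.+1 ord0).

(** The families [u1] and [u2] are the first and the pure second partial
    derivatives of [u]; naming them avoids manipulating limits. *)
Definition smooth_neumann (u : 'rV[R]_m.+1 -> R)
    (u1 u2 : 'I_m.+1 -> 'rV[R]_m.+1 -> R) : Prop :=
  [/\ {within D, continuous u},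
      forall i x, D x -> is_rel_derive D (unit_vec i) u x (u1 i x),
      forall i x, D x -> is_rel_derive D (unit_vec i) (u1 i) x (u2 i x) &
      forall i x, i != ord0 -> D x -> x ord0 i = 0 \/ x ord0 i = L ->
        u1 i x = 0].

Definition front_limits (u : 'rV[R]_m.+1 -> R) : Prop :=
  (forall x, D x -> 0 <= u x <= 1) /\
  forall e, 0 < e -> exists X : R, forall x, D x ->
    (x ord0 ord0 <= - X -> u x < e) /\ (X <= x ord0 ord0 -> 1 - e < u x).

(** Left-hand side of the travelling wave equation, where [beta] is the shear
    minus the speed of the moving frame. *)
Definition wave_operator (f : R -> R) (beta : 'rV[R]_m -> R)
    (u : 'rV[R]_m.+1 -> R) (u1 u2 : 'I_m.+1 -> 'rV[R]_m.+1 -> R) x : R :=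
  \sum_i u2 i x + beta (cross_section x) * u1 ord0 x + f (u x).

Lemma is_rel_derive_shift u (i : 'I_m.+1) (t : R) x d : 
  is_rel_derive D (unit_vec i) u (t *: e0 + x) d ->
  is_rel_derive D (unit_vec i) (fun y => u (t *: e0 + y)) x d.
Proof.
move=> ud; apply/cvgrPdist_lt => e e_gt0.
move/cvgrPdist_lt : ud => /(_ e e_gt0) /increments_near[r r0 H].
apply: (near_increments _ _ _ _ _ r0) => h hn0 hr Dh.
have := H h hn0 hr; rewrite !(addrCA (t *: e0)); apply.
by rewrite addrCA; exact: cylinder_shift.
Qed.

Lemma smooth_neumann_shift u u1 u2 (t : R) : smooth_neumann u u1 u2 ->
  smooth_neumann (fun x => u (t *: e0 + x)) (fun i x => u1 i (t *: e0 + x))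
    (fun i x => u2 i (t *: e0 + x)).
Proof.
move=> [cu uu1 u1u2 uN]; split.
- apply/within_continuousP => x Dx e e_gt0.
  move/within_continuousP : cu => /(_ _ (cylinder_shift _ _ t _ Dx) e e_gt0).
  move=> [r r0 H]; exists r => // y Dy xy; apply: H; first exact: cylinder_shift.
  by rewrite opprD addrACA subrr add0r.
- by move=> i x Dx; apply: is_rel_derive_shift; apply: uu1; exact: cylinder_shift.
- by move=> i x Dx; apply: (is_rel_derive_shift (u1 i)); apply: u1u2; exact: cylinder_shift.
- move=> i x i0 Dx xi; apply: uN => //; first exact: cylinder_shift.
  by rewrite coord_line (negPf i0) add0r.
Qed.

(** Where [u - v] is minimal the gradients agree, and the Laplacians are
    ordered. *)
Lemma wave_operator_at_min f beta u u1 u2 v v1 v2 x : 0 < L -> D x ->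
  smooth_neumann u u1 u2 -> smooth_neumann v v1 v2 ->
  (forall y, D y -> u x - v x <= u y - v y) -> f (v x) <= f (u x) ->
  wave_operator f beta v v1 v2 x <= wave_operator f beta u u1 u2 x.
Proof.
move=> L0 Dx [cu uu1 u1u2 uN] [cv vv1 v1v2 vN] xmin fuv.
have H i : u1 i x - v1 i x = 0 /\ 0 <= u2 i x - v2 i x.
  apply: (@cell_min_derivatives R L _ _ i (fun y => u y - v y)
    (fun y => u1 i y - v1 i y) x (u2 i x - v2 i x) L0 Dx xmin).
  - by move=> y Dy; apply: is_rel_deriveB; [exact: uu1|exact: vv1].
  - by apply: is_rel_deriveB; [exact: u1u2|exact: v1v2].
  - by move=> iJ xi; rewrite uN// vN// subr0.
have [/eqP] := H ord0; rewrite subr_eq0 => /eqP E _.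
rewrite /wave_operator E lerD// lerD2r; apply: ler_sum => i _.
by have [_] := H i; rewrite subr_ge0.
Qed.

Lemma negative_min_attained u v : {within D, continuous u} ->
  {within D, continuous v} -> front_limits u -> front_limits v ->
  (exists2 x, D x & u x - v x < 0) ->
  exists x, [/\ D x, u x - v x < 0 & forall y, D y -> u x - v x <= u y - v y].
Proof.
move=> cu cv [u01 ulim] [v01 vlim] [x0 Dx0 wx0].
pose e := - (u x0 - v x0).
have e_gt0 : 0 < e by rewrite oppr_gt0.
have [Xu Hu] := ulim _ e_gt0; have [Xv Hv] := vlim _ e_gt0.
have out x : D x -> u x - v x <= - e ->
    - Num.max Xu Xv <= x ord0 ord0 <= Num.max Xu Xv.
  move=> Dx ue; have [Hu1 Hu2] := Hu _ Dx; have [Hv1 Hv2] := Hv _ Dx.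
  have /andP[ux0 ux1] := u01 _ Dx; have /andP[vx0 vx1] := v01 _ Dx.
  apply/andP; split; rewrite leNgt; apply/negP.
  - move=> /ltW X0; have : v x < e.
      by apply: Hv1; rewrite (le_trans X0)// lerN2 le_max lexx orbT.
    by move: ue; lra.
  - move=> /ltW X0; have : 1 - e < u x.
      by apply: Hu2; rewrite (le_trans _ X0)// le_max lexx.
    by move: ue; lra.
have cw : {within [set x | D x /\ - Num.max Xu Xv <= x ord0 ord0 <= Num.max Xu Xv],
    continuous (fun x => u x - v x)}.
  apply: (@continuous_subspaceW _ _ _ D); first by move=> x [].
  by move=> x; apply: cvgB; [exact: cu|exact: cv].
have [|c] := @EVT_min_rV R m.+1 _ _ _ (compact_slab L m _ _) cw.
  by exists x0; split=> //; apply: out => //; rewrite /e opprK.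
rewrite inE => -[Dc cX] cmin.
have cx0 : u c - v c <= u x0 - v x0.
  by apply: cmin; rewrite inE; split=> //; apply: out => //; rewrite /e opprK.
exists c; split => //; first exact: le_lt_trans cx0 wx0.
move=> y Dy; have [yX|yX] := boolP
  (- Num.max Xu Xv <= y ord0 ord0 <= Num.max Xu Xv).
  by apply: cmin; rewrite inE.
rewrite (le_trans cx0)// ltW// ltNge; apply: contra yX => yx0.
by apply: out => //; rewrite /e opprK.
Qed.

(** The sliding method.  The translates of [u] by large amounts are above [v];
    the last one that is above [v] touches [v], and at the contact point the
    wave operators are in the wrong order.  The monotonicity of [f] near 0 and
    near 1 rules out that the contact happens at infinity. *)
Theorem sliding (f : R -> R) beta (eta : R) u u1 u2 v v1 v2 :
  0 < L -> 0 < eta ->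
  (forall a b : R, 0 <= a -> a <= b -> b <= eta -> f b <= f a) ->
  (forall a b : R, 1 - eta <= a -> a <= b -> b <= 1 -> f b <= f a) ->
  smooth_neumann u u1 u2 -> smooth_neumann v v1 v2 ->
  front_limits u -> front_limits v ->
  (forall x y, D x -> D y -> cross_section x = cross_section y ->
    wave_operator f beta u u1 u2 x < wave_operator f beta v v1 v2 y) ->
  False.
Proof.
move=> L0 eta0 f0 f1 su sv ulim vlim Ouv.
pose ut t := fun x => u (t *: e0 + x).
have sut t : smooth_neumann (ut t) (fun i x => u1 i (t *: e0 + x))
    (fun i x => u2 i (t *: e0 + x)) := smooth_neumann_shift _ _ _ t su.
have utlim t : front_limits (ut t).
  case: ulim => u01 ulim; split; first by move=> x Dx; apply: u01; exact: cylinder_shift.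
  move=> e e_gt0; have [X HX] := ulim _ e_gt0; exists (X + `|t|) => x Dx.
  have [H1 H2] := HX _ (cylinder_shift _ _ t _ Dx).
  have [? ?] : t <= `|t| /\ - t <= `|t| by rewrite -{2}normrN !ler_norm.
  by split => Hx; [apply: H1|apply: H2]; rewrite coord_line eqxx; lra.
have touch t x : D x -> (forall y, D y -> ut t x - v x <= ut t y - v y) ->
    f (v x) <= f (ut t x) -> False.
  move=> Dx xmin fx.
  have := wave_operator_at_min f beta _ _ _ _ _ _ _ L0 Dx (sut t) sv xmin fx.
  have := Ouv (t *: e0 + x) x (cylinder_shift _ _ _ _ Dx) Dx
    (cross_section_shift _ _ _).
  by rewrite /wave_operator cross_section_shift; lra.
have [Xu Hu] : exists X, forall x, D x -> X <= x ord0 ord0 -> 1 - eta < u x.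
  by have [X H] := ulim.2 _ eta0; exists X => x /H[].
have [Xv Hv] : exists X, forall x, D x -> x ord0 ord0 <= - X -> v x < eta.
  by have [X H] := vlim.2 _ eta0; exists X => x /H[].
(* If a translate is above [v] wherever neither of the two monotonicity
   regions of [f] applies, then it is above [v] everywhere. *)
have above t : (forall x, D x -> - Xv <= x ord0 ord0 ->
      0 <= ut t x - v x \/ 1 - eta <= ut t x) ->
    forall x, D x -> 0 <= ut t x - v x.
  move=> Ht x Dx; rewrite leNgt; apply/negP => wx.
  have [c [Dc wc cmin]] : exists c, [/\ D c, ut t c - v c < 0 &
      forall y, D y -> ut t c - v c <= ut t y - v y].
    case: (sut t) => cut _ _ _; case: sv => cv _ _ _.
    by apply: negative_min_attained => //; exists x.
  apply: (touch t c Dc cmin).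
  have /andP[ut0 ut1] := (utlim t).1 _ Dc; have /andP[v0 v1'] := vlim.1 _ Dc.
  have [cX|cX] := leP (- Xv) (c ord0 ord0).
    by have [|ut_eta] := Ht _ Dc cX; [lra|apply: f1 => //; lra].
  by have := Hv _ Dc (ltW cX) => v_eta; apply: f0 => //; lra.
pose S := [set t | forall x, D x -> 0 <= ut t x - v x].
have S0 : S (Xu + Xv).
  apply: above => x Dx xX; right; apply/ltW/Hu; first exact: cylinder_shift.
  by rewrite coord_line eqxx; lra.
have D0 t : D (t *: e0).
  rewrite -[X in D X]addr0; apply: cylinder_shift => i _; rewrite mxE lexx/=.
  exact: ltW.
have half : (0 : R) < 2^-1 by rewrite invr_gt0.
have [X1 HX1] := ulim.2 _ half; have [X2 HX2] := vlim.2 _ half.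
have Slb : lbound S (- X1 - X2).
  move=> t St; rewrite leNgt; apply/negP => tX.
  have [_ H2] := HX2 _ (D0 X2).
  have [H1 _] := HX1 _ (cylinder_shift _ _ t _ (D0 X2)).
  have E : (X2 *: e0) ord0 ord0 = X2 by rewrite !mxE !eqxx /= mulr1.
  have {}H2 : 1 - 2^-1 < v (X2 *: e0) by apply: H2; rewrite E.
  have {}H1 : u (t *: e0 + X2 *: e0) < 2^-1.
    by apply: H1; rewrite coord_line eqxx E; lra.
  by have := St _ (D0 X2); rewrite /ut; lra.
have Sinf : has_inf S by split; [exists (Xu + Xv)|exists (- X1 - X2)].
set ts := inf S.
have Sts : S ts.
  move=> x Dx; rewrite leNgt; apply/negP => wx.
  have cut : {for ts, continuous (fun t : R => u (t *: e0 + x))}.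
    apply: (@derivative_continuous R _ _ (u1 ord0 (ts *: e0 + x))).
    apply: (@is_rel_derive_line _ _ D e0 u x _ (ts - 1) (ts + 1)).
    - by apply/andP; split; lra.
    - by move=> s _; exact: cylinder_shift.
    - by case: su => _ + _ _; apply; exact: cylinder_shift.
  have d0 : 0 < v x - u (ts *: e0 + x) by rewrite /ut in wx; lra.
  move/cvgrPdist_lt : cut => /(_ _ d0) /= [r /= r0 H].
  have [t St tts] := inf_adherent r0 Sinf.
  have tsl : ts <= t by apply: ge_inf => //; case: Sinf.
  have {}H := H t; have := St _ Dx; rewrite /ut => St0.
  have : `|u (ts *: e0 + x) - u (t *: e0 + x)| < v x - u (ts *: e0 + x).
    by apply: H; rewrite /= ler0_norm; lra.
  by rewrite ltr_norml => /andP[]; lra.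
have pos x : D x -> 0 < ut ts x - v x.
  move=> Dx; rewrite lt_neqAle Sts// andbT eq_sym; apply/eqP => wx.
  apply: (touch ts x Dx); first by move=> y Dy; rewrite wx Sts.
  by move/eqP : wx; rewrite subr_eq0 => /eqP ->.
pose K := [set x | D x /\ - Xv <= x ord0 ord0 <= Xu - ts + 1].
have cK : compact K := compact_slab L m _ _.
(* By compactness the translates slightly below the critical one are still
   above [v] on the middle part, hence everywhere. *)
have : \forall t \near ts, K `<=` [set x | D x -> 0 < ut t x - v x].
  move/compact_near_coveringP : cK.
  apply: (_ : near_covering K -> _) => /(_ R (nbhs ts)
    (fun t x => D x -> 0 < ut t x - v x) _); apply => x [Dx _].
  have := pos _ Dx; rewrite /ut => wx.
  pose e := (u (ts *: e0 + x) - v x) / 2.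
  have e_gt0 : 0 < e by rewrite divr_gt0.
  case: su => cu _ _ _; case: sv => cv _ _ _.
  move/within_continuousP : cu => /(_ _ (cylinder_shift _ _ ts _ Dx) e e_gt0).
  move=> [r1 r10 H1].
  move/within_continuousP : cv => /(_ _ Dx e e_gt0) [r2 r20 H2].
  pose c := `|e0| + 1; have c0 : 0 < c by rewrite ltr_wpDl.
  exists (ball x (Num.min r2 (r1 / 2)), ball ts (r1 / 2 / c)) => /=.
    by split; apply: nbhsx_ballx; rewrite ?lt_min ?r20 ?divr_gt0.
  move=> [y t] [/=]; rewrite -ball_normE /= lt_min => /andP[yx2 yx1].
  rewrite -ball_normE /= ltr_pdivlMr// => tts Dy.
  have K1 : `|v x - v y| < e by exact: H2.
  have K2 : `|u (ts *: e0 + x) - u (t *: e0 + y)| < e.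
    apply: H1; first exact: cylinder_shift.
    rewrite opprD addrACA -scalerBl.
    apply: (le_lt_trans (ler_normD _ _)); rewrite normrZ.
    have : `|ts - t| * `|e0| <= `|ts - t| * c by rewrite ler_wpM2l// lerDl.
    by lra.
  by move: K1 K2; rewrite !ltr_norml /e => /andP[? ?] /andP[? ?]; lra.
move=> [r /= r0 Hr].
have q0 : 0 < Num.min (r / 2) 1 by rewrite lt_min divr_gt0 ?ltr01.
have qr : Num.min (r / 2) 1 <= r / 2 by rewrite ge_min lexx.
have q1 : Num.min (r / 2) 1 <= 1 by rewrite ge_min lexx orbT.
move: q0 qr q1; set q := Num.min _ _ => q0 qr q1; pose t := ts - q.
have tr : `|ts - t| < r by rewrite /t opprB addrCA subrr addr0 gtr0_norm//; lra.
have t1 : ts - 1 <= t by rewrite /t; lra.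
have tlt : t < ts by rewrite /t; lra.
have : S t.
  apply: above => x Dx xX.
  have [xX2|xX2] := leP (x ord0 ord0) (Xu - ts + 1).
    by left; apply/ltW; apply: (Hr t tr) => //; split=> //; rewrite xX.
  right; apply/ltW/Hu; first exact: cylinder_shift.
  by rewrite coord_line eqxx; lra.
have /ge_inf inf_le : has_lbound S by case: Sinf.
by move=> /inf_le; rewrite leNgt tlt.
Qed.

End comparison.

(** * The planar front *)

Section growth.
Context {R : realType}.
Implicit Types (h dh : R -> R) (s : R).

Lemma gronwall h dh (k a b : R) : (forall s, is_derive s 1 h (dh s)) ->
  a <= b -> (forall s, a <= s <= b -> dh s <= k * h s) ->
  h b <= h a * expR (k * (b - a)).
Proof.
move=> hdh ab dhk.
pose g s := h s * expR (- (k * (s - a))).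
pose dg s := (dh s - k * h s) * expR (- (k * (s - a))).
have gdg s : is_derive s 1 g (dg s).
  rewrite /g /dg; have hs := hdh s.
  apply: is_derive_eq; rewrite /GRing.scale /=; ring.
have := derivative_le g dg a b 0 gdg ab.
rewrite mul0r subr_le0 /g subrr mulr0 oppr0 expR0 mulr1 => H.
have {}H : h b * expR (- (k * (b - a))) <= h a.
  apply: H => s sab; rewrite /dg pmulr_lle0 ?expR_gt0// subr_le0; exact: dhk.
rewrite -[h b]mulr1 -(expRxMexpNx_1 (k * (b - a))) (mulrC (expR (k * _))) mulrA.
by rewrite ler_pM2r ?expR_gt0.
Qed.

Lemma gronwall_ge h dh (k a b : R) : (forall s, is_derive s 1 h (dh s)) ->
  a <= b -> (forall s, a <= s <= b -> k * h s <= dh s) ->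
  h a * expR (k * (b - a)) <= h b.
Proof.
move=> hdh ab dhk; rewrite -lerN2 -mulNr.
apply: (gronwall (fun s => - h s) (fun s => - dh s) k a b _ ab).
by move=> s sab /=; rewrite mulrN lerN2 dhk.
Qed.

Lemma expR_quadratic (x : R) : 0 <= x -> x ^+ 2 / 4 <= expR x.
Proof.
move=> x0; have -> : expR x = expR (x / 2) ^+ 2.
  by rewrite expr2 -expRD; congr expR; field.
have H : 1 + x / 2 <= expR (x / 2) by apply: expR_ge1Dx.
have : (x / 2) ^+ 2 <= expR (x / 2) ^+ 2.
  by rewrite ler_sqr ?nnegrE ?expR_ge0 ?divr_ge0//; lra.
by apply: le_trans; rewrite le_eqVlt; apply/orP; left; apply/eqP; field.
Qed.

End growth.

Section planar_front_facts.
Context {R : realType}.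
Implicit Types (f U : R -> R) (s x e : R).

(** The common properties of bistable and combustion nonlinearities: this one
    serves the construction of the test functions, whose values lie strictly
    between 0 and 1, and [stable_ends] the comparison of fronts. *)
Set Implicit Arguments.
Record regular_reaction f (f1 f2 : R -> R) (K : R) : Prop := RegularReaction {
  reaction_derive : forall u : R, 0 < u < 1 -> is_derive u 1 f (f1 u);
  reaction_derive2 : forall u : R, 0 < u < 1 -> is_derive u 1 f1 (f2 u);
  reaction_bound : forall u : R, 0 < u < 1 -> `|f1 u| <= K;
  reaction_bound2 : forall u : R, 0 < u < 1 -> `|f2 u| <= K;
  reaction_cont2 : forall u : R, 0 < u < 1 -> {for u, continuous f2} }.
Unset Implicit Arguments.

Definition stable_ends f : Prop := exists2 eta : R, 0 < eta &
  (forall a b : R, 0 <= a -> a <= b -> b <= eta -> f b <= f a) /\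
  (forall a b : R, 1 - eta <= a -> a <= b -> b <= 1 -> f b <= f a).

(** The profile [V] of a planar front for the diffusion coefficient [a].  The
    fourth derivative is needed because the main part of the corrector is a
    multiple of [V2]; every derivative is compared with the slope [V1], since
    errors will be measured by the change of speed that compensates them. *)
Set Implicit Arguments.
Record front_profile f (f1 f2 : R -> R) (a c Q : R) (V V1 V2 V3 V4 : R -> R) :
    Prop := FrontProfile {
  profile_derive : forall s : R, is_derive s 1 V (V1 s);
  profile_derive1 : forall s : R, is_derive s 1 V1 (V2 s);
  profile_derive2 : forall s : R, is_derive s 1 V2 (V3 s);
  profile_derive3 : forall s : R, is_derive s 1 V3 (V4 s);
  profile_eq : forall s, a * V2 s - c * V1 s + f (V s) = 0;
  profile_eq1 : forall s, a * V3 s - c * V2 s + f1 (V s) * V1 s = 0;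
  profile_eq2 : forall s,
    a * V4 s - c * V3 s + f1 (V s) * V2 s + f2 (V s) * V1 s ^+ 2 = 0;
  profile_gt0 : forall s, 0 < V s;
  profile_lt1 : forall s, V s < 1;
  profile_incr : forall s, 0 < V1 s;
  profile_bound1 : forall s, V1 s <= Q;
  profile_bound2 : forall s, `|V2 s| <= Q * V1 s;
  profile_bound3 : forall s, `|V3 s| <= Q * V1 s;
  profile_bound4 : forall s, `|V4 s| <= Q * V1 s;
  profile_left : forall s, V1 s <= Q * V s;
  profile_right : forall s, V1 s <= Q * (1 - V s);
  profile_limits : forall e, 0 < e -> exists X : R, forall s,
    (s <= - X -> V s < e) /\ (X <= s -> 1 - e < V s) }.
Unset Implicit Arguments.

(** Harnack inequality: |(log p)'| <= Q. *)
Lemma log_derivative_harnack (p dp : R -> R) (Q s t : R) :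
  (forall x, is_derive x 1 p (dp x)) -> (forall x, `|dp x| <= Q * p x) ->
  p s <= expR (Q * `|s - t|) * p t.
Proof.
move=> pdp pQ; have [ts|st] := leP t s.
  rewrite ger0_norm ?subr_ge0// mulrC; apply: gronwall pdp ts _ => x _.
  exact: le_trans (ler_norm _) (pQ x).
have := @gronwall_ge _ p dp (- Q) s t pdp (ltW st).
rewrite ltr0_norm ?subr_lt0// opprB => H.
have {}H : p s * expR (- Q * (t - s)) <= p t.
  apply: H => x _; rewrite mulNr lerNl; apply: le_trans (pQ x).
  by rewrite -normrN ler_norm.
rewrite -[p s]mulr1 -(expRxMexpNx_1 (Q * (t - s))) mulrCA ler_pM2l ?expR_gt0//.
by rewrite -mulNr.
Qed.

Lemma increasing_between (V V1 : R -> R) :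
  (forall s, is_derive s 1 V (V1 s)) -> (forall s, 0 < V1 s) ->
  V s @[s --> -oo] --> (0 : R) -> V s @[s --> +oo] --> (1 : R) ->
  forall s, 0 < V s < 1.
Proof.
move=> VV1 V1_gt0 V0 V1_.
have Vlt a b : a < b -> V a < V b.
  move=> ab; have [c _] := mean_value V V1 a b VV1.
  rewrite -subr_gt0 => ->; rewrite mulr_gt0 ?subr_gt0//.
move=> s; apply/andP; split; rewrite ltNge; apply/negP => H.
- have d0 : 0 < V s - V (s - 1) by rewrite subr_gt0 Vlt//; lra.
  move/cvgrPdist_lt : V0 => /(_ _ d0) [M [_ HM]].
  pose r := Num.min M (s - 1) - 1.
  have rM : r < M by rewrite /r ltrBlDr gt_min; apply/orP; left; lra.
  have rs : r < s - 1 by rewrite /r ltrBlDr gt_min; apply/orP; right; lra.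
  have := HM r rM; have := Vlt _ _ rs.
  by rewrite /= sub0r normrN ltr_norml => ? /andP[]; lra.
- have d0 : 0 < V (s + 1) - V s by rewrite subr_gt0 Vlt//; lra.
  move/cvgrPdist_lt : V1_ => /(_ _ d0) [M [_ HM]].
  pose r := Num.max M (s + 1) + 1.
  have rM : M < r by rewrite /r -ltrBlDr lt_max; apply/orP; left; lra.
  have rs : s + 1 < r by rewrite /r -ltrBlDr lt_max; apply/orP; right; lra.
  have := HM r rM; have := Vlt _ _ rs.
  by rewrite /= ltr_norml => ? /andP[]; lra.
Qed.

(** The logarithmic derivative of [p] = U' stays bounded: [p] solves a linear
    equation of second order, and where p' > Q p the difference p' - Q p would
    grow backwards in time, hence make [p] negative; similarly forwards where
    p' < - Q p. *)
Lemma log_derivative_bound (p dp ddp r : R -> R) (c K : R) :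
  (forall s, is_derive s 1 p (dp s)) -> (forall s, is_derive s 1 dp (ddp s)) ->
  (forall s, ddp s = c * dp s - r s * p s) -> (forall s, `|r s| <= K) ->
  (forall s, 0 < p s) ->
  forall s, `|dp s| <= (`|c| + K + 1) * p s.
Proof.
move=> pd dpd ddpE rK p0.
have K0 : 0 <= K := le_trans (normr_ge0 _) (rK 0).
set Q := `|c| + K + 1.
have [? ?] : c <= `|c| /\ - c <= `|c| by rewrite -{2}normrN !ler_norm.
have c0 : 0 <= `|c| := normr_ge0 c.
have QcK : K <= (Q - c) * Q.
  apply: (@le_trans _ _ (1 * Q)); first by rewrite /Q; lra.
  by rewrite ler_wpM2r// /Q; lra.
have QcK' : K <= (Q + c) * Q.
  apply: (@le_trans _ _ (1 * Q)); first by rewrite /Q; lra.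
  by rewrite ler_wpM2r// /Q; lra.
have rp s : `|r s * p s| <= K * p s.
  by rewrite normrM (gtr0_norm (p0 s)) ler_wpM2r// ltW.
move=> s0; rewrite ler_norml; apply/andP; split; rewrite leNgt; apply/negP => H.
- pose g s := dp s + Q * p s; pose dg s := ddp s + Q * dp s.
  have gdg s : is_derive s 1 g (dg s).
    rewrite /g /dg; have ps := pd s; have dps := dpd s.
    by apply: is_derive_eq; rewrite /GRing.scale /=; ring.
  have gneg : g s0 < 0 by rewrite /g; lra.
  have gle s : s0 <= s -> g s <= g s0.
    move=> ss; apply: le_trans (gronwall g dg (c + Q) _ _ gdg ss _) _.
      move=> x _; rewrite /dg /g ddpE.
      have := rp x; rewrite ler_norml => /andP[? _].
      have : K * p x <= (Q + c) * Q * p x by rewrite ler_pM2r.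
      by lra.
    rewrite -[X in _ <= X]mulr1 ler_nM2l// -[X in X <= _]expR0 ler_expR.
    by apply: mulr_ge0; rewrite /Q; lra.
  have dple s : s0 <= s -> dp s <= g s0.
    move=> ss; have := gle s ss; rewrite {1}/g.
    have : 0 <= Q * p s by rewrite mulr_ge0 ?ltW//; rewrite /Q; lra.
    by lra.
  pose t := s0 - p s0 / g s0.
  have st : s0 <= t.
    by rewrite /t lerDl oppr_ge0 ltW// pmulr_rlt0// invr_lt0.
  have := derivative_le p dp s0 t (g s0) pd st (fun x xs => dple x (proj1 (andP xs))).
  rewrite {2}/t addrAC subrr add0r mulrN mulrC divfK ?lt_eqF//.
  by have := p0 t; lra.
- pose g s := dp s - Q * p s; pose dg s := ddp s - Q * dp s.
  have gdg s : is_derive s 1 g (dg s).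
    rewrite /g /dg; have ps := pd s; have dps := dpd s.
    by apply: is_derive_eq; rewrite /GRing.scale /=; ring.
  have gpos : 0 < g s0 by rewrite /g; lra.
  have gge s : s <= s0 -> g s0 <= g s.
    move=> ss; have := gronwall g dg (c - Q) _ _ gdg ss.
    have dgg x : s <= x <= s0 -> dg x <= (c - Q) * g x.
      move=> _; rewrite /dg /g ddpE.
      have := rp x; rewrite ler_norml => /andP[_ ?].
      have : K * p x <= (Q - c) * Q * p x by rewrite ler_pM2r.
      have := rp x; rewrite ler_norml => /andP[? _].
      by lra.
    move=> /(_ dgg) gs.
    have gs0 : 0 < g s.
      by have := lt_le_trans gpos gs; rewrite pmulr_lgt0 ?expR_gt0.
    apply: (le_trans gs); rewrite -[X in _ <= X]mulr1 ler_pM2l// expR_le1.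
    by rewrite mulr_le0_ge0 ?subr_ge0//; rewrite /Q; lra.
  have dpge s : s <= s0 -> g s0 <= dp s.
    move=> ss; have := gge s ss; rewrite {2}/g.
    have : 0 <= Q * p s by rewrite mulr_ge0 ?ltW//; rewrite /Q; lra.
    by lra.
  pose t := s0 - p s0 / g s0.
  have st : t <= s0 by rewrite /t gerDl oppr_le0 divr_ge0 ?ltW.
  have := derivative_ge p dp t s0 (g s0) pd st (fun x xs => dpge x (proj2 (andP xs))).
  rewrite {1}/t opprB addrCA subrr addr0 mulrC divfK ?gt_eqF//.
  by have := p0 t; lra.
Qed.

End planar_front_facts.

Section reactions.
Context {R : realType}.
Implicit Types (f U : R -> R) (s x e u : R).

Lemma bistable_regular f : bistable f ->
  exists f1 f2 K, regular_reaction f f1 f2 K.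
Proof.
move=> [mu /andP[mu0 mu1] fE].
have -> : f = fun u => u * (1 - u) * (u - mu) by exact/funext.
exists (fun u => - (3 * (u * u)) + 2 * (1 + mu) * u - mu),
  (fun u => - (6 * u) + 2 * (1 + mu)), 10; split => u /andP[u0 u1].
- by apply: is_derive_eq; rewrite /GRing.scale /=; ring.
- by apply: is_derive_eq; rewrite /GRing.scale /=; ring.
- by rewrite ler_norml; apply/andP; split; nra.
- by rewrite ler_norml; apply/andP; split; nra.
- by apply: differentiable_continuous; apply/derivable1_diffP.
Qed.

Lemma bistable_stable_ends f : bistable f -> stable_ends f.
Proof.
move=> [mu /andP[mu0 mu1] fE]; exists (mu / 4); first by rewrite divr_gt0.
split=> a b; rewrite !fE => a0 ab b1; rewrite -subr_ge0.
- have -> : a * (1 - a) * (a - mu) - b * (1 - b) * (b - mu) =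
    (b - a) * (a ^+ 2 + a * b + b ^+ 2 - (1 + mu) * (a + b) + mu) by ring.
  apply: mulr_ge0; first by rewrite subr_ge0.
  have : (1 + mu) * (a + b) <= 2 * (mu / 2) by apply: ler_pM; lra.
  have : 0 <= a * b by rewrite mulr_ge0//; lra.
  by have := sqr_ge0 a; have := sqr_ge0 b; lra.
- have -> : a * (1 - a) * (a - mu) - b * (1 - b) * (b - mu) =
    (b - a) * ((1 - a) ^+ 2 + (1 - a) * (1 - b) + (1 - b) ^+ 2 -
       (2 - mu) * ((1 - a) + (1 - b)) + (1 - mu)) by ring.
  apply: mulr_ge0; first by rewrite subr_ge0.
  have : (2 - mu) * ((1 - a) + (1 - b)) <= 2 * (mu / 2) by apply: ler_pM; lra.
  have : 0 <= (1 - a) * (1 - b) by rewrite mulr_ge0//; lra.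
  by have := sqr_ge0 (1 - a); have := sqr_ge0 (1 - b); lra.
Qed.

(** For a combustion nonlinearity the derivatives relative to [0, 1] are the
    usual ones inside, and stay bounded by compactness. *)
Lemma combustion_regular f : combustion f ->
  exists f1 f2 K, [/\ regular_reaction f f1 f2 K,
    {within `[0, 1], continuous f} & {within `[0, 1], continuous f1}].
Proof.
move=> [mu _ [_ _ _ [cf /(_ 1 erefl)[fd [cf1 /(_ 1 erefl)[f1d [cf2 _]]]]]]].
set f1 : R -> R := rel_derive _ _ f in f1d cf1 cf2 *.
set f2 : R -> R := rel_derive _ _ f1 in cf2 *.
have bnd (g : R -> R) : {within `[0, 1], continuous g} ->
    exists K, forall u, 0 <= u <= 1 -> `|g u| <= K.
  move=> cg.
  have /compact_bounded [M [_ HM]] :=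
    continuous_compact cg (@segment_compact R 0 1).
  exists (M + 1) => u u01; apply: (HM (M + 1)); first by lra.
  by exists u => //=; rewrite in_itv.
have [K1 HK1] := bnd _ cf1; have [K2 HK2] := bnd _ cf2.
have inner (g dg : R -> R) : (forall u, (`[0, 1]%classic : set R^o) u ->
      is_rel_derive (`[0, 1]%classic : set R^o) 1 g u (dg u)) ->
    forall u, 0 < u < 1 -> is_derive u 1 g (dg u).
  move=> gdg u u01.
  have := @is_rel_derive_line R R^o `[0, 1]%classic 1 g 0 (dg u) 0 1 u u01.
  have E (t : R) : t *: (1 : R^o) + 0 = t by rewrite addr0 /GRing.scale /= mulr1.
  rewrite E (_ : (fun t => g (t *: (1 : R^o) + 0)) = g); last first.
    by apply/funext => t; rewrite E.
  apply; first by move=> t t01; rewrite E /= in_itv.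
  apply: gdg => /=; rewrite in_itv/=.
  by case/andP: u01 => /ltW-> /ltW->.
exists f1, f2, (Num.max K1 K2); split => //; split.
- by apply: inner => u u01; exact: fd.
- by apply: inner => u u01; exact: f1d.
- move=> u /andP[/ltW u0 /ltW u1]; rewrite le_max; apply/orP; left.
  by apply: HK1; rewrite u0.
- move=> u /andP[/ltW u0 /ltW u1]; rewrite le_max; apply/orP; right.
  by apply: HK2; rewrite u0.
- move=> u /andP[u0 u1]; have [+ _ _] := (continuous_within_itvP f2 ltr01).1 cf2.
  by apply; rewrite in_itv/= u0.
Qed.

Section planar.
Variables (f U : R -> R) (c0 : R).
Hypothesis Ufront : planar_front f c0 U.

Lemma planar_derive s : is_derive s 1 U (derive1 U s).
Proof. by case: Ufront => /(_ s)[? _] _ _ _ _; rewrite derive1E; exact: derivableP. Qed.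

Lemma planar_derive1 s : is_derive s 1 (derive1 U) (c0 * derive1 U s - f (U s)).
Proof.
case: Ufront => /(_ s)[_ d] /(_ s) e _ _ _.
have -> : c0 * derive1 U s - f (U s) = derive1n 2 U s.
  by move: e; lra.
by rewrite /= [X in is_derive _ _ _ X]derive1E; exact: derivableP.
Qed.

Lemma planar_between s : 0 < U s < 1.
Proof.
case: Ufront => _ _ [U0 U1] Uincr _.
exact: (increasing_between U _ planar_derive Uincr U0 U1).
Qed.

(** If the derivative of [f] at the stable state 1 vanished, then f would be
    quadratically small there, U would approach 1 only like 1 / s, and the
    exponential rate would fail. *)
Lemma combustion_slope (f1 f2 : R -> R) (K : R) : regular_reaction f f1 f2 K ->
  {within `[0, 1], continuous f} -> {within `[0, 1], continuous f1} ->
  combustion f -> f1 1 < 0.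
Proof.
move=> [fd f1d fK f2K _] cf cf1 [mu /andP[mu0 mu1] [fmu fpos fone _]].
rewrite ltNge; apply/negP => f1_ge0.
have K0 : 0 <= K.
  by apply: le_trans (normr_ge0 _) (fK 2^-1 _); apply/andP; split; lra.
have f1_low u : 0 < u < 1 -> - (K * (1 - u)) <= f1 u.
  move=> /andP[u0 u1].
  have c1 : {within `[u, 1], continuous f1}.
    by apply: continuous_subspaceW cf1 => x /=; rewrite !in_itv/= => /andP[]; lra.
  have d1 x : x \in `]u, 1[%R -> is_derive x 1 f1 (f2 x).
    by rewrite in_itv/= => /andP[ux x1]; apply: f1d; apply/andP; split; lra.
  have [x] := MVT u1 d1 c1; rewrite in_itv/= => /andP[ux x1] E.
  have : f2 x * (1 - u) <= K * (1 - u).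
    rewrite ler_wpM2r//; first lra.
    by apply: le_trans (ler_norm _) (f2K x _); apply/andP; split; lra.
  by lra.
have f_up u : 0 < u < 1 -> f u <= K * (1 - u) ^+ 2.
  move=> /andP[u0 u1].
  have c1 : {within `[u, 1], continuous f}.
    by apply: continuous_subspaceW cf => x /=; rewrite !in_itv/= => /andP[]; lra.
  have d1 x : x \in `]u, 1[%R -> is_derive x 1 f (f1 x).
    by rewrite in_itv/= => /andP[ux x1]; apply: fd; apply/andP; split; lra.
  have [x] := MVT u1 d1 c1; rewrite in_itv/= fone => /andP[ux x1] E.
  have x01 : 0 < x < 1 by apply/andP; split; lra.
  have : - (K * (1 - u)) * (1 - u) <= f1 x * (1 - u).
    rewrite ler_wpM2r//; first lra.
    apply: le_trans (f1_low x x01); rewrite lerN2 ler_wpM2l//; lra.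
  by rewrite expr2; lra.
case: Ufront => _ _ [U0 U1] Uincr [M [lam lam0 [_ Mright]]].
have Ub := planar_between.
have f_ge0 s : 0 <= f (U s).
  have /andP[u0 u1] := Ub s.
  have [umu|umu] := leP (U s) mu; first by rewrite fmu// ltW.
  by apply/ltW/fpos; rewrite umu.
pose p := derive1 U.
have pd s : is_derive s 1 p (c0 * p s - f (U s)) := planar_derive1 s.
have Ud s : is_derive s 1 U (p s) := planar_derive s.
(* A non-positive speed would make U' decrease while U stays bounded. *)
have c0_gt0 : 0 < c0.
  rewrite ltNge; apply/negP => c0_le0.
  have ple s : s <= 0 -> p 0 <= p s.
    move=> s0; have := derivative_le p _ s 0 0 pd s0.
    rewrite mul0r subr_le0; apply=> x _.
    have : c0 * p x <= 0 by rewrite mulr_le0_ge0// ltW// Uincr.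
    by have := f_ge0 x; lra.
  have p0 : 0 < p 0 := Uincr 0.
  pose t := - (p 0)^-1.
  have t0 : t <= 0 by rewrite /t oppr_le0 invr_ge0 ltW.
  have := derivative_ge U p t 0 (p 0) Ud t0
    (fun x xt => ple x (proj2 (andP xt))).
  rewrite /t sub0r opprK mulfV ?gt_eqF//.
  by have /andP[] := Ub 0; have /andP[] := Ub (- (p 0)^-1); lra.
pose C := K / c0.
have C0 : 0 <= C by rewrite divr_ge0// ltW.
have pC s : p s <= C * (1 - U s) ^+ 2.
  rewrite leNgt; apply/negP => Hs.
  pose h x := p x - C * (1 - U x) ^+ 2.
  pose dh x := c0 * p x - f (U x) + 2 * C * (1 - U x) * p x.
  have hdh x : is_derive x 1 h (dh x).
    have px := pd x; have Ux := Ud x; rewrite /h /dh.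
    have -> : (fun x => p x - C * (1 - U x) ^+ 2) =
      (fun x => p x - C * ((1 - U x) * (1 - U x))).
      by apply/funext => y; rewrite expr2.
    by apply: is_derive_eq; rewrite /GRing.scale /=; ring.
  have hs : 0 < h s by rewrite /h subr_gt0.
  have hge x : s <= x -> h s <= h x.
    move=> sx; apply: le_trans (gronwall_ge h dh c0 _ _ hdh sx _).
      rewrite -[X in X <= _]mulr1 ler_pM2l// -[X in X <= _]expR0 ler_expR.
      by rewrite mulr_ge0 ?subr_ge0// ltW.
    move=> y _; rewrite /h /dh /C.
    have /andP[y0 y1] := Ub y.
    have := f_up _ (Ub y).
    have : 0 <= 2 * (K / c0) * (1 - U y) * p y.
      rewrite mulr_ge0//; last exact/ltW/Uincr.
      by rewrite mulr_ge0//; [rewrite mulr_ge0|lra].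
    have -> : c0 * (p y - K / c0 * (1 - U y) ^+ 2) =
      c0 * p y - K * (1 - U y) ^+ 2 by field; rewrite gt_eqF.
    by lra.
  have pge x : s <= x -> h s <= p x.
    move=> sx; have := hge x sx; rewrite {2}/h.
    have : 0 <= C * (1 - U x) ^+ 2 by rewrite mulr_ge0 ?sqr_ge0.
    by lra.
  pose t := s + (h s)^-1.
  have st : s <= t by rewrite lerDl invr_ge0 ltW.
  have := derivative_ge U p s t (h s) Ud st
    (fun x xt => pge x (proj1 (andP xt))).
  rewrite /t addrAC subrr add0r mulfV ?gt_eqF//.
  by have /andP[] := Ub s; have /andP[] := Ub (s + (h s)^-1); lra.
pose d s := 1 - U s.
have d0 s : 0 < d s by rewrite subr_gt0; case/andP: (Ub s).
have dinv s : is_derive s 1 (fun x => (d x)^-1) (p s / d s ^+ 2).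
  have Us := Ud s.
  have ds : is_derive s 1 d (- p s).
    by rewrite /d; apply: is_derive_eq; rewrite /GRing.scale /=; ring.
  have dn0 : d s != 0 by rewrite gt_eqF.
  have := @realfun.is_deriveV R d s (- p s) 1 dn0 ds.
  move=> H; apply: (is_derive_eq H).
  by rewrite /GRing.scale /=; field.
have d_lin s : 0 <= s -> (d s)^-1 <= (d 0)^-1 + C * s.
  move=> s0; have := derivative_le _ _ 0 s C dinv s0; rewrite subr0.
  rewrite lerBlDl; apply=> x _; rewrite ler_pdivrMr ?exprn_gt0 ?d0//.
have M0 : 0 < M.
  have := Mright 0 (lexx _); rewrite mulr0 oppr0 expR0 mulr1.
  by apply: lt_le_trans; rewrite normr_gt0 gt_eqF// d0.
have grow s : 0 <= s -> expR (lam * s) <= M * ((d 0)^-1 + C * s).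
  move=> s0; apply: le_trans (_ : _ <= M * (d s)^-1) _; last first.
    by rewrite ler_pM2l// d_lin.
  have := Mright s s0; rewrite gtr0_norm ?d0// -/(d s) expRN.
  by rewrite ler_pdivlMr ?expR_gt0// ler_pdivlMr ?d0// mulrC.
pose A := M * ((d 0)^-1 + C).
have A0 : 0 < A by rewrite mulr_gt0// ltr_pwDl// invr_gt0.
pose t := 1 + 4 * A / lam ^+ 2.
have t1 : 1 <= t by rewrite lerDl divr_ge0 ?sqr_ge0// mulr_ge0// ltW.
have t0 : 0 < t by lra.
have lt0 : 0 <= lam * t by rewrite mulr_ge0 ?ltW.
have H := le_trans (expR_quadratic _ lt0) (grow t (ltW t0)).
have At : M * ((d 0)^-1 + C * t) <= A * t.
  rewrite /A -mulrA ler_pM2l// mulrDl lerD2r.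
  by rewrite ler_peMr// invr_ge0 ltW.
have : lam ^+ 2 * t / 4 <= A.
  rewrite -(ler_pM2r t0); apply: le_trans At; apply: le_trans H.
  by rewrite le_eqVlt; apply/orP; left; apply/eqP; field.
have -> : lam ^+ 2 * t / 4 = lam ^+ 2 / 4 + A.
  by rewrite /t; field; rewrite gt_eqF.
have : 0 < lam ^+ 2 by rewrite exprn_gt0.
by lra.
Qed.

End planar.

Lemma combustion_stable_ends f (f1 f2 : R -> R) (K : R) :
  regular_reaction f f1 f2 K ->
  {within `[0, 1], continuous f} -> {within `[0, 1], continuous f1} ->
  f1 1 < 0 -> combustion f -> stable_ends f.
Proof.
move=> [fd _ _ _ _] cf cf1 f1_neg [mu /andP[mu0 mu1] [fmu _ _ _]].
have I1 : `[0, 1]%classic (1 : R) by rewrite /= in_itv/= ler01 lexx.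
have [r r0 Hr] := (within_continuousP _ _).1 cf1 1 I1 (- f1 1)
  ltac:(by rewrite oppr_gt0).
have f1_neg' u : 0 <= u <= 1 -> 1 - u < r -> f1 u < 0.
  move=> /andP[u0 u1] ur; have := Hr u; rewrite /= in_itv/= u0 u1.
  move=> /(_ isT); rewrite ger0_norm ?subr_ge0// => /(_ ur).
  by rewrite ltr_norml => /andP[]; lra.
pose eta := Num.min mu (Num.min (r / 2) 2^-1).
have e1 : eta <= mu by rewrite /eta ge_min lexx.
have e2 : eta <= r / 2 by rewrite /eta !ge_min lexx !orbT.
have e3 : eta <= 2^-1 by rewrite /eta !ge_min lexx !orbT.
exists eta.
  by rewrite /eta !lt_min mu0 divr_gt0//= invr_gt0 ltr0n.
split=> a b ea ab eb; first by rewrite !fmu//; apply/andP; split; lra.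
have [|ltab] := ltrP a b; last by have -> : a = b by lra.
move=> ltab.
have c1 : {within `[a, b], continuous f}.
  by apply: continuous_subspaceW cf => x /=; rewrite !in_itv/= => /andP[]; lra.
have d1 x : x \in `]a, b[%R -> is_derive x 1 f (f1 x).
  by rewrite in_itv/= => /andP[ux x1]; apply: fd; apply/andP; split; lra.
have [x] := MVT ltab d1 c1; rewrite in_itv/= => /andP[ax xb] E.
have : f1 x * (b - a) <= 0.
  rewrite mulr_le0_ge0//; last by lra.
  by apply/ltW/f1_neg'; [apply/andP; split|]; lra.
by lra.
Qed.

Lemma reaction_of_front f U c0 : combustion f \/ bistable f ->
  planar_front f c0 U ->
  exists f1 f2 K, regular_reaction f f1 f2 K /\ stable_ends f.
Proof.
move=> [fcomb|fbi] Uf.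
  have [f1 [f2 [K [freg cf cf1]]]] := combustion_regular _ fcomb.
  exists f1, f2, K; split => //.
  apply: (combustion_stable_ends _ _ _ _ freg cf cf1 _ fcomb).
  exact: (combustion_slope _ _ _ Uf _ _ _ freg cf cf1 fcomb).
have [f1 [f2 [K freg]]] := bistable_regular _ fbi.
by exists f1, f2, K; split => //; exact: bistable_stable_ends.
Qed.

(** Stretching the planar front by a factor [sg] gives the front for the
    diffusion coefficient [sg ^ 2], with speed [c0 * sg] and the same bounds. *)
Lemma planar_front_profile f (f1 f2 : R -> R) (K c0 : R) U :
  regular_reaction f f1 f2 K -> planar_front f c0 U ->
  exists2 Q : R, 0 < Q & forall sg : R, 1 <= sg ->
    exists V V1 V2 V3 V4, front_profile f f1 f2 (sg ^+ 2) (c0 * sg) Q V V1 V2 V3 V4.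
Proof.
move=> [fd f1d fK f2K _] Uf.
have U01 := planar_between _ _ _ Uf.
pose U1 := derive1 U.
have UU1 s : is_derive s 1 U (U1 s) := planar_derive _ _ _ Uf s.
pose U2 s := c0 * U1 s - f (U s).
have U1U2 s : is_derive s 1 U1 (U2 s) := planar_derive1 _ _ _ Uf s.
pose U3 s := c0 * U2 s - f1 (U s) * U1 s.
have comp (g dg : R -> R) s : is_derive (U s) 1 g (dg (U s)) ->
    is_derive s 1 (fun x => g (U x)) (dg (U s) * U1 s).
  move=> gdg; have H := @is_derive1_comp R g U s _ _ gdg (UU1 s).
  by apply: (is_derive_eq H); rewrite /GRing.scale /=; ring.
have U2U3 s : is_derive s 1 U2 (U3 s).
  have h1 := U1U2 s; have h2 := comp f f1 s (fd _ (U01 s)).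
  by rewrite /U2 /U3; apply: is_derive_eq; rewrite /GRing.scale /=; ring.
pose U4 s := c0 * U3 s - (f2 (U s) * U1 s ^+ 2 + f1 (U s) * U2 s).
have U3U4 s : is_derive s 1 U3 (U4 s).
  have h1 := U1U2 s; have h2 := comp f1 f2 s (f1d _ (U01 s)); have h3 := U2U3 s.
  by rewrite /U3 /U4; apply: is_derive_eq; rewrite /GRing.scale /=; ring.
have U1_gt0 s : 0 < U1 s by case: Uf.
have f1UK s : `|f1 (U s)| <= K by exact: fK.
have f2UK s : `|f2 (U s)| <= K by exact: f2K.
have K0 : 0 <= K := le_trans (normr_ge0 _) (f1UK 0).
pose q := `|c0| + K + 1.
have U2q s : `|U2 s| <= q * U1 s.
  by apply: (log_derivative_bound U1 U2 U3 (fun s => f1 (U s)) c0 K).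
have q1 : 1 <= q by rewrite /q lerDr addr_ge0.
have q0 : 0 < q by lra.
pose P := expR q.
have P0 : 0 < P by exact: expR_gt0.
(* One unit of length around [s] already contributes a fixed fraction of
   U'(s) to the increment of U. *)
have incr s t : `|s - t| <= 1 -> U1 s <= P * U1 t.
  move=> st; apply: le_trans (log_derivative_harnack _ _ q s t U1U2 U2q) _.
  rewrite ler_pM2r ?U1_gt0// ler_expR -[X in _ <= X]mulr1 ler_pM2l//.
have UP s t : s <= t -> t - s <= 1 -> forall x, s <= x <= t ->
    U1 x * (t - s) <= P * (U t - U s).
  move=> st ts x /andP[sx xt].
  have Px y : s <= y <= t -> P^-1 * U1 x <= U1 y.
    move=> /andP[sy yt]; rewrite ler_pdivrMl// incr// ler_norml.
    by apply/andP; split; lra.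
  have := derivative_ge U U1 s t (P^-1 * U1 x) UU1 st Px.
  by rewrite -mulrA ler_pdivrMl.
have left_ s : U1 s <= P * U s.
  have := UP (s - 1) s ltac:(lra) ltac:(lra) s ltac:(apply/andP; split; lra).
  rewrite opprB addrCA subrr addr0 mulr1 => H; apply: (le_trans H).
  by rewrite ler_pM2l// gerBl; case/andP: (U01 (s - 1)) => /ltW.
have right_ s : U1 s <= P * (1 - U s).
  have := UP s (s + 1) ltac:(lra) ltac:(lra) s ltac:(apply/andP; split; lra).
  rewrite addrAC subrr add0r mulr1 => H; apply: (le_trans H).
  by rewrite ler_pM2l// lerD2r; case/andP: (U01 (s + 1)) => _ /ltW.
have U1P s : U1 s <= P.
  apply: (le_trans (left_ s)); rewrite ler_piMr ?ltW//.
  by case/andP: (U01 s).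
pose q3 := `|c0| * q + K.
have U3q s : `|U3 s| <= q3 * U1 s.
  rewrite /U3 /q3 mulrDl; apply: le_trans (ler_normB _ _) _.
  rewrite !normrM (gtr0_norm (U1_gt0 s)) lerD//.
    by rewrite -mulrA ler_wpM2l.
  by rewrite ler_pM2r.
pose q4 := `|c0| * q3 + (K * P + K * q).
have U4q s : `|U4 s| <= q4 * U1 s.
  rewrite /U4 /q4 mulrDl; apply: le_trans (ler_normB _ _) _.
  rewrite lerD//; first by rewrite normrM -mulrA ler_wpM2l.
  apply: le_trans (ler_normD _ _) _; rewrite mulrDl lerD//.
    rewrite normrM expr2 normrM (gtr0_norm (U1_gt0 s)) -mulrA.
    by apply: ler_pM => //; [rewrite mulr_ge0 ?ltW|rewrite ler_pM2r].
  by rewrite normrM -mulrA; apply: ler_pM.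
have q3_0 : 0 <= q3 by rewrite /q3 addr_ge0// mulr_ge0// ltW.
have q4_0 : 0 <= q4.
  by rewrite /q4 addr_ge0// ?mulr_ge0// addr_ge0// mulr_ge0// ltW.
pose Q := P + q + q3 + q4.
have QP : P <= Q by rewrite /Q; lra.
have Qq : q <= Q by rewrite /Q; lra.
have Qq3 : q3 <= Q by rewrite /Q; lra.
have Qq4 : q4 <= Q by rewrite /Q; lra.
have Q0 : 0 < Q by lra.
exists Q => // sg sg1.
have sg0 : 0 < sg by lra.
have sgn0 : sg != 0 by rewrite gt_eqF.
have isg0 : 0 < sg^-1 by rewrite invr_gt0.
have isg1 : sg^-1 <= 1 by rewrite invf_le1.
pose st (g : R -> R) (k : nat) s := sg^-1 ^+ k * g (s / sg).
have std (g dg : R -> R) k : (forall s, is_derive s 1 g (dg s)) ->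
    forall s, is_derive s 1 (st g k) (st dg k.+1 s).
  move=> gdg s.
  have ids : is_derive s 1 (fun x : R => x / sg) sg^-1.
    by apply: is_derive_eq; rewrite /GRing.scale /=; ring.
  have H := @is_derive1_comp R g (fun x => x / sg) s _ _ (gdg (s / sg)) ids.
  rewrite /st; apply: is_derive_eq.
  by rewrite /GRing.scale /= exprSr; ring.
have ek k : 0 < sg^-1 ^+ k by rewrite exprn_gt0.
have stb (g : R -> R) k r : r <= Q -> (forall s, `|g s| <= r * U1 s) ->
    forall s, `|st g k.+1 s| <= Q * st U1 1 s.
  move=> rQ gr s; rewrite /st normrM (gtr0_norm (ek _)) exprS expr1 -mulrA.
  rewrite (mulrCA Q) ler_pM2l//; apply: (@le_trans _ _ `|g (s / sg)|).
    by rewrite ler_piMl// exprn_ile1// ltW.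
  by apply: le_trans (gr _) _; rewrite ler_pM2r.
have st1 s : st U1 1 s <= U1 (s / sg) by rewrite /st expr1 ler_piMl// ltW.
exists (st U 0%N), (st U1 1%N), (st U2 2%N), (st U3 3%N), (st U4 4%N); split.
- exact: std.
- exact: std.
- exact: std.
- exact: std.
- by move=> s; rewrite /st expr0 mul1r /U2; field.
- by move=> s; rewrite /st expr0 mul1r /U3; field.
- by move=> s; rewrite /st expr0 mul1r /U4; field.
- by move=> s; rewrite /st expr0 mul1r; case/andP: (U01 (s / sg)).
- by move=> s; rewrite /st expr0 mul1r; case/andP: (U01 (s / sg)).
- by move=> s; rewrite /st mulr_gt0.
- by move=> s; apply: le_trans (st1 s) _; apply: le_trans (U1P _) QP.
- exact: stb Qq U2q.
- exact: stb Qq3 U3q.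
- exact: stb Qq4 U4q.
- move=> s; apply: le_trans (st1 s) _; apply: le_trans (left_ _) _.
  by rewrite /st expr0 mul1r ler_pM2r//; case/andP: (U01 (s / sg)).
- move=> s; apply: le_trans (st1 s) _; apply: le_trans (right_ _) _.
  by rewrite /st expr0 mul1r ler_pM2r// subr_gt0; case/andP: (U01 (s / sg)).
- move=> e e_gt0; case: Uf => _ _ [Ul Ur] _ _.
  move/cvgrPdist_lt : Ul => /(_ _ e_gt0) [A [_ HA]].
  move/cvgrPdist_lt : Ur => /(_ _ e_gt0) [B [_ HB]].
  pose X := `|A| + `|B| + 1.
  have ? := ler_norm B; have ? := lerNnormlW (lexx `|A|).
  have [? ?] : 0 <= `|A| /\ 0 <= `|B| by [].
  exists (X * sg) => s; rewrite /st expr0 mul1r; split => sX.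
    have : s / sg < A.
      by rewrite (@le_lt_trans _ _ (- X))// ?ler_pdivrMr ?mulNr// /X; lra.
    by move=> /HA /=; rewrite sub0r normrN ltr_norml => /andP[].
  have : B < s / sg.
    by rewrite (@lt_le_trans _ _ X)// ?ler_pdivlMr// /X; lra.
  by move=> /HB /=; rewrite ltr_norml => /andP[]; lra.
Qed.

End reactions.

(** * Bounded solutions of linear equations on the line *)

Section first_order.
Context {R : realType}.
Notation mu := (@lebesgue_measure R).
Implicit Types (s t u : R) (F p dp : R -> R).

Lemma exp_left_integral (r u : R) : 0 < r ->
  (\int[mu]_(t in `]-oo, u]) (expR (r * t))%:E = (expR (r * u) / r)%:E)%E.
Proof.
move=> r0.
have cexp : continuous (fun t : R => expR (r * t)).
  move=> t; apply: (@continuous_comp _ _ _ (fun t => r * t) expR).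
    exact: mulrl_continuous.
  exact: continuous_expR.
have := @ge0_integration_by_substitutionNy R (fun t => expR (r * t)) (- u).
rewrite opprK => ->; first last.
- by move=> t _; exact: expR_ge0.
- exact: continuous_subspaceT.
pose G t := - (expR (- (r * t)) / r).
have Gd t : is_derive t 1 G (expR (- (r * t))).
  by rewrite /G; apply: is_derive_eq; rewrite /GRing.scale /=; field; rewrite gt_eqF.
rewrite (@ge0_continuous_FTC2y R _ G (- u) 0); first last.
- by move=> t _; rewrite derive1E derive_val /= mulrN.
- by apply: cvg_at_right_filter; exact: derivative_continuous (Gd (- u)).
- by move=> t _; have [] := Gd t.
- rewrite /G -oppr0; apply: cvgN; rewrite -(mul0r r^-1); apply: cvgMl.
  apply: (@cvg_comp _ _ _ (fun t => r * t) (fun t => expR (- t)) _ +oo).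
    apply: gt0_cvgMry => //; exact: cvg_id.
  exact: cvgr_expR.
- apply: continuous_subspaceT => t /=; apply: continuous_comp.
    exact: opp_continuous.
  exact: cexp.
- by move=> t _; exact: expR_ge0.
by rewrite /G sub0e /= opprK mulrN opprK.
Qed.

Lemma weighted_integrable (r A u : R) F : 0 < r -> continuous F ->
  (forall t, `|F t| <= A) ->
  mu.-integrable `]-oo, u] (EFin \o (fun t => expR (r * t) * F t)).
Proof.
move=> r0 cF FA.
have cexp : continuous (fun t : R => expR (r * t)).
  move=> t; apply: (@continuous_comp _ _ _ (fun t => r * t) expR).
    exact: mulrl_continuous.
  exact: continuous_expR.
apply: (@le_integrable _ _ _ mu _ _ _ (EFin \o (fun t => A * expR (r * t)))) => //.
- apply/measurable_EFinP; apply: measurable_funTS.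
  apply: continuous_measurable_fun => t; apply: cvgM; [exact: cexp|exact: cF].
- move=> t _ /=; rewrite lee_fin !normrM mulrC ler_wpM2r//.
  by apply: le_trans (FA t) _; exact: ler_norm.
- have -> : EFin \o (fun t => A * expR (r * t)) =
      (fun t => A%:E * (expR (r * t))%:E)%E by [].
  apply: integrableZl => //; apply/integrableP; split.
    apply/measurable_EFinP; apply: measurable_funTS.
    exact: continuous_measurable_fun.
  under eq_integral do rewrite gee0_abs ?lee_fin ?expR_ge0//.
  by rewrite exp_left_integral// ltry.
Qed.

(** The bounded solution is given by Duhamel's formula from minus infinity. *)
Lemma first_order_solution (r A : R) F : 0 < r -> continuous F ->
  (forall t, `|F t| <= A) ->
  exists p, (forall s, is_derive s 1 p (- r * p s + F s)) /\
            (forall s, `|p s| <= A / r).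
Proof.
move=> r0 cF FA.
pose h t := expR (r * t) * F t.
have cexp : continuous (fun t : R => expR (r * t)).
  move=> t; apply: (@continuous_comp _ _ _ (fun t => r * t) expR).
    exact: mulrl_continuous.
  exact: continuous_expR.
have ch : continuous h by move=> t; apply: cvgM; [exact: cexp|exact: cF].
have ih u : mu.-integrable `]-oo, u] (EFin \o h) by exact: weighted_integrable.
pose P s := \int[mu]_(t in [set` Interval -oo%O (BRight s)]) h t.
have Pd s : is_derive s 1 P (h s).
  have ss : s < s + 1 by rewrite ltrDl.
  have [Pd' PE] : derivable P s 1 /\ derive1 P s = h s.
    apply: (@continuous_FTC1 R h -oo%O s (s + 1) ss (ih (s + 1))); last exact: ch.
    by rewrite ltNyr.
  by rewrite -PE derive1E; exact: derivableP.
have Pb s : `|P s| <= A / r * expR (r * s).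
  apply: le_trans (le_normr_Rintegral _ (ih s)) _ => //.
  have iA : mu.-integrable `]-oo, s] (EFin \o (fun t => expR (r * t) * A)).
    apply: weighted_integrable => //; first by move=> t; exact: cst_continuous.
  apply: le_trans (_ : _ <= \int[mu]_(t in `]-oo, s]) (expR (r * t) * A)) _.
    apply: le_Rintegral => //.
      exact: integrable_norm (ih s).
    by move=> t _; rewrite normrM (gtr0_norm (expR_gt0 _)) ler_wpM2l ?expR_ge0.
  rewrite RintegralZr//; last first.
    have := @weighted_integrable r 1 s (fun=> 1) r0.
    rewrite (_ : (fun t => expR (r * t) * 1) = (fun t => expR (r * t))); last first.
      by apply/funext => t; rewrite mulr1.
    apply; first by move=> t; exact: cst_continuous.
    by move=> t; rewrite normr1.
  rewrite /Rintegral exp_left_integral//= le_eqVlt; apply/orP; left.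
  by apply/eqP; ring.
exists (fun s => expR (- (r * s)) * P s); split=> s.
  have Ps := Pd s; apply: is_derive_eq; rewrite /GRing.scale /= /h.
  rewrite [_ * (_ * F s)]mulrA [expR (- _) * expR _]mulrC expRxMexpNx_1; ring.
rewrite normrM (gtr0_norm (expR_gt0 _)).
apply: (@le_trans _ _ (expR (- (r * s)) * (A / r * expR (r * s)))).
  by rewrite ler_pM2l ?expR_gt0.
by rewrite mulrCA [expR _ * expR _]mulrC expRxMexpNx_1 mulr1.
Qed.

(** A bounded function with p' + r p >= 0 cannot be negative, as it would grow
    exponentially backwards in time. *)
Lemma first_order_comparison (r B : R) p dp : 0 < r ->
  (forall s, is_derive s 1 p (dp s)) -> (forall s, `|p s| <= B) ->
  (forall s, 0 <= dp s + r * p s) -> forall s, 0 <= p s.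
Proof.
move=> r0 pd pB dpr s0; rewrite leNgt; apply/negP => ps0.
have B0 : 0 <= B := le_trans (normr_ge0 _) (pB 0).
pose h0 := - p s0; have h0_gt0 : 0 < h0 by rewrite oppr_gt0.
pose x := B / (h0 * r).
have x0 : 0 <= x by rewrite divr_ge0// mulr_ge0// ltW.
have sx : s0 - x <= s0 by rewrite gerBl.
have := @gronwall_ge R p dp (- r) (s0 - x) s0 pd sx.
have -> : - r * (s0 - (s0 - x)) = - (r * x) by ring.
move=> H; have {}H : p (s0 - x) * expR (- (r * x)) <= p s0.
  by apply: H => y _; have := dpr y; lra.
have : expR (r * x) * h0 <= B.
  have : - B <= p (s0 - x) by exact: lerNnormlW.
  rewrite -(ler_pM2r (expR_gt0 (- (r * x)))) => H2.
  have : h0 <= B * expR (- (r * x)) by rewrite /h0; lra.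
  by rewrite expRN ler_pdivlMr ?expR_gt0// mulrC.
have : (1 + r * x) * h0 <= expR (r * x) * h0 by rewrite ler_pM2r// expR_ge1Dx.
have -> : (1 + r * x) * h0 = h0 + B.
  by rewrite /x; field; rewrite !gt_eqF.
by lra.
Qed.

Lemma is_derive_reflect p dp : (forall s, is_derive s 1 p (dp s)) ->
  forall s, is_derive s 1 (fun x => p (- x)) (- dp (- s)).
Proof.
move=> pd s.
have ids : is_derive s 1 (fun x : R => - x) (- 1) by exact: is_deriveN.
have H := @is_derive1_comp R p (fun x => - x) s _ _ (pd (- s)) ids.
by apply: (is_derive_eq H); rewrite /GRing.scale /=; ring.
Qed.

End first_order.

Section second_order.
Context {R : realType} (R1 R2 : R).
Hypotheses (R1_gt0 : 0 < R1) (R2_gt0 : 0 < R2).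
Implicit Types (s : R) (F y : R -> R).

(** The operator is the product (d/ds - R1) (d/ds + R2), so that the first
    order problems, one of them reflected, can be solved in turn. *)
Lemma second_order_solution (A : R) F : continuous F ->
  (forall s, `|F s| <= A) ->
  exists y y1 y2 B, [/\ forall s, is_derive s 1 y (y1 s),
    forall s, is_derive s 1 y1 (y2 s),
    forall s, y2 s = (R1 - R2) * y1 s + R1 * R2 * y s + F s &
    forall s, `|y s| <= B /\ `|y1 s| <= B].
Proof.
move=> cF FA.
have cF' : continuous (fun s => - F (- s)).
  move=> s; apply: cvgN; apply: continuous_comp; last exact: cF.
  exact: opp_continuous.
have [|q [qd qB]] := first_order_solution R1 A _ R1_gt0 cF'.
  by move=> s; rewrite normrN.
pose p s := q (- s).
have pd s : is_derive s 1 p (R1 * p s + F s).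
  apply: (is_derive_eq (is_derive_reflect _ _ qd s)).
  by rewrite /p opprK; ring.
have cp : continuous p by move=> s; exact: derivative_continuous (pd s).
have [y [yd yB]] := first_order_solution R2 _ _ R2_gt0 cp (fun s => qB (- s)).
exists y, (fun s => - R2 * y s + p s),
  (fun s => - R2 * (- R2 * y s + p s) + (R1 * p s + F s)),
  (A / R1 / R2 + (R2 * (A / R1 / R2) + A / R1)); split.
- exact: yd.
- move=> s; have ys := yd s; have ps := pd s.
  by apply: is_derive_eq; rewrite /GRing.scale /=; ring.
- by move=> s; ring.
- move=> s; have := yB s; have := qB (- s); rewrite -/(p s) => ps ys.
  have A1 : 0 <= A / R1 := le_trans (normr_ge0 _) ps.
  have A2 : 0 <= A / R1 / R2 := le_trans (normr_ge0 _) ys.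
  have A3 : 0 <= R2 * (A / R1 / R2) by rewrite mulr_ge0// ltW.
  split; first by lra.
  apply: le_trans (ler_normD _ _) _; rewrite normrM normrN (gtr0_norm R2_gt0).
  have : R2 * `|y s| <= R2 * (A / R1 / R2) by rewrite ler_pM2l.
  by lra.
Qed.

Lemma second_order_comparison y (y1 y2 : R -> R) (B : R) :
  (forall s, is_derive s 1 y (y1 s)) -> (forall s, is_derive s 1 y1 (y2 s)) ->
  (forall s, `|y s| <= B /\ `|y1 s| <= B) ->
  (forall s, y2 s <= (R1 - R2) * y1 s + R1 * R2 * y s) -> forall s, 0 <= y s.
Proof.
move=> yd y1d yB y2le.
pose p s := y1 s + R2 * y s.
pose dp s := y2 s + R2 * y1 s.
have pd s : is_derive s 1 p (dp s).
  have h1 := yd s; have h2 := y1d s.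
  by rewrite /p /dp; apply: is_derive_eq; rewrite /GRing.scale /=; ring.
have p0 s : 0 <= p s.
  rewrite -[s]opprK.
  apply: (first_order_comparison R1 (B + R2 * B) (fun s => p (- s))
    (fun s => - dp (- s)) R1_gt0 (is_derive_reflect _ _ pd)) => t.
    have [b1 b2] := yB (- t).
    apply: le_trans (ler_normD _ _) _; rewrite normrM (gtr0_norm R2_gt0).
    by rewrite lerD// ler_pM2l.
  rewrite /dp /p; have := y2le (- t); lra.
apply: (first_order_comparison R2 B y y1 R2_gt0 yd) => s.
  by case: (yB s).
exact: p0.
Qed.

End second_order.

Section geometric.
Context {R : realType}.

Lemma geometric_le0 (x C k : R) : 0 <= k < 1 ->
  (forall n, x <= C * k ^+ n) -> x <= 0.
Proof.
move=> /andP[k0 k1] H.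
have : C * k ^+ n @[n --> \oo] --> C * 0.
  by apply: cvgMr; apply: cvg_expr; rewrite ger0_norm.
rewrite mulr0 => lim0; rewrite -(cvg_lim _ lim0)//.
by apply: limr_ge; [apply/cvg_ex; exists 0|near=> n; exact: H].
Unshelve. all: by end_near. Qed.

(** A sequence whose increments decay geometrically has a limit, with an
    explicit error; the limit is the common point of nested intervals. *)
Lemma geometric_limit (w : nat -> R) (C k : R) : 0 <= C -> 0 <= k < 1 ->
  (forall n, `|w n.+1 - w n| <= C * k ^+ n) ->
  exists l, forall n, `|w n - l| <= C / (1 - k) * k ^+ n.
Proof.
move=> C0 /andP[k0 k1] wC.
pose c n := C / (1 - k) * k ^+ n.
have k1_gt0 : 0 < 1 - k by rewrite subr_gt0.
have c0 n : 0 <= c n by rewrite mulr_ge0 ?exprn_ge0// divr_ge0// ltW.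
have cS n : c n - c n.+1 = C * k ^+ n.
  by rewrite /c exprS; field; rewrite gt_eqF.
have wc n j : `|w (n + j)%N - w n| <= c n - c (n + j)%N.
  elim: j => [|j IH]; first by rewrite addn0 !subrr normr0.
  rewrite addnS; have := wC (n + j)%N; rewrite -cS.
  move: IH; rewrite !ler_norml => /andP[? ?] /andP[? ?].
  by apply/andP; split; lra.
have nested n m : w n - c n <= w m + c m.
  have [nm|/ltnW mn] := leqP n m.
    have := wc n (m - n)%N; rewrite subnKC// ler_norml => /andP[? ?].
    by have := c0 m; lra.
  have := wc m (n - m)%N; rewrite subnKC// ler_norml => /andP[? ?].
  by have := c0 n; lra.
pose S := range (fun n => w n - c n).
have S_ub m : ubound S (w m + c m) by move=> _ [n _ <-]; exact: nested.
have S0 : S !=set0 by exists (w 0%N - c 0%N), 0%N.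
exists (sup S) => n; rewrite ler_norml; apply/andP; split.
- have : sup S <= w n + c n by apply: ge_sup => //; exact: S_ub.
  by rewrite /c; lra.
- have : w n - c n <= sup S.
    apply: ub_le_sup; last by exists n.
    by exists (w 0%N + c 0%N); exact: S_ub.
  by rewrite /c; lra.
Qed.

End geometric.

Section corrector.
Context {R : realType}.
Variables (be Q F1 lam A P : R) (phi phi1 phi2 r F : R -> R).
Implicit Types (s : R) (w y : R -> R).
Hypotheses (Q_ge0 : 0 <= Q) (F1_ge0 : 0 <= F1) (lam_gt0 : 0 < lam).
Hypotheses (A_ge0 : 0 <= A).
Hypothesis phi_derive : forall s, is_derive s 1 phi (phi1 s).
Hypothesis phi1_derive : forall s, is_derive s 1 phi1 (phi2 s).
Hypothesis phi_gt0 : forall s, 0 < phi s.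
Hypothesis phi_le : forall s, phi s <= P.
Hypothesis phi1_le : forall s, `|phi1 s| <= Q * phi s.
Hypothesis phi_super : forall s,
  phi2 s - be * phi1 s + (r s - lam) * phi s <= - (lam / 2) * phi s.
Hypotheses (r_cont : continuous r) (r_le : forall s, `|r s| <= F1).
Hypotheses (F_cont : continuous F) (F_le : forall s, `|F s| <= A * phi s).

(* The constant coefficient operator d^2/ds^2 - be d/ds - R1 R2 is kept on the
   left and rho w is moved to the right; R1 and R2 are so large that rho is
   non-negative and that the exponential rate R1 exceeds the growth rate Q of
   phi. *)
Let kap := `|be| + 2 * Q + F1 + 1.
Let R2 := lam + kap.
Let R1 := R2 + be.
Let rho s := R1 * R2 - lam + r s.
Let rhom := R1 * R2 - lam + F1.
Let d := 2 * A / lam.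

Let be_bounds : - `|be| <= be <= `|be|.
Proof. by rewrite lerNnormlW//= ler_norm. Qed.

Let R1_ge : lam + 2 * Q + F1 + 1 <= R1.
Proof. by have /andP[? ?] := be_bounds; rewrite /R1 /R2 /kap; lra. Qed.

Let R2_ge : lam + 2 * Q + F1 + 1 <= R2.
Proof. by have := normr_ge0 be; rewrite /R2 /kap; lra. Qed.

Let R1_gt0 : 0 < R1.
Proof. by apply: lt_le_trans R1_ge; move: Q_ge0 F1_ge0 lam_gt0; lra. Qed.

Let R2_gt0 : 0 < R2.
Proof. by apply: lt_le_trans R2_ge; move: Q_ge0 F1_ge0 lam_gt0; lra. Qed.

Let rho_ge0 s : 0 <= rho s.
Proof.
have Q0 := Q_ge0; have F0 := F1_ge0; have l0 := lam_gt0.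
have : (lam + F1 + 1) * 1 <= R1 * R2.
  by apply: ler_pM; have := R1_ge; have := R2_ge; lra.
by have := lerNnormlW (r_le s); rewrite /rho; lra.
Qed.

Let rho_le s : rho s <= rhom.
Proof. by have := ler_normlW (r_le s); rewrite /rho /rhom; lra. Qed.

Let rhom_ge0 : 0 <= rhom. Proof. exact: le_trans (rho_ge0 0) (rho_le 0). Qed.

Let d_ge0 : 0 <= d. Proof. by rewrite divr_ge0 ?mulr_ge0// ltW. Qed.

Let be_eq : R1 - R2 = be. Proof. by rewrite /R1; ring. Qed.

Let solves w y (y1 y2 : R -> R) : Prop :=
  [/\ forall s, is_derive s 1 y (y1 s), forall s, is_derive s 1 y1 (y2 s),
      forall s, y2 s = be * y1 s + R1 * R2 * y s + (F s - rho s * w s) &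
      exists B, forall s, `|y s| <= B /\ `|y1 s| <= B].

(** The maximum principle with the supersolution [phi]: replacing
    (r - lam) y by its frozen value costs a factor smaller than one. *)
Let phi_comparison (e : R) y (y1 y2 G : R -> R) (B : R) : 0 <= e ->
  (forall s, is_derive s 1 y (y1 s)) -> (forall s, is_derive s 1 y1 (y2 s)) ->
  (forall s, `|y s| <= B /\ `|y1 s| <= B) ->
  (forall s, y2 s = be * y1 s + R1 * R2 * y s + G s) ->
  (forall s, `|G s| <= e * (rho s + lam / 2) * phi s) ->
  forall s, `|y s| <= e * phi s.
Proof.
move=> e0 yd y1d yB yE Gle.
have half (sg : R) : sg = 1 \/ sg = - 1 -> forall s, 0 <= e * phi s - sg * y s.
  move=> sg1.
  have sgn : `|sg| = 1 by case: sg1 => ->; rewrite ?normrN normr1.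
  apply: (second_order_comparison _ _ R1_gt0 R2_gt0 (fun s => e * phi s - sg * y s)
    (fun s => e * phi1 s - sg * y1 s) (fun s => e * phi2 s - sg * y2 s)
    (e * P + e * (Q * P) + B)) => s.
  - have [b1 b2] := yB s.
    have p1 : `|phi s| <= P by rewrite gtr0_norm.
    have p2 : `|phi1 s| <= Q * P.
      by apply: le_trans (phi1_le s) _; rewrite ler_wpM2l.
    have q1 : 0 <= e * P by rewrite mulr_ge0// (le_trans _ p1).
    have q2 : 0 <= e * (Q * P) by rewrite mulr_ge0// (le_trans _ p2).
    have p1' : e * `|phi s| <= e * P by rewrite ler_wpM2l.
    have p2' : e * `|phi1 s| <= e * (Q * P) by rewrite ler_wpM2l.
    by split; apply: le_trans (ler_normB _ _) _; rewrite !normrM sgn mul1r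
       (ger0_norm e0); lra.
  - rewrite be_eq yE.
    have : e * (phi2 s - be * phi1 s + (r s - lam) * phi s) <=
        e * (- (lam / 2) * phi s) by rewrite ler_wpM2l.
    have : - (e * (rho s + lam / 2) * phi s) <= sg * G s.
      by apply: lerNnormlW; rewrite normrM sgn mul1r.
    by rewrite /rho; lra.
move=> s; rewrite ler_norml.
have := half 1 (or_introl erefl) s; have := half (- 1) (or_intror erefl) s.
by move=> ? ?; apply/andP; split; lra.
Qed.

Let step w : continuous w -> (forall s, `|w s| <= d * phi s) ->
  exists y y1 y2, solves w y y1 y2 /\ forall s, `|y s| <= d * phi s.
Proof.
move=> cw wd.
have cG : continuous (fun s => F s - rho s * w s).
  move=> s; apply: cvgB; first exact: F_cont.
  apply: cvgM; last exact: cw.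
  by apply: cvgD; [exact: cvg_cst|exact: r_cont].
have Gle s : `|F s - rho s * w s| <= d * (rho s + lam / 2) * phi s.
  apply: le_trans (ler_normB _ _) _; rewrite normrM (ger0_norm (rho_ge0 s)).
  have : rho s * `|w s| <= rho s * (d * phi s) by rewrite ler_wpM2l.
  have := F_le s.
  have -> : A = d * (lam / 2) by rewrite /d; field; rewrite gt_eqF.
  by lra.
have GB s : `|F s - rho s * w s| <= d * (rhom + lam / 2) * P.
  apply: le_trans (Gle s) _; apply: ler_pM => //.
  - by rewrite mulr_ge0// addr_ge0// divr_ge0// ltW.
  - exact: ltW.
  - by rewrite ler_wpM2l// lerD2r.
have [y [y1 [y2 [B [yd y1d yE yB]]]]] :=
  second_order_solution _ _ R1_gt0 R2_gt0 _ _ cG GB.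
exists y, y1, y2; split.
  by split => //; [move=> s; rewrite yE be_eq|exists B].
apply: (phi_comparison d y y1 y2 _ B d_ge0 yd y1d yB _ Gle) => s.
by rewrite yE be_eq.
Qed.

Let k := rhom / (rhom + lam / 2).

Let k_bounds : 0 <= k < 1.
Proof.
have l2 : 0 < lam / 2 by rewrite divr_gt0.
have dn : 0 < rhom + lam / 2 by rewrite ltr_wpDl.
by rewrite divr_ge0 ?(ltW dn)//= ltr_pdivrMr// mul1r ltrDl.
Qed.

Let rho_k s : rho s <= k * (rho s + lam / 2).
Proof.
have l2 : 0 < lam / 2 by rewrite divr_gt0.
have dn : 0 < rhom + lam / 2 by rewrite ltr_wpDl.
rewrite /k mulrAC ler_pdivlMr//.
have : rho s * (lam / 2) <= rhom * (lam / 2) by rewrite ler_pM2r.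
by lra.
Qed.

(** The difference of two solutions is controlled by the difference of the
    frozen values. *)
Let difference w w' (e e' : R) y (y1 y2 : R -> R) y' (y1' y2' : R -> R) :
  solves w y y1 y2 -> solves w' y' y1' y2' -> 0 <= e' ->
  (forall s, `|w s - w' s| <= e * phi s) ->
  (forall s, rho s * e <= (rho s + lam / 2) * e') ->
  forall s, `|y s - y' s| <= e' * phi s.
Proof.
move=> [yd y1d yE [B yB]] [yd' y1d' yE' [B' yB']] e0 ww ee.
apply: (phi_comparison e' _ (fun s => y1 s - y1' s) (fun s => y2 s - y2' s)
  (fun s => - (rho s * (w s - w' s))) (B + B') e0) => s.
- have [? ?] := yB s; have [? ?] := yB' s.
  by split; apply: le_trans (ler_normB _ _) _; exact: lerD.
- by rewrite yE yE'; ring.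
- rewrite normrN normrM (ger0_norm (rho_ge0 s)).
  apply: (@le_trans _ _ (rho s * (e * phi s))); first by rewrite ler_wpM2l.
  by rewrite mulrA (mulrC e') ler_pM2r.
Qed.

(** Bounded solution of w'' - be w' + (r - lam) w = F when [phi] is a strict
    supersolution: the fixed point of the contraction that freezes the
    variable coefficient. *)
Lemma corrector_solution : exists w w1 w2, [/\ forall s, is_derive s 1 w (w1 s),
  forall s, is_derive s 1 w1 (w2 s),
  forall s, w2 s - be * w1 s + (r s - lam) * w s = F s,
  forall s, `|w s| <= 2 * A / lam * phi s &
  forall s, `|w1 s| <=
    (8 + (6 * (`|be| + 2 * Q + F1 + 1) + 4 * F1) / lam) * A * phi s].
Proof.
have Q0 := Q_ge0; have F0 := F1_ge0; have l0 := lam_gt0.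
pose good w := continuous w /\ forall s, `|w s| <= d * phi s.
have ex_step w : exists y, good w ->
    (exists y1 y2, solves w y y1 y2) /\ forall s, `|y s| <= d * phi s.
  have [[cw wd]|Nw] := pselect (good w); last by exists w.
  have [y [y1 [y2 [sy yd]]]] := step w cw wd.
  by exists y => _; split => //; exists y1, y2.
have [T HT] := choice ex_step.
have Tgood w : good w -> good (T w).
  move=> gw; have [[y1 [y2 [yd _ _ _]]] Td] := HT w gw.
  by split => // s; exact: derivative_continuous (yd s).
pose w n := iter n T (fun=> 0).
have wgood n : good (w n).
  elim: n => [|n IH]; last exact: Tgood.
  split; first by move=> s; exact: cvg_cst.
  by move=> s; rewrite /w /= normr0 mulr_ge0// ltW.
have /andP[k0 k1] := k_bounds.
have k1_gt0 : 0 < 1 - k by rewrite subr_gt0.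
have wdiff n s : `|w n.+1 s - w n s| <= d * k ^+ n * phi s.
  elim: n s => [|n IH] s.
    have [_ w1d] := wgood 1%N; have -> : w 0%N s = 0 by [].
    by rewrite subr0 expr0 mulr1; exact: w1d.
  have [[y1 [y2 sy]] _] := HT _ (wgood n.+1).
  have [[y1' [y2' sy']] _] := HT _ (wgood n).
  apply: (difference _ _ (d * k ^+ n) _ _ _ _ _ _ _ sy sy') => //.
    by rewrite mulr_ge0// exprn_ge0.
  move=> x; have dk : 0 <= d * k ^+ n by rewrite mulr_ge0// exprn_ge0.
  have : d * k ^+ n * rho x <= d * k ^+ n * (k * (rho x + lam / 2)).
    by rewrite ler_wpM2l// rho_k.
  by rewrite exprS; lra.
have ex_lim s : exists l, forall n,
    `|w n s - l| <= d / (1 - k) * k ^+ n * phi s.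
  have dphi : 0 <= d * phi s by rewrite mulr_ge0// ltW.
  have wS n : `|w n.+1 s - w n s| <= d * phi s * k ^+ n by rewrite mulrAC.
  have [l Hl] := geometric_limit (fun n => w n s) _ _ dphi k_bounds wS.
  exists l => n; apply: le_trans (Hl n) _.
  by rewrite le_eqVlt; apply/orP; left; apply/eqP; ring.
have [v Hv] := choice ex_lim.
have e0 n : 0 <= d / (1 - k) * k ^+ n.
  by rewrite mulr_ge0 ?exprn_ge0// divr_ge0// ltW.
have P0 : 0 <= P by apply: le_trans (phi_le 0); exact: ltW.
have vgood : good v.
  split=> s.
    apply/cvgrPdist_lt => e e_gt0.
    have [n Hn] : exists n, d / (1 - k) * P * k ^+ n < e / 4.
      apply: contrapT => /forallNP Hn.
      have := geometric_le0 (e / 4) (d / (1 - k) * P) k k_bounds.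
      move=> /(_ (fun n => _)) H.
      have : e / 4 <= 0.
        by apply: H => n; rewrite leNgt; apply/negP; exact: Hn.
      by lra.
    have vn x : `|w n x - v x| < e / 4.
      apply: le_lt_trans (Hv x n) _; apply: le_lt_trans Hn.
      by rewrite [X in _ <= X]mulrAC; apply: ler_wpM2l (phi_le x).
    have [cw _] := wgood n; have := cw s; move=> /cvgrPdist_lt/(_ (e / 4)).
    rewrite divr_gt0// => /(_ isT); apply: filterS => t.
    have := vn s; have := vn t.
    rewrite !ltr_norml => /andP[? ?] /andP[? ?] /andP[? ?].
    by apply/andP; split; lra.
  rewrite -subr_le0; apply: (geometric_le0 _ (d / (1 - k) * phi s) k k_bounds).
  move=> n; have [_ wd] := wgood n; have := wd s; have := Hv s n.
  have := ler_normB (w n s) (w n s - v s); rewrite subKr mulrAC; lra.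
have [[y1 [y2 sy]] Td] := HT v vgood.
have Tv : T v = v.
  apply/funext => s; apply/eqP; rewrite -subr_eq0 -normr_le0.
  apply: (geometric_le0 _ (2 * (d / (1 - k) * phi s)) k k_bounds) => n.
  have [[y1' [y2' sy']] _] := HT _ (wgood n).
  have H : `|T v s - w n.+1 s| <= d / (1 - k) * k ^+ n * phi s.
    apply: (difference _ _ (d / (1 - k) * k ^+ n) _ _ _ _ _ _ _ sy sy') => //.
      by move=> x; rewrite distrC.
    move=> x; rewrite mulrC [X in _ <= X]mulrC ler_wpM2l// lerDl.
    by rewrite divr_ge0// ltW.
  have := Hv s n.+1; have := ler_normD (T v s - w n.+1 s) (w n.+1 s - v s).
  rewrite addrA subrK => H1 H2.
  have : d / (1 - k) * k ^+ n.+1 * phi s <= d / (1 - k) * k ^+ n * phi s.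
    rewrite ler_pM2r//; apply: ler_wpM2l; first by rewrite divr_ge0// ltW.
    by rewrite exprS ler_piMl ?exprn_ge0// ltW.
  by lra.
move: sy; rewrite Tv => -[yd y1d yE [B yB]].
exists v, y1, y2; split => //.
- by move=> s; rewrite yE /rho; ring.
- by case: vgood.
have vd s : `|v s| <= d * phi s by case: vgood.
(* The derivative is estimated through the first order factor
   p = v' + R2 v, which solves p' - R1 p = F - rho v. *)
pose E := (rhom * d + A) / (R1 - Q).
have R1Q : 0 < R1 - Q by have := R1_ge; lra.
have B0 : 0 <= rhom * d + A by rewrite addr_ge0// mulr_ge0.
have E0 : 0 <= E by rewrite divr_ge0// ltW.
have EE : rhom * d + A = E * (R1 - Q) by rewrite /E; field; rewrite gt_eqF.
move: E E0 EE => E E0 EE.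
have pE s : `|y1 s + R2 * v s| <= E * phi s.
  have half (sg : R) : sg = 1 \/ sg = - 1 ->
      forall s, 0 <= E * phi s - sg * (y1 s + R2 * v s).
    move=> sg1.
    have sgn : `|sg| = 1 by case: sg1 => ->; rewrite ?normrN normr1.
    pose p s := E * phi s - sg * (y1 s + R2 * v s).
    pose dp s := E * phi1 s - sg * (y2 s + R2 * y1 s).
    have pd (x : R) : is_derive x 1 p (dp x).
      have h1 := phi_derive x; have h2 := yd x; have h3 := y1d x.
      by rewrite /p /dp; apply: is_derive_eq; rewrite /GRing.scale /=; ring.
    move=> x; rewrite -/(p x) -[x]opprK.
    apply: (first_order_comparison R1 (E * P + (B + R2 * B)) (fun s => p (- s))
      (fun s => - dp (- s)) R1_gt0 (is_derive_reflect _ _ pd)) => t.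
      have [b1 b2] := yB (- t).
      rewrite /p; apply: le_trans (ler_normB _ _) _; rewrite !normrM sgn mul1r.
      rewrite (ger0_norm E0) (gtr0_norm (phi_gt0 _)); apply: lerD.
        by rewrite ler_wpM2l.
      apply: le_trans (ler_normD _ _) _; rewrite normrM (gtr0_norm R2_gt0).
      by rewrite lerD// ler_pM2l.
    rewrite /dp /p yE -be_eq.
    have Fle := F_le (- t); have phile := phi1_le (- t).
    have vle := vd (- t).
    have : - ((rhom * d + A) * phi (- t)) <=
        sg * (F (- t) - rho (- t) * v (- t)).
      apply: lerNnormlW; rewrite normrM sgn mul1r.
      apply: le_trans (ler_normB _ _) _; rewrite normrM (ger0_norm (rho_ge0 _)).
      have : rho (- t) * `|v (- t)| <= rhom * (d * phi (- t)).
        by apply: ler_pM.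
      by lra.
    rewrite EE.
    have : E * phi1 (- t) <= E * (Q * phi (- t)).
      by rewrite ler_wpM2l// ler_normlW.
    by lra.
  rewrite ler_norml.
  have := half 1 (or_introl erefl) s; have := half (- 1) (or_intror erefl) s.
  by move=> ? ?; apply/andP; split; lra.
move=> s.
have Ebound : E + R2 * d <=
    (8 + (6 * (`|be| + 2 * Q + F1 + 1) + 4 * F1) / lam) * A.
  have R12 : R1 / 2 <= R1 - Q by have := R1_ge; lra.
  have R1h : 2^-1 <= R1 - Q by have := R1_ge; lra.
  have H1 : E <= 2 * R2 * d + 2 * (F1 * d + A).
    rewrite -(ler_pM2r R1Q) -EE.
    have : 2 * R2 * d * (R1 / 2) <= 2 * R2 * d * (R1 - Q).
      by rewrite ler_wpM2l// mulr_ge0// mulr_ge0// ltW.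
    have : 2 * (F1 * d + A) * 2^-1 <= 2 * (F1 * d + A) * (R1 - Q).
      by rewrite ler_wpM2l// mulr_ge0// addr_ge0// mulr_ge0.
    have : 0 <= lam * d by rewrite mulr_ge0// ltW.
    by rewrite /rhom; lra.
  have -> : (8 + (6 * (`|be| + 2 * Q + F1 + 1) + 4 * F1) / lam) * A =
    3 * R2 * d + 2 * F1 * d + 2 * A.
    by rewrite /d /R2 /kap; field; rewrite gt_eqF.
  by lra.
apply: (@le_trans _ _ ((E + R2 * d) * phi s)); last by rewrite ler_pM2r.
have := ler_normB (y1 s + R2 * v s) (R2 * v s).
rewrite addrK normrM (gtr0_norm R2_gt0) => H.
have : R2 * `|v s| <= R2 * (d * phi s) by rewrite ler_pM2l.
by have := pE s; lra.
Qed.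

End corrector.

(** * Cosine approximation of Lipschitz functions *)

Section trigonometry.
Context {R : realType}.
Implicit Types (x y z : R).

Lemma cosM x y : cos x * cos y = (cos (x + y) + cos (x - y)) / 2.
Proof. by rewrite cosD cosB; field. Qed.

Lemma sin_lower z : 0 <= z <= pi / 2 -> z / 3 <= sin z.
Proof.
move=> /andP[z0 zpi].
have sz : 0 <= sin z by apply: sin_ge0_pi; have := @pi_gt0 R; lra.
have dg (t : R) : is_derive t 1 (fun t : R => sin t - t * cos t) (t * sin t).
  by apply: is_derive_eq; rewrite /GRing.scale /=; ring.
have := derivative_ge _ _ 0 z 0 dg z0; rewrite sin0 !mul0r !subr0.
have H x : 0 <= x <= z -> 0 <= x * sin x.
  move=> /andP[x0 xz]; rewrite mulr_ge0// sin_ge0_pi// x0/=.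
  by have := @pi_gt0 R; lra.
move=> /(_ H); rewrite subr_ge0 => zc.
have cz : 0 <= cos z by apply: cos_ge0_pihalf; rewrite zpi andbT; lra.
have z2 : z <= 2 by have := @pihalf_lt2 R; lra.
have H2 : (z * cos z) ^+ 2 <= sin z ^+ 2.
  by rewrite ler_sqr ?nnegrE ?mulr_ge0.
rewrite -ler_sqr ?nnegrE ?divr_ge0//.
have zz : z ^+ 2 <= 4.
  by rewrite (_ : 4 = 2 ^+ 2); [rewrite ler_sqr ?nnegrE|ring].
have s2 := sqr_ge0 (sin z); have z20 := sqr_ge0 z.
move: H2; rewrite exprMn cos2sin2 => H2.
have : z ^+ 2 * sin z ^+ 2 <= 4 * sin z ^+ 2 by rewrite ler_wpM2r.
have -> : (z / 3) ^+ 2 = z ^+ 2 / 9 by field.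
by lra.
Qed.

(** The cosine separates the points of [0, pi] at least quadratically: it is
    2 sin u sin z for z = (y - x) / 2 and the midpoint u, and both sines are at
    least z / 3. *)
Lemma cos_separates x y : 0 <= x <= pi -> 0 <= y <= pi ->
  (x - y) ^+ 4 <= 324 * (cos x - cos y) ^+ 2.
Proof.
wlog xy : x y / x <= y => [H|] x0pi y0pi.
  have [xy|/ltW yx] := leP x y; first exact: H.
  have := H y x yx y0pi x0pi.
  rewrite (_ : (x - y) ^+ 4 = (y - x) ^+ 4); last by ring.
  by rewrite (_ : (cos x - cos y) ^+ 2 = (cos y - cos x) ^+ 2); last by ring.
move: x0pi y0pi => /andP[x0 xpi] /andP[y0 ypi].
pose u := (x + y) / 2; pose z := (y - x) / 2.
have z0 : 0 <= z by rewrite /z; lra.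
have zpi : z <= pi / 2 by rewrite /z; lra.
have sz : z / 3 <= sin z by apply: sin_lower; rewrite z0.
have su : sin z <= sin u.
  have [upi|upi] := leP u (pi / 2).
    have: z <= u by rewrite /u /z; lra.
    rewrite le_eqVlt => /orP[/eqP->//|zu]; apply/ltW.
    by rewrite ltr_sin// in_itv/=; apply/andP; split; have := @pi_gt0 R; lra.
  have -> : sin u = sin (pi - u) by rewrite sinB sinpi cospi; ring.
  have: z <= pi - u by rewrite /u /z; lra.
  rewrite le_eqVlt => /orP[/eqP->//|zu]; apply/ltW.
  by rewrite ltr_sin// in_itv/=; apply/andP; split; have := @pi_gt0 R;
    move: upi; rewrite /u; lra.
have E : cos x - cos y = 2 * sin u * sin z.
  rewrite (_ : x = u - z); last by rewrite /u /z; field.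
  rewrite (_ : y = u + z); last by rewrite /u /z; field.
  by rewrite cosB cosD; ring.
have szz : (z / 3) ^+ 2 <= sin u * sin z.
  by rewrite expr2; apply: ler_pM; rewrite ?divr_ge0//; lra.
have : ((z / 3) ^+ 2) ^+ 2 <= (sin u * sin z) ^+ 2.
  by rewrite ler_sqr ?nnegrE ?sqr_ge0// (le_trans _ szz)// sqr_ge0.
rewrite E (_ : x - y = - 2 * z); last by rewrite /z; field.
rewrite -!exprM (_ : (- 2 * z) ^+ 4 = 324 * 4 * (z / 3) ^+ (2 * 2)); last first.
  by rewrite mulnE/=; field.
rewrite (_ : (2 * sin u * sin z) ^+ 2 = 4 * (sin u * sin z) ^+ 2); last by ring.
by lra.
Qed.

Lemma norm_le_fourth z (eta : R) : 0 < eta -> `|z| <= eta + z ^+ 4 / eta ^+ 3.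
Proof.
move=> eta0; have z4 : 0 <= z ^+ 4 by rewrite (exprM z 2 2) sqr_ge0.
have e3 : 0 < eta ^+ 3 by rewrite exprn_gt0.
have [ze|/ltW ez] := leP `|z| eta.
  by rewrite (le_trans ze)// lerDl divr_ge0// ltW.
suff : `|z| <= z ^+ 4 / eta ^+ 3 by lra.
rewrite ler_pdivlMr// (_ : z ^+ 4 = `|z| * `|z| ^+ 3); last first.
  by rewrite -exprS -normrX ger0_norm.
by rewrite ler_wpM2l// lerXn2r ?nnegrE// ltW.
Qed.

End trigonometry.

Section fejer.
Context {R : realType} (n : nat).
Implicit Types (x : R) (a : nat -> R) (i k : nat).
Local Notation N := n.+1.

Let Nn0 : N%:R != 0 :> R. Proof. by rewrite pnatr_eq0. Qed.
Let N_gt0 : 0 < N%:R :> R. Proof. by rewrite ltr0n. Qed.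

Definition node i : R := (i%:R + 2^-1) * (pi / N%:R).

Lemma node_bounds i : (i < N)%N -> 0 <= node i <= pi.
Proof.
move=> iN; have p0 := @pi_gt0 R; apply/andP; split.
  apply: mulr_ge0; first by rewrite addr_ge0// invr_ge0.
  by rewrite divr_ge0// pi_ge0.
rewrite /node mulrA ler_pdivrMr// mulrC ler_pM2l//.
have : i.+1%:R <= N%:R :> R by rewrite ler_nat.
by rewrite -natr1; lra.
Qed.

(** Fejer's multipliers. *)
Definition multiplier k : R := if k == 0%N then 1 else 2 * (1 - k%:R / N%:R).

Lemma multiplier_bounds k : (k < N)%N -> 0 <= multiplier k <= 2.
Proof.
move=> kN; rewrite /multiplier; case: ifP => _; first by lra.
have k1 : k%:R / N%:R <= 1 :> R.
  by rewrite ler_pdivrMr// mul1r ler_nat ltnW.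
have : 0 <= k%:R / N%:R :> R by rewrite divr_ge0.
by move: k1; move: (_ / _) => q q1 q0; apply/andP; split; lra.
Qed.

(** Fejer's kernel is a sum of squares. *)
Lemma fejer_ge0 x : 0 <= \sum_(k < N) multiplier k * cos (k%:R * x).
Proof.
pose T m : R := if m is m'.+1 then m'.+1%:R +
  \sum_(j < m'.+1) 2 * (m'%:R - j%:R) * cos (j.+1%:R * x) else 0.
have TE m : T m = (\sum_(j < m) cos (j%:R * x)) ^+ 2 +
    (\sum_(j < m) sin (j%:R * x)) ^+ 2.
  elim: m => [|m IH]; first by rewrite !big_ord0 /=; ring.
  have -> : T m.+1 = T m + 1 + 2 * \sum_(j < m) cos (j.+1%:R * x).
    case: m {IH} => [|m].
      by rewrite /T big_ord_recr !big_ord0 /=; ring.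
    have E : \sum_(j < m.+1) 2 * (m.+1%:R - j%:R) * cos (j.+1%:R * x) =
        \sum_(j < m.+1) 2 * (m%:R - j%:R) * cos (j.+1%:R * x) +
        2 * \sum_(j < m.+1) cos (j.+1%:R * x).
      rewrite mulr_sumr -big_split /=; apply: eq_bigr => j _.
      by rewrite -[m.+1%:R]natr1; ring.
    rewrite /T big_ord_recr /= subrr mulr0 mul0r addr0 E -[m.+2%:R]natr1.
    by ring.
  rewrite IH !big_ord_recr /=.
  set C := \sum_(j < m) cos _; set S := \sum_(j < m) sin _.
  have -> : \sum_(j < m) cos (j.+1%:R * x) =
      cos (m%:R * x) * C + sin (m%:R * x) * S.
    rewrite (reindex_inj rev_ord_inj) /= !mulr_sumr -big_split /=.
    apply: eq_bigr => j _; rewrite -cosB -mulrBl -natrB ?(ltnW (ltn_ord j))//.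
    by rewrite subnSK.
  by have := cos2Dsin2 (m%:R * x); move: (cos _) (sin _) => c s cs; lra.
have -> : \sum_(k < N) multiplier k * cos (k%:R * x) = T N / N%:R.
  rewrite /T [in RHS]big_ord_recr /= subrr mulr0 mul0r addr0 mulrDl divff//.
  rewrite big_ord_recl /multiplier /= mul0r cos0 mulr1 mulr_suml.
  congr (_ + _); apply: eq_bigr => k _.
  by rewrite /bump leq0n add1n -!natr1; field; rewrite natr1.
by rewrite divr_ge0// TE addr_ge0 ?sqr_ge0.
Qed.

Let h : R := pi / N%:R / 2.

Let h_gt0 : 0 < h. Proof. by rewrite !divr_gt0 ?pi_gt0. Qed.

Lemma cos_node_telescope i k :
  2 * sin (k%:R * h) * cos (k%:R * node i) =
  sin (k%:R * (i.+1%:R * (2 * h))) - sin (k%:R * (i%:R * (2 * h))).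
Proof.
rewrite (_ : k%:R * (i.+1%:R * (2 * h)) = k%:R * node i + k%:R * h); last first.
  by rewrite /node /h -natr1; field.
rewrite (_ : k%:R * (i%:R * (2 * h)) = k%:R * node i - k%:R * h); last first.
  by rewrite /node /h; field.
by rewrite sinD sinB; ring.
Qed.

Lemma sin_nat_pi k : sin (k%:R * pi) = 0 :> R.
Proof.
elim: k => [|k IH]; first by rewrite mul0r sin0.
by rewrite -natr1 mulrDl mul1r sinD sinpi IH; ring.
Qed.

Lemma sin_kh_gt0 k : (0 < k)%N -> (k < 2 * N)%N -> 0 < sin (k%:R * h).
Proof.
move=> k0 kN; apply: sin_gt0_pi; rewrite mulr_gt0 ?ltr0n//=.
rewrite (_ : k%:R * h = pi * (k%:R / (2 * N%:R))); last by rewrite /h; field.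
rewrite gtr_pMr ?pi_gt0// ltr_pdivrMr ?mulr_gt0// mul1r -natrM ltr_nat.
exact: kN.
Qed.

(** Discrete orthogonality to the constants. *)
Lemma sum_cos_node k : (0 < k)%N -> (k < 2 * N)%N ->
  \sum_(i < N) cos (k%:R * node i) = 0 :> R.
Proof.
move=> k0 kN; have s0 := sin_kh_gt0 k k0 kN.
apply: (mulfI (_ : 2 * sin (k%:R * h) != 0)).
  by rewrite mulf_neq0 ?gt_eqF.
rewrite mulr0 mulr_sumr.
under eq_bigr do rewrite cos_node_telescope.
rewrite -(big_mkord xpredT (fun i => sin (k%:R * (i.+1%:R * (2 * h))) -
  sin (k%:R * (i%:R * (2 * h))))) telescope_sumr// mul0r mulr0 sin0 subr0.
by rewrite (_ : N%:R * (2 * h) = pi) ?sin_nat_pi// /h; field.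
Qed.

(** Summation by parts turns a bound for the increments of the samples into a
    decay of the cosine coefficients. *)
Lemma sum_cos_node_decay (D : R) a k : (0 < k)%N -> (k < N)%N ->
  (forall i, (i.+1 < N)%N -> `|a i.+1 - a i| <= D) ->
  `|\sum_(i < N) a i * cos (k%:R * node i)| <= 2 * N%:R ^+ 2 * D / k%:R.
Proof.
move=> k0 kN aD.
have k0R : 0 < k%:R :> R by rewrite ltr0n.
pose s i : R := sin (k%:R * (i%:R * (2 * h))).
have abel m : \sum_(i < m.+1) a i * (s i.+1 - s i) =
    a m * s m.+1 - a 0%N * s 0%N - \sum_(i < m) (a i.+1 - a i) * s i.+1.
  elim: m => [|m IH]; first by rewrite big_ord_recr !big_ord0 /=; ring.
  by rewrite big_ord_recr /= IH big_ord_recr /=; ring.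
have s0 : s 0%N = 0 by rewrite /s mul0r mulr0 sin0.
have sN : s N = 0.
  by rewrite /s (_ : N%:R * (2 * h) = pi) ?sin_nat_pi// /h; field.
have S : 2 * sin (k%:R * h) * (\sum_(i < N) a i * cos (k%:R * node i)) =
    - \sum_(i < n) (a i.+1 - a i) * s i.+1.
  have := abel n; rewrite sN s0 !mulr0 subr0 sub0r => <-; rewrite mulr_sumr.
  by apply: eq_bigr => i _; rewrite mulrCA cos_node_telescope.
have nD : `|\sum_(i < n) (a i.+1 - a i) * s i.+1| <= N%:R * D.
  apply: le_trans (ler_norm_sum _ _ _) _.
  apply: (@le_trans _ _ (\sum_(i < n) D)).
    apply: ler_sum => i _; rewrite normrM -[D]mulr1; apply: ler_pM => //.
      by apply: aD; rewrite ltnS.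
    exact: sin_max.
  rewrite sumr_const card_ord -[D *+ n]mulr_natl; case: (ltnP 0 n) => [n0|].
    have D0 : 0 <= D by apply: le_trans (normr_ge0 _) (aD 0%N _).
    by rewrite ler_wpM2r// ler_nat.
  rewrite leqn0 => /eqP n0; move: kN; rewrite n0 ltnS leqNgt k0//.
have p2 := @pi_ge2 R.
have sk : k%:R / (3 * N%:R) <= sin (k%:R * h).
  have hk : k%:R * h / 3 <= sin (k%:R * h).
    apply: sin_lower; rewrite mulr_ge0 ?(ltW h_gt0)//=.
    rewrite (_ : k%:R * h = pi / 2 * (k%:R / N%:R)); last by rewrite /h; field.
    rewrite ler_piMr ?divr_ge0 ?pi_ge0// ler_pdivrMr// mul1r ler_nat.
    exact: ltnW.
  apply: le_trans hk; rewrite (_ : k%:R * h / 3 = pi / 2 * (k%:R / (3 * N%:R))).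
    by apply: ler_peMl; [rewrite divr_ge0// mulr_ge0|lra].
  by rewrite /h; field.
have s_gt0 : 0 < k%:R / (3 * N%:R) :> R by rewrite divr_gt0 ?mulr_gt0.
set X := \sum_(i < N) a i * _ in S *.
have H : 2 * (k%:R / (3 * N%:R)) * `|X| <= N%:R * D.
  apply: le_trans nD; rewrite -[X in _ <= X]normrN -S !normrM ler_wpM2r//.
  rewrite (ger0_norm (ler0n R 2)) ler_pM2l// gtr0_norm//.
  exact: lt_le_trans sk.
rewrite ler_pdivlMr//.
have : N%:R * D * (3 * N%:R) = 3 * N%:R ^+ 2 * D by ring.
move: H; rewrite -(ler_pM2r (_ : 0 < 3 * N%:R)) ?mulr_gt0//.
have -> : 2 * (k%:R / (3 * N%:R)) * `|X| * (3 * N%:R) = 2 * (`|X| * k%:R) by field.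
have D0 : 0 <= N%:R ^+ 2 * D.
  have := le_trans (normr_ge0 _) nD; rewrite pmulr_rge0// => D0.
  by rewrite mulr_ge0 ?sqr_ge0.
by move=> + E; rewrite E; lra.
Qed.

Definition kernel x i : R := N%:R^-1 *
  \sum_(k < N) multiplier k * cos (k%:R * x) * cos (k%:R * node i).

Lemma kernel_ge0 x i : 0 <= kernel x i.
Proof.
rewrite /kernel mulr_ge0 ?invr_ge0//.
have -> : \sum_(k < N) multiplier k * cos (k%:R * x) * cos (k%:R * node i) =
  (\sum_(k < N) multiplier k * cos (k%:R * (x + node i)) +
   \sum_(k < N) multiplier k * cos (k%:R * (x - node i))) / 2.
  rewrite -big_split /= mulr_suml; apply: eq_bigr => k _.
  by rewrite -mulrA cosM mulrDr mulrBr; ring.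
by rewrite divr_ge0// addr_ge0// fejer_ge0.
Qed.

Lemma sum_cos_cos_node j k : (0 < j)%N -> (k < N)%N -> (j + k < 2 * N)%N ->
  \sum_(i < N) cos (j%:R * node i) * cos (k%:R * node i) =
  if k == j then N%:R / 2 else 0.
Proof.
move=> j0 kN jkN.
under eq_bigr do rewrite cosM -mulrDl -mulrBl -natrD.
rewrite -mulr_suml big_split /= sum_cos_node//; last by rewrite addn_gt0 j0.
rewrite add0r; case: eqP => [->|/eqP kj].
  under eq_bigr do rewrite subrr mul0r cos0.
  by rewrite sumr_const card_ord.
have [jk|kj'] := leqP j k.
  under eq_bigr do rewrite -cosN -mulNr opprB -natrB//.
  rewrite sum_cos_node ?mul0r ?subn_gt0//.
    by rewrite ltn_neqAle eq_sym kj.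
  by apply: leq_ltn_trans jkN; apply: leq_trans (leq_subr _ _) (leq_addl _ _).
under eq_bigr do rewrite -natrB 1?ltnW//.
rewrite sum_cos_node ?mul0r ?subn_gt0//.
by apply: leq_ltn_trans jkN; apply: leq_trans (leq_subr _ _) (leq_addr _ _).
Qed.

Lemma kernel_cos j x : (0 < j)%N -> (j < N)%N ->
  \sum_(i < N) cos (j%:R * node i) * kernel x i =
  (1 - j%:R / N%:R) * cos (j%:R * x).
Proof.
move=> j0 jN; rewrite /kernel.
transitivity (N%:R^-1 * \sum_(k < N) multiplier k * cos (k%:R * x) *
    \sum_(i < N) cos (j%:R * node i) * cos (k%:R * node i)).
  rewrite mulr_sumr; under [RHS]eq_bigr do rewrite !mulr_sumr.
  rewrite exchange_big /=; apply: eq_bigr => i _.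
  by rewrite !mulr_sumr; apply: eq_bigr => k _; ring.
have jk k : (k < N)%N -> (j + k < 2 * N)%N.
  by move=> kN; rewrite mul2n -addnn -addSn leq_add// ltnW.
rewrite (bigD1 (Ordinal jN))//= sum_cos_cos_node// ?eqxx; last exact: jk.
rewrite big1 ?addr0; last first.
  move=> k kj; rewrite sum_cos_cos_node//; last exact: jk.
  by rewrite (negPf (_ : k != j :> nat)) ?mulr0.
by rewrite /multiplier gtn_eqF//; field.
Qed.

Lemma kernel_sum x : \sum_(i < N) kernel x i = 1.
Proof.
rewrite /kernel -mulr_sumr exchange_big /=.
rewrite (bigD1 ord0)//= [X in X + _](_ : _ = N%:R); last first.
  under eq_bigr do rewrite !mul0r !cos0 !mulr1 /multiplier/=.
  by rewrite sumr_const card_ord.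
rewrite big1 ?addr0 ?mulVf//.
move=> k k0; rewrite -mulr_sumr sum_cos_node ?mulr0 ?lt0n//.
by rewrite mul2n -addnn; apply: leq_trans (ltn_ord k) (leq_addr _ _).
Qed.

(** The kernel concentrates: its second moment in the variable cos x is
    exactly 1 / N, since the multipliers of the frequencies 1 and 2 are
    1 - 1 / N and 1 - 2 / N. *)
Lemma kernel_moment x : (2 < N)%N ->
  \sum_(i < N) (cos x - cos (node i)) ^+ 2 * kernel x i = N%:R^-1.
Proof.
move=> N2.
have c1 := kernel_cos 1 x isT (ltnW N2); have c2 := kernel_cos 2 x isT N2.
have c2E y : cos (2%:R * y) = 2 * cos y ^+ 2 - 1 :> R.
  by rewrite mulr_natl cos_mulr2n -mulr_natl.
transitivity ((cos x ^+ 2 + 2^-1) * (\sum_(i < N) kernel x i) +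
    - (2 * cos x) * (\sum_(i < N) cos (1%:R * node i) * kernel x i) +
    2^-1 * (\sum_(i < N) cos (2%:R * node i) * kernel x i)).
  rewrite !mulr_sumr -!big_split /=; apply: eq_bigr => i _.
  by rewrite c2E mul1r; field.
by rewrite kernel_sum c1 c2 c2E !mul1r; field.
Qed.

Definition coefficient k a : R := N%:R^-1 * multiplier k *
  \sum_(i < N) a i * cos (k%:R * node i).

Definition cosine_sum a x : R := \sum_(k < N) coefficient k a * cos (k%:R * x).

Lemma cosine_sumE a x : cosine_sum a x = \sum_(i < N) a i * kernel x i.
Proof.
rewrite /cosine_sum /coefficient /kernel.
transitivity (\sum_(k < N) \sum_(i < N)
    N%:R^-1 * multiplier k * a i * cos (k%:R * node i) * cos (k%:R * x)).
  apply: eq_bigr => k _; rewrite mulr_sumr mulr_suml.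
  by apply: eq_bigr => i _; ring.
rewrite exchange_big /=; apply: eq_bigr => i _.
by rewrite !mulr_sumr; apply: eq_bigr => k _; ring.
Qed.

Lemma cosine_sum_bound (M : R) a x : (forall i, (i < N)%N -> `|a i| <= M) ->
  `|cosine_sum a x| <= M.
Proof.
move=> aM; rewrite cosine_sumE; apply: le_trans (ler_norm_sum _ _ _) _.
apply: (@le_trans _ _ (\sum_(i < N) M * kernel x i)); last first.
  by rewrite -mulr_sumr kernel_sum mulr1.
apply: ler_sum => i _; rewrite normrM (ger0_norm (kernel_ge0 x i)).
by rewrite ler_wpM2r ?kernel_ge0// aM.
Qed.

(** Chebyshev's inequality turns the second moment into an error bound for
    Lipschitz samples. *)
Lemma cosine_sum_error (eta Lam al : R) a x : (2 < N)%N -> 0 < eta -> 0 <= Lam ->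
  0 <= x <= pi -> (forall i, (i < N)%N -> `|a i - al| <= Lam * `|x - node i|) ->
  `|cosine_sum a x - al| <= Lam * (eta + 324 / (eta ^+ 3 * N%:R)).
Proof.
move=> N2 eta0 Lam0 xpi aal.
have e3 : 0 < eta ^+ 3 by rewrite exprn_gt0.
have etan0 : eta != 0 by rewrite gt_eqF.
have -> : cosine_sum a x - al = \sum_(i < N) (a i - al) * kernel x i.
  rewrite cosine_sumE -{1}[al]mulr1 -(kernel_sum x) mulr_sumr -sumrB.
  by apply: eq_bigr => i _; ring.
apply: le_trans (ler_norm_sum _ _ _) _.
apply: (@le_trans _ _ (\sum_(i < N) Lam * ((eta * kernel x i) +
    324 / eta ^+ 3 * ((cos x - cos (node i)) ^+ 2 * kernel x i)))); last first.
  rewrite -mulr_sumr big_split /=.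
  rewrite -(mulr_sumr _ _ _ eta) -(mulr_sumr _ _ _ (324 / eta ^+ 3)).
  rewrite kernel_sum kernel_moment// mulr1.
  by rewrite le_eqVlt; apply/orP; left; apply/eqP; field; rewrite etan0 andbT nat1r.
apply: ler_sum => i _; rewrite normrM (ger0_norm (kernel_ge0 x i)).
rewrite [X in _ <= X](_ : _ = Lam * (eta + 324 / eta ^+ 3 *
  (cos x - cos (node i)) ^+ 2) * kernel x i); last by ring.
rewrite ler_wpM2r ?kernel_ge0//.
apply: le_trans (aal i (ltn_ord i)) _; rewrite ler_wpM2l//.
apply: le_trans (norm_le_fourth _ _ eta0) _; rewrite lerD2l.
rewrite [X in _ <= X]mulrAC ler_pM2r ?invr_gt0//.
exact: cos_separates xpi (node_bounds _ (ltn_ord i)).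
Qed.

Lemma coefficient_bound (M : R) a k : (k < N)%N ->
  (forall i, (i < N)%N -> `|a i| <= M) -> `|coefficient k a| <= 2 * M.
Proof.
move=> kN aM; have /andP[m0 m2] := multiplier_bounds k kN.
have H : `|\sum_(i < N) a i * cos (k%:R * node i)| <= N%:R * M.
  apply: le_trans (ler_norm_sum _ _ _) _.
  apply: (@le_trans _ _ (\sum_(i < N) M)).
    apply: ler_sum => i _; rewrite normrM -[M]mulr1; apply: ler_pM => //.
      exact: aM.
    exact: cos_max.
  by rewrite sumr_const card_ord -[M *+ _]mulr_natl.
rewrite /coefficient !normrM (ger0_norm m0) normfV (gtr0_norm N_gt0).
rewrite -mulrA ler_pdivrMl// mulrA (mulrC _ 2) -mulrA; apply: ler_pM => //.
Qed.

Lemma coefficient_decay (D : R) a k : (0 < k)%N -> (k < N)%N ->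
  (forall i, (i.+1 < N)%N -> `|a i.+1 - a i| <= D) ->
  `|coefficient k a| <= 4 * N%:R * D / k%:R.
Proof.
move=> k0 kN aD; have /andP[m0 m2] := multiplier_bounds k kN.
have H := sum_cos_node_decay D a k k0 kN aD.
rewrite /coefficient !normrM (ger0_norm m0) normfV (gtr0_norm N_gt0).
rewrite -mulrA ler_pdivrMl//.
rewrite (_ : N%:R * (4 * N%:R * D / k%:R) = 2 * (2 * N%:R ^+ 2 * D / k%:R));
  last by ring.
exact: ler_pM.
Qed.

Lemma coefficientB k a a' :
  coefficient k a - coefficient k a' = coefficient k (fun i => a i - a' i).
Proof.
rewrite /coefficient -mulrBr -sumrB; congr (_ * _).
by apply: eq_bigr => i _; ring.
Qed.

Lemma cosine_sumB a a' x :
  cosine_sum a x - cosine_sum a' x = cosine_sum (fun i => a i - a' i) x.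
Proof.
rewrite /cosine_sum -sumrB; apply: eq_bigr => k _.
by rewrite -coefficientB; ring.
Qed.

Lemma coefficient_exchange k l (a : nat -> nat -> R) :
  coefficient k (fun i => coefficient l (a i)) =
  coefficient l (fun j => coefficient k (fun i => a i j)).
Proof.
rewrite /coefficient.
transitivity (\sum_(i < N) \sum_(j < N) N%:R^-1 * multiplier k *
    (N%:R^-1 * multiplier l) *
    (a i j * cos (k%:R * node i) * cos (l%:R * node j))).
  rewrite mulr_sumr; apply: eq_bigr => i _.
  by rewrite mulr_sumr mulr_suml mulr_sumr; apply: eq_bigr => j _; ring.
rewrite exchange_big mulr_sumr; apply: eq_bigr => j _.
by rewrite mulr_sumr mulr_suml mulr_sumr; apply: eq_bigr => i _; ring.
Qed.

End fejer.

Section sampled_functions.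
Context {R : realType} (L : R).
Hypothesis L_gt0 : 0 < L.
Notation mu := (@lebesgue_measure R).
Implicit Types (F : R -> R) (n k : nat) (t : R).

Definition lipschitz_on F (Lam : R) : Prop :=
  forall x y : R, 0 <= x <= L -> 0 <= y <= L -> `|F x - F y| <= Lam * `|x - y|.

Definition sample n F i : R := F (L / pi * node n i).

Definition cosine_approx n F t : R := cosine_sum n (sample n F) (pi / L * t).

Let p0 : 0 < pi :> R := pi_gt0 R.
Let pn0 : pi != 0 :> R. Proof. by rewrite gt_eqF. Qed.
Let Ln0 : L != 0. Proof. by rewrite gt_eqF. Qed.

Lemma scaled_node n i : (i < n.+1)%N -> 0 <= L / pi * node n i <= L.
Proof.
move=> iN; have /andP[x0 x1] := @node_bounds R n i iN.
have Lp : 0 < L / pi by rewrite divr_gt0.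
rewrite mulr_ge0 ?(ltW Lp)//=.
by rewrite mulrAC ler_pdivrMr// ler_pM2l.
Qed.

Lemma scaled_angle t : 0 <= t <= L -> 0 <= pi / L * t <= pi.
Proof.
move=> /andP[t0 tL]; rewrite mulr_ge0 ?divr_ge0 ?(ltW p0) ?(ltW L_gt0)//=.
by rewrite mulrAC ler_pdivrMr// ler_pM2l.
Qed.

Lemma lipschitz_ge0 F (Lam : R) : lipschitz_on F Lam -> 0 <= Lam.
Proof.
move=> FL; have := FL L 0; rewrite subr0 (gtr0_norm L_gt0) !lexx (ltW L_gt0)/=.
move=> /(_ isT isT) H; have := le_trans (normr_ge0 _) H.
by rewrite pmulr_lge0.
Qed.

Lemma lipschitz_continuous F (Lam : R) : lipschitz_on F Lam ->
  {within `[0, L], continuous F}.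
Proof.
move=> FL; apply/within_continuousP => x; rewrite /= in_itv/= => x0 e e0.
have Lam0 := lipschitz_ge0 _ _ FL.
exists (e / (Lam + 1)); first by rewrite divr_gt0// ltr_wpDl.
move=> y; rewrite /= in_itv/= => y0; rewrite ltr_pdivlMr ?ltr_wpDl// => xy.
apply: le_lt_trans (FL _ _ x0 y0) _; apply: le_lt_trans xy.
by rewrite mulrC ler_wpM2l// lerDl.
Qed.

Lemma lipschitz_integrable F (Lam : R) : lipschitz_on F Lam ->
  mu.-integrable `[0, L] (EFin \o F).
Proof.
move=> /lipschitz_continuous cF; apply: continuous_compact_integrable => //.
exact: segment_compact.
Qed.

(** The number of nodes depends on the Lipschitz constant only. *)
Lemma cosine_approx_error (Lam e : R) : 0 <= Lam -> 0 < e -> exists n0, forall n,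
  (n0 <= n)%N -> forall F, lipschitz_on F Lam ->
  forall t, 0 <= t <= L -> `|cosine_approx n F t - F t| <= e.
Proof.
move=> Lam0 e0; pose Lam' := Lam * (L / pi).
have Lp : 0 < L / pi by rewrite divr_gt0.
have L0 : 0 <= Lam' by rewrite mulr_ge0// ltW.
pose eta := e / (2 * (Lam' + 1)).
have eta0 : 0 < eta by rewrite divr_gt0// mulr_gt0// ltr_wpDl.
have e3 : 0 < eta ^+ 3 by rewrite exprn_gt0.
pose M := 324 / (eta ^+ 3 * eta).
have e34 : 0 < eta ^+ 3 * eta := mulr_gt0 e3 eta0.
have M0 : 0 <= M by rewrite divr_ge0// ltW.
exists (Num.bound M + 2)%N => n nn0 F FL t t0L.
have N2 : (2 < n.+1)%N by rewrite ltnS (leq_trans _ nn0)// leq_addl.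
have NM : M <= n.+1%:R.
  apply/ltW/(lt_le_trans (archi_boundP M0)); rewrite ler_nat.
  by rewrite ltnW// ltnS (leq_trans _ nn0)// leq_addr.
have N0 : 0 < n.+1%:R :> R by rewrite ltr0n.
apply: le_trans (cosine_sum_error n eta Lam' (F t) _ _ N2 eta0 L0
  (scaled_angle t t0L) _) _ => [i iN|].
  apply: le_trans (FL _ _ (scaled_node n i iN) t0L) _.
  rewrite /Lam' -[X in _ <= X]mulrA ler_wpM2l//.
  rewrite -[X in _ <= X * _](gtr0_norm Lp) -normrM distrC.
  have E q x : q != 0 -> L / q * (q / L * t - x) = t - L / q * x.
    by move=> qn0; field; rewrite qn0.
  by rewrite E.
have : 324 / (eta ^+ 3 * n.+1%:R) <= eta.
  move: NM; rewrite /M (ler_pdivrMr _ _ e34) => NM.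
  rewrite ler_pdivrMr ?(mulr_gt0 e3 N0)//; apply: (le_trans NM).
  by rewrite le_eqVlt; apply/orP; left; apply/eqP; ring.
move=> H; apply: (@le_trans _ _ (Lam' * (eta + eta))).
  by rewrite ler_wpM2l// lerD2l.
rewrite /eta; have -> : Lam' * (e / (2 * (Lam' + 1)) + e / (2 * (Lam' + 1))) =
    e * (Lam' / (Lam' + 1)) by field; rewrite gt_eqF// ltr_wpDl.
by rewrite ler_piMr ?(ltW e0)// ler_pdivrMr ?ltr_wpDl// mul1r lerDl.
Qed.

Lemma is_derive_big (n : nat) (F dF : nat -> R -> R) t :
  (forall k, is_derive t 1 (F k) (dF k t)) ->
  is_derive t 1 (fun x => \sum_(k < n) F k x) (\sum_(k < n) dF k t).
Proof.
move=> FdF; elim: n => [|n IH].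
  rewrite big_ord0 (_ : (fun x => _) = fun=> 0); first exact: is_derive_cst.
  by apply/funext => x; rewrite big_ord0.
rewrite big_ord_recr /= (_ : (fun x => _) =
  fun x => \sum_(k < n) F k x + F n x); last first.
  by apply/funext => x; rewrite big_ord_recr.
by have Fn := FdF n; exact: is_deriveD.
Qed.

Lemma segment_integral (f Phi : R -> R) : (forall t, is_derive t 1 Phi (f t)) ->
  continuous f -> \int[mu]_(t in `[0, L]) f t = Phi L - Phi 0.
Proof.
move=> Pf cf; rewrite /Rintegral (@continuous_FTC2 R f Phi 0 L)//.
- exact: continuous_subspaceT.
- split.
  + by move=> t _; have [] := Pf t.
  + by apply: cvg_at_right_filter; exact: derivative_continuous (Pf 0).
  + by apply: cvg_at_left_filter; exact: derivative_continuous (Pf L).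
- by move=> t _; rewrite derive1E; have [_ ->] := Pf t.
Qed.

Lemma continuous_cosine_approx n F : continuous (cosine_approx n F).
Proof.
rewrite /cosine_approx /cosine_sum => t.
pose c k : R -> R := fun t => coefficient n k (sample n F) * cos (k%:R * (pi / L * t)).
pose dc k : R -> R := fun t => coefficient n k (sample n F) *
  (- sin (k%:R * (pi / L * t)) * (k%:R * (pi / L))).
have cd k : is_derive t 1 (c k) (dc k t).
  by rewrite /c /dc; apply: is_derive_eq; rewrite /GRing.scale /=; ring.
exact: (derivative_continuous _ _ _ (is_derive_big n.+1 c dc t cd)).
Qed.

Lemma cosine_approx_integral n F :
  \int[mu]_(t in `[0, L]) cosine_approx n F t = L * coefficient n 0 (sample n F).
Proof.
pose c k := coefficient n k (sample n F).
pose S k : R -> R := fun t => if k == 0%N then c 0%N * t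
  else c k * (L / (pi * k%:R) * sin (k%:R * (pi / L * t))).
pose dS k : R -> R := fun t => c k * cos (k%:R * (pi / L * t)).
have SdS t k : is_derive t 1 (S k) (dS k t).
  rewrite /S /dS; case: k => [|k] /=.
    by apply: is_derive_eq; rewrite /GRing.scale /= mul0r cos0; ring.
  have k0 : k.+1%:R != 0 :> R by rewrite pnatr_eq0.
  apply: is_derive_eq; rewrite /GRing.scale /=.
  move: (pi : R) pn0 (cos _) => q qn0 z.
  by field; rewrite qn0 Ln0 nat1r k0.
pose Phi t := \sum_(k < n.+1) S k t.
have Phid t : is_derive t 1 Phi (cosine_approx n F t).
  exact: (is_derive_big n.+1 S dS t (SdS t)).
rewrite (segment_integral _ _ Phid (continuous_cosine_approx n F)) /Phi.
rewrite !big_ord_recl /= !big1 => [|k _|k _]; rewrite /S /= ?mulr0 ?sin0 ?mulr0//.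
  by rewrite !addr0 subr0 mulrC.
rewrite divfK// sin_nat_pi ?mulr0//.
Qed.

(** Hence the constant coefficient is close to the mean value. *)
Lemma mean_approx n F (Lam e : R) : lipschitz_on F Lam ->
  (forall t, 0 <= t <= L -> `|cosine_approx n F t - F t| <= e) ->
  `|L * coefficient n 0 (sample n F) - \int[mu]_(t in `[0, L]) F t| <= L * e.
Proof.
move=> FL Fe; rewrite -cosine_approx_integral.
have iJ : mu.-integrable `[0, L] (EFin \o cosine_approx n F).
  apply: continuous_compact_integrable; first exact: segment_compact.
  exact/continuous_subspaceT/continuous_cosine_approx.
have iF := lipschitz_integrable _ _ FL.
rewrite -RintegralB//.
have iB : mu.-integrable `[0, L] (EFin \o (fun t => cosine_approx n F t - F t)).
  by have := integrableB _ iJ iF; apply.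
apply: le_trans (le_normr_Rintegral _ iB) _ => //.
apply: le_trans (_ : _ <= \int[mu]_(t in `[0, L]) (cst e) t) _.
  apply: le_Rintegral => //.
  - exact: integrable_norm iB.
  - apply: continuous_compact_integrable; first exact: segment_compact.
    by apply: continuous_subspaceT => t; exact: cvg_cst.
by rewrite Rintegral_cst//= lebesgue_measure_itv/= lte_fin L_gt0 -EFinD/= subr0 mulrC.
Qed.

End sampled_functions.

Section double_sums.
Context {R : realType}.

Lemma sum_inverse_squares n :
  \sum_(k < n) (k.+1%:R ^+ 2)^-1 <= 2 - n%:R^-1 * (0 < n)%:R :> R.
Proof.
elim: n => [|[|n] IH]; first by rewrite big_ord0 mulr0 subr0.
  by rewrite big_ord_recr big_ord0 /= add0r expr1n invr1 mulr1; lra.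
rewrite big_ord_recr /=; move: IH; rewrite /= !mulr1 => IH.
have n1 : 0 < n.+1%:R :> R by rewrite ltr0n.
have n2 : 0 < n.+2%:R :> R by rewrite ltr0n.
have E : n.+2%:R = n.+1%:R + 1 :> R by rewrite natr1.
suff H : (n.+2%:R ^+ 2)^-1 <= n.+1%:R^-1 - n.+2%:R^-1 :> R.
  by apply: le_trans (lerD IH H) _; rewrite addrA subrK.
rewrite E in n2 *; move: (n.+1%:R : R) n1 n2 => x x0 x1.
have -> : x^-1 - (x + 1)^-1 = (x * (x + 1))^-1 by field; rewrite !gt_eqF.
by rewrite lef_pV2 ?posrE ?exprn_gt0 ?mulr_gt0//; nra.
Qed.

Lemma sum_inverse_squares_le2 n : \sum_(k < n) (k.+1%:R ^+ 2)^-1 <= 2 :> R.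
Proof.
by apply: le_trans (sum_inverse_squares n) _; rewrite gerBl mulr_ge0 ?invr_ge0.
Qed.

Lemma sum_positive_squares n :
  \sum_(k < n.+1 | (0 < k)%N) (k%:R ^+ 2)^-1 <= 2 :> R.
Proof.
rewrite big_mkcond big_ord_recl /= add0r.
exact: sum_inverse_squares_le2.
Qed.

(** In two dimensions the sum of 1 / |k|^3 over the non-zero frequencies
    converges. *)
Lemma sum_inverse_cubes n :
  \sum_(p : 'I_n.+1 * 'I_n.+1 | (0 < maxn p.1 p.2)%N)
    ((maxn p.1 p.2)%:R ^+ 3)^-1 <= 8 :> R.
Proof.
pose F (k : nat) : R := if (0 < k)%N then (k%:R ^+ 3)^-1 else 0.
have F0 k : 0 <= F k by rewrite /F; case: ifP => // _; rewrite invr_ge0 exprn_ge0.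
pose H (k l : 'I_n.+1) := if (l <= k)%N then F k else 0.
have H0 k l : 0 <= H k l by rewrite /H; case: ifP.
have one_sided : \sum_k \sum_l H k l <= 4.
  apply: (@le_trans _ _ (2 * \sum_(k < n.+1 | (0 < k)%N) (k%:R ^+ 2)^-1));
    last by have := sum_positive_squares n; lra.
  rewrite mulr_sumr [X in _ <= X]big_mkcond /=; apply: ler_sum => k _.
  rewrite /H -big_mkcond /=.
  have -> : \sum_(l < n.+1 | (l <= k)%N) F k = F k * k.+1%:R.
    by rewrite -(big_ord_widen n.+1 (fun=> F k) (ltn_ord k)) sumr_const card_ord
      mulr_natr.
  rewrite /F; case: ifP => [k0|_]; last by rewrite mul0r.
  have k0R : 0 < k%:R :> R by rewrite ltr0n.
  rewrite mulrC ler_pdivrMr ?exprn_gt0// exprS.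
  rewrite (_ : 2 / k%:R ^+ 2 * (k%:R * k%:R ^+ 2) = 2 * k%:R); last first.
    by field; rewrite gt_eqF.
  have : 1 <= k%:R :> R by rewrite ler1n.
  by rewrite -natr1; lra.
apply: (@le_trans _ _ (\sum_p (H p.1 p.2 + H p.2 p.1))).
  rewrite big_mkcond /=; apply: ler_sum => -[k l] _ /=.
  case: ifP => [kl|_]; last by rewrite addr_ge0.
  have /orP[lk|lk] := leq_total l k.
    rewrite (maxn_idPl lk) in kl *; rewrite [in H k l]/H lk /F kl lerDl.
    exact: H0.
  rewrite (maxn_idPr lk) in kl *; rewrite [in H l k]/H lk /F kl lerDr.
  exact: H0.
rewrite big_split /=.
rewrite -(pair_bigA _ (fun k l => H k l)) -(pair_bigA _ (fun k l => H l k)) /=.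
by rewrite [X in _ + X]exchange_big /=; lra.
Qed.

End double_sums.

Section separable_approximation.
Context {R : realType} (L : R).
Hypothesis L_gt0 : 0 < L.
Notation mu := (@lebesgue_measure R).
Implicit Types (F : R -> R) (n k l : nat) (t x y e Lam : R).

Let om := pi / L : R.
Let om_gt0 : 0 < om. Proof. by rewrite divr_gt0 ?pi_gt0. Qed.

Lemma sample_increment n F Lam i : lipschitz_on L F Lam -> (i.+1 < n.+1)%N ->
  `|sample L n F i.+1 - sample L n F i| <= Lam * (L / n.+1%:R).
Proof.
move=> FL iN.
apply: le_trans (FL _ _ (scaled_node _ L_gt0 n i.+1 iN)
  (scaled_node _ L_gt0 n i (ltnW iN))) _.
have Lam0 := lipschitz_ge0 _ L_gt0 _ _ FL; rewrite ler_wpM2l//.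
have N0 : n.+1%:R != 0 :> R by rewrite pnatr_eq0.
have -> : L / pi * node n i.+1 - L / pi * node n i = L / n.+1%:R.
  rewrite /node -[i.+1%:R]natr1; move: (pi : R) (pi_gt0 R) => q q0.
  by field; rewrite (gt_eqF q0) nat1r N0.
by rewrite ger0_norm// divr_ge0// ltW.
Qed.

Lemma coefficient_lipschitz_decay n F Lam k : lipschitz_on L F Lam ->
  (0 < k)%N -> (k < n.+1)%N ->
  `|coefficient n k (sample L n F)| <= 4 * Lam * L / k%:R.
Proof.
move=> FL k0 kN.
have := coefficient_decay n (Lam * (L / n.+1%:R)) (sample L n F) k k0 kN
  (fun i iN => sample_increment n F Lam i FL iN).
rewrite (_ : 4 * n.+1%:R * (Lam * (L / n.+1%:R)) = 4 * Lam * L)//.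
by field; rewrite nat1r pnatr_eq0.
Qed.

Lemma integral_distance F F' Lam Lam' e : lipschitz_on L F Lam ->
  lipschitz_on L F' Lam' -> (forall t, 0 <= t <= L -> `|F t - F' t| <= e) ->
  `|\int[mu]_(t in `[0, L]) F t - \int[mu]_(t in `[0, L]) F' t| <= L * e.
Proof.
move=> FL FL' FF.
have iF := lipschitz_integrable _ L_gt0 _ _ FL.
have iF' := lipschitz_integrable _ L_gt0 _ _ FL'.
rewrite -RintegralB//.
have iB : mu.-integrable `[0, L] (EFin \o (fun t => F t - F' t)).
  by have := integrableB _ iF iF'; apply.
apply: le_trans (le_normr_Rintegral _ iB) _ => //.
apply: le_trans (_ : _ <= \int[mu]_(t in `[0, L]) (cst e) t) _.
  apply: le_Rintegral => //.
  - exact: integrable_norm iB.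
  - apply: continuous_compact_integrable; first exact: segment_compact.
    by apply: continuous_subspaceT => t; exact: cvg_cst.
by rewrite Rintegral_cst//= lebesgue_measure_itv/= lte_fin L_gt0 -EFinD/= subr0 mulrC.
Qed.

(** The coefficients of a Lipschitz function decay like 1 / k, so that with the
    weights 1 / k^2 their sum is bounded uniformly in the number of modes. *)
Lemma one_variable_approximation F Lam : lipschitz_on L F Lam ->
  exists2 C : R, 0 <= C & forall e, 0 < e -> exists n (ga : nat -> R),
  (forall x, 0 <= x <= L -> `|F x - L^-1 * (\int[mu]_(t in `[0, L]) F t) -
     \sum_(k < n.+1 | (0 < k)%N) ga k * cos (k%:R * (om * x))| <= e) /\
  \sum_(k < n.+1 | (0 < k)%N) `|ga k| / (k%:R * om) ^+ 2 <= C.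
Proof.
move=> FL; have Lam0 := lipschitz_ge0 _ L_gt0 _ _ FL.
have C0 : 0 <= 4 * Lam * L / om ^+ 2.
  by rewrite divr_ge0 ?sqr_ge0// mulr_ge0 ?(ltW L_gt0)// mulr_ge0.
exists (2 * (4 * Lam * L / om ^+ 2)); first by rewrite mulr_ge0.
move=> e e0; have e2 : 0 < e / 2 by rewrite divr_gt0.
have [n0 /(_ n0 (leqnn _) F FL) Hn] := cosine_approx_error _ L_gt0 Lam _ Lam0 e2.
exists n0, (fun k => coefficient n0 k (sample L n0 F)); split.
  move=> x x0; have := Hn x x0.
  have := mean_approx _ L_gt0 _ _ _ _ FL Hn.
  rewrite -(ler_pM2l (_ : 0 < L^-1)) ?invr_gt0// mulKf ?gt_eqF//.
  rewrite -[X in X * `|_|]gtr0_norm ?invr_gt0// -normrM mulrBr mulKf ?gt_eqF//.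
  rewrite /cosine_approx /cosine_sum big_ord_recl /= mul0r cos0 mulr1.
  rewrite [in X in _ -> _ -> `|_ - X| <= _]big_mkcond big_ord_recl /= add0r -/om.
  set c := coefficient _ _ _; set S := \sum_(k < n0) _; set I := L^-1 * _.
  rewrite !ler_norml => /andP[? ?] /andP[? ?]; apply/andP; split; lra.
apply: (@le_trans _ _ ((4 * Lam * L / om ^+ 2) *
    \sum_(k < n0.+1 | (0 < k)%N) (k%:R ^+ 2)^-1)); last first.
  by rewrite [X in _ <= X]mulrC ler_wpM2l// sum_positive_squares.
rewrite mulr_sumr; apply: ler_sum => k k0.
have k1 : 1 <= k%:R :> R by rewrite ler1n.
have kk : 0 < k%:R :> R by lra.
rewrite exprMn invfM mulrCA [X in _ <= X]mulrC ler_wpM2l ?invr_ge0 ?sqr_ge0//.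
rewrite ler_wpM2r ?invr_ge0 ?sqr_ge0//.
apply: le_trans (coefficient_lipschitz_decay _ _ _ _ FL k0 (ltn_ord k)) _.
by rewrite ler_piMr ?invf_le1// mulr_ge0 ?(ltW L_gt0)// mulr_ge0.
Qed.

(** Tensor products of the approximation in one variable.  A Lipschitz bound in
    either variable makes the coefficients decay like 1 / max (k, l), which
    with the inverse eigenvalues is still summable over the pairs. *)
Lemma two_variable_approximation (G : R -> R -> R) Lam :
  (forall x, 0 <= x <= L -> lipschitz_on L (G x) Lam) ->
  (forall y, 0 <= y <= L -> lipschitz_on L (G ^~ y) Lam) ->
  exists2 C : R, 0 <= C & forall e, 0 < e -> exists n (ga : nat -> nat -> R),
  (forall x y, 0 <= x <= L -> 0 <= y <= L ->
     `|G x y - (L ^+ 2)^-1 *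
         (\int[mu]_(s in `[0, L]) \int[mu]_(t in `[0, L]) G s t) -
       \sum_(p : 'I_n.+1 * 'I_n.+1 | (0 < maxn p.1 p.2)%N)
         ga p.1 p.2 * (cos (p.1%:R * (om * x)) * cos (p.2%:R * (om * y)))| <= e) /\
  \sum_(p : 'I_n.+1 * 'I_n.+1 | (0 < maxn p.1 p.2)%N)
    `|ga p.1 p.2| / ((p.1%:R * om) ^+ 2 + (p.2%:R * om) ^+ 2) <= C.
Proof.
move=> GL1 GL2.
have L0L : 0 <= (0 : R) <= L by rewrite lexx ltW.
have Lam0 : 0 <= Lam := lipschitz_ge0 _ L_gt0 _ _ (GL1 _ L0L).
pose K := 8 * Lam * L / om ^+ 2.
have K0 : 0 <= K.
  by rewrite divr_ge0 ?sqr_ge0// mulr_ge0 ?(ltW L_gt0)// mulr_ge0.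
exists (K * 8); first by rewrite mulr_ge0.
move=> e e_gt0.
(* Two units of the error d come from the two successive approximations and
   2 + 1 / L units from the mean value. *)
pose d := e / (4 + L^-1).
have iL : 0 < L^-1 by rewrite invr_gt0.
have d0 : 0 < d by rewrite divr_gt0//; lra.
have LL0 : 0 <= L * Lam by rewrite mulr_ge0// ltW.
have [n1 Hn1] := cosine_approx_error _ L_gt0 Lam _ Lam0 d0.
have [n2 Hn2] := cosine_approx_error _ L_gt0 (L * Lam) _ LL0 d0.
pose n := maxn n1 n2.
have A1 := Hn1 n (leq_maxl _ _); have A2 := Hn2 n (leq_maxr _ _).
pose c l x := coefficient n l (sample L n (G x)).
pose ga k l := coefficient n k (sample L n (c l)).
have nodeL i : (i < n.+1)%N -> 0 <= L / pi * node n i <= L.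
  exact: (scaled_node _ L_gt0).
have c_lip l : (l < n.+1)%N -> lipschitz_on L (c l) (2 * Lam).
  move=> lN x y x0 y0; rewrite /c coefficientB -mulrA.
  apply: coefficient_bound => // i iN; rewrite /sample.
  exact: GL2 (nodeL i iN) _ _ x0 y0.
have ga_sym k l : ga k l = coefficient n l
    (sample L n (fun y => coefficient n k (sample L n (G ^~ y)))).
  exact: coefficient_exchange.
have c'_lip k : (k < n.+1)%N ->
    lipschitz_on L (fun y => coefficient n k (sample L n (G ^~ y))) (2 * Lam).
  move=> kN x y x0 y0; rewrite coefficientB -mulrA.
  apply: coefficient_bound => // i iN; rewrite /sample.
  exact: GL1 (nodeL i iN) _ _ x0 y0.
have ga_bound k l : (k < n.+1)%N -> (l < n.+1)%N -> (0 < maxn k l)%N ->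
    `|ga k l| <= 8 * Lam * L / (maxn k l)%:R.
  move=> kN lN kl; have E : 8 * Lam * L = 4 * (2 * Lam) * L by ring.
  have /orP[lk|lk] := leq_total l k.
    rewrite (maxn_idPl lk) in kl *; rewrite E.
    exact: coefficient_lipschitz_decay (c_lip l lN) kl kN.
  rewrite (maxn_idPr lk) in kl *; rewrite E ga_sym.
  exact: coefficient_lipschitz_decay (c'_lip k kN) kl lN.
pose H x := \int[mu]_(t in `[0, L]) G x t.
have H_lip : lipschitz_on L H (L * Lam).
  move=> x y x0 y0; rewrite -mulrA.
  apply: integral_distance (GL1 _ x0) (GL1 _ y0) _ => t t0.
  exact: GL2 t0 _ _ x0 y0.
have mean_c x : 0 <= x <= L -> `|L * c 0%N x - H x| <= L * d.
  move=> x0; exact: (mean_approx _ L_gt0 _ _ _ _ (GL1 _ x0) (A1 _ (GL1 _ x0))).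
have mean_H := mean_approx _ L_gt0 _ _ _ _ H_lip (A2 _ H_lip).
have c0H : `|coefficient n 0 (sample L n (fun x => L * c 0%N x)) -
    coefficient n 0 (sample L n H)| <= 2 * (L * d).
  rewrite coefficientB; apply: coefficient_bound => // i iN.
  exact: mean_c (nodeL i iN).
have coefZ : coefficient n 0 (sample L n (fun x => L * c 0%N x)) = L * ga 0%N 0%N.
  rewrite /ga /coefficient mulrCA; congr (_ * _); rewrite mulr_sumr.
  by apply: eq_bigr => i _; rewrite /sample; ring.
have mean_ga : `|ga 0%N 0%N - (L ^+ 2)^-1 * (\int[mu]_(s in `[0, L]) H s)| <=
    2 * d + L^-1 * d.
  have iL2 : 0 < (L ^+ 2)^-1 by rewrite invr_gt0 exprn_gt0.
  have -> : ga 0%N 0%N - (L ^+ 2)^-1 * (\int[mu]_(s in `[0, L]) H s) =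
    (L ^+ 2)^-1 * (L * (L * ga 0%N 0%N - coefficient n 0 (sample L n H)) +
      (L * coefficient n 0 (sample L n H) - \int[mu]_(s in `[0, L]) H s)).
    by field; rewrite gt_eqF.
  rewrite normrM (gtr0_norm iL2) ler_pdivrMl ?exprn_gt0//.
  apply: le_trans (ler_normD _ _) _; rewrite normrM (gtr0_norm L_gt0).
  rewrite coefZ in c0H.
  have -> : L ^+ 2 * (2 * d + L^-1 * d) = L * (2 * (L * d)) + L * d.
    by field; rewrite gt_eqF.
  by apply: lerD => //; rewrite ler_pM2l.
exists n, ga; split.
- move=> x y x0 y0.
  pose Hy s := cosine_approx L n (G s) y.
  have HyE : cosine_approx L n Hy x =
      \sum_(p : 'I_n.+1 * 'I_n.+1)
        ga p.1 p.2 * (cos (p.1%:R * (om * x)) * cos (p.2%:R * (om * y))).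
    rewrite -(pair_bigA _ (fun k l : 'I_n.+1 => ga k l *
      (cos (k%:R * (om * x)) * cos (l%:R * (om * y))))) /=.
    apply: eq_bigr => k _; rewrite /ga /coefficient.
    transitivity (\sum_(l < n.+1) \sum_(i < n.+1) n.+1%:R^-1 * multiplier n k *
      (c l (L / pi * node n i) * cos (l%:R * (om * y)) * cos (k%:R * node n i)) *
       cos (k%:R * (om * x))).
      rewrite exchange_big /= mulr_sumr mulr_suml; apply: eq_bigr => i _.
      rewrite /sample /Hy /cosine_approx /cosine_sum -/om.
      by rewrite mulr_suml mulr_sumr mulr_suml.
    apply: eq_bigr => l _; rewrite mulr_sumr mulr_suml; apply: eq_bigr => i _.
    by rewrite /sample; ring.
  have err1 : `|cosine_approx L n Hy x - cosine_approx L n (G ^~ y) x| <= d.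
    rewrite /cosine_approx cosine_sumB; apply: cosine_sum_bound => i iN.
    exact: A1 (GL1 _ (nodeL i iN)) _ y0.
  have err2 := A1 _ (GL2 _ y0) _ x0.
  have split0 : \sum_(p : 'I_n.+1 * 'I_n.+1)
        ga p.1 p.2 * (cos (p.1%:R * (om * x)) * cos (p.2%:R * (om * y))) =
      ga 0%N 0%N + \sum_(p : 'I_n.+1 * 'I_n.+1 | (0 < maxn p.1 p.2)%N)
        ga p.1 p.2 * (cos (p.1%:R * (om * x)) * cos (p.2%:R * (om * y))).
    rewrite (bigD1 (ord0, ord0))//= !mul0r !cos0 !mulr1; congr (_ + _).
    apply: eq_bigl => -[k l] /=; rewrite xpair_eqE -!val_eqE /=.
    by rewrite leq_max !lt0n negb_and.
  rewrite HyE split0 in err1; move: err1 err2 mean_ga.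
  set S := \sum_(p | _) _; set I := _^-1 * _; set g0 := ga _ _.
  have -> : e = 4 * d + L^-1 * d.
    rewrite /d; have : 4 + L^-1 != 0 by rewrite gt_eqF// addr_gt0.
    by move: (L^-1) => z zn; field.
  set J := cosine_approx _ _ _ _.
  rewrite !ler_norml => /andP[? ?] /andP[? ?] /andP[? ?].
  by apply/andP; split; lra.
- apply: (@le_trans _ _ (K * \sum_(p : 'I_n.+1 * 'I_n.+1 | (0 < maxn p.1 p.2)%N)
    ((maxn p.1 p.2)%:R ^+ 3)^-1)); last first.
    by rewrite ler_wpM2l// sum_inverse_cubes.
  rewrite mulr_sumr; apply: ler_sum => -[k l] /= kl.
  have M0 : 0 < (maxn k l)%:R :> R by rewrite ltr0n.
  have q0 : 0 < (maxn k l)%:R ^+ 2 * om ^+ 2 :> R by rewrite mulr_gt0 ?exprn_gt0.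
  have q1 : (maxn k l)%:R ^+ 2 * om ^+ 2 <= (k%:R * om) ^+ 2 + (l%:R * om) ^+ 2.
    rewrite !(exprMn _ _ om); have /orP[lk|lk] := leq_total l k.
      by rewrite (maxn_idPl lk) lerDl; apply: mulr_ge0; exact: sqr_ge0.
    by rewrite (maxn_idPr lk) lerDr; apply: mulr_ge0; exact: sqr_ge0.
  apply: (@le_trans _ _ (`|ga k l| / ((maxn k l)%:R ^+ 2 * om ^+ 2))).
    by rewrite ler_wpM2l// lef_pV2 ?posrE// (lt_le_trans q0).
  rewrite ler_pdivrMr//; apply: le_trans (ga_bound _ _ _ _ kl) _ => //.
  rewrite /K le_eqVlt; apply/orP; left; apply/eqP.
  by move: (om) om_gt0 => w w0; field; rewrite !gt_eqF.
Qed.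

End separable_approximation.

(** * Neumann modes of the cross-section *)

Section lines.
Context {R : realType} {V : normedModType R} (A : set V).
Implicit Types (u p : V -> R) (v x : V).

Lemma is_rel_derive_invariant v u x : (forall h, u (h *: v + x) = u x) ->
  is_rel_derive A v u x 0.
Proof.
move=> uh; apply: (is_rel_derive_quotient _ _ _ _ _ (fun=> 0)).
  exact: cvg_cst.
by move=> h; rewrite uh subrr mulr0.
Qed.

Lemma rel_lipschitz v u p x (h K : R) :
  (forall s : R, Num.min 0 h <= s <= Num.max 0 h -> A (s *: v + x)) ->
  (forall y, A y -> is_rel_derive A v u y (p y)) ->
  (forall y, A y -> `|p y| <= K) -> `|u (h *: v + x) - u x| <= K * `|h|.
Proof.
wlog h0 : v h p / 0 <= h => [H|] Ah up pK.
  have [h0|h0] := leP 0 h; first exact: (H v h p).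
  have := H (- v) (- h) (fun y => - p y).
  rewrite scalerN scaleNr opprK normrN; apply.
  - by rewrite oppr_ge0 ltW.
  - have Nh : 0 <= - h by rewrite oppr_ge0 ltW.
    move=> s; rewrite (min_idPl Nh) (max_idPr Nh) => /andP[s0 sh].
    rewrite scalerN -scaleNr; apply: Ah.
    rewrite (min_idPr (ltW h0)) (max_idPl (ltW h0)).
    by apply/andP; split; lra.
  - by move=> y Ay; apply: is_rel_deriveN_dir; exact: up.
  - by move=> y Ay; rewrite normrN; exact: pK.
move: h0; rewrite le_eqVlt => /orP[/eqP <-|h0].
  by rewrite scale0r add0r subrr !normr0 mulr0.
have {}Ah s : 0 <= s <= h -> A (s *: v + x).
  by move=> sh; apply: Ah; rewrite (min_idPl (ltW h0)) (max_idPr (ltW h0)).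
pose phi s := u (s *: v + x).
have phid s : s \in `]0, h[%R -> is_derive s 1 phi (p (s *: v + x)).
  rewrite in_itv/= => /andP[s0 sh].
  apply: (is_rel_derive_line A v u x _ 0 h) => //; first by rewrite s0.
  by apply: up; apply: Ah; rewrite (ltW s0) ltW.
have Ah' s : 0 <= s <= h -> A (s *: - v + (h *: v + x)).
  move=> /andP[s0 sh]; rewrite scalerN -scaleNr addrA -scalerDl; apply: Ah.
  by apply/andP; split; lra.
have Ax : A x by have := Ah 0; rewrite scale0r add0r lexx ltW//; exact.
have Axh : A (h *: v + x) by apply: Ah; rewrite lexx ltW.
have cphi : {within `[0, h], continuous phi}.
  apply/continuous_within_itvP => //; split.
  - by move=> s /phid; exact: derivative_continuous.
  - rewrite /phi scale0r add0r.
    exact: rel_continuous_at_right h0 Ah (up _ Ax).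
  - have := rel_continuous_at_right _ _ _ _ _ _ h0 Ah'
      (is_rel_deriveN_dir _ _ _ _ _ (up _ Axh)).
    move=> c; apply/cvgrPdist_lt => e e0.
    move/cvgrPdist_lt : c => /(_ e e0) [r /= r0 H].
    exists r => //= s sr sh; have := H (h - s).
    rewrite /= sub0r normrN subr_gt0 => /(_ sr sh); rewrite /phi.
    by rewrite scalerN -scaleNr addrA -scalerDl opprB subrK.
have [c] := MVT h0 phid cphi.
rewrite in_itv/= => /andP[c0 ch]; rewrite /phi scale0r add0r subr0 => ->.
rewrite normrM ler_wpM2r//; apply: pK; apply: Ah.
by rewrite (ltW c0) ltW.
Qed.

End lines.

Section modes.
Context {R : realType} (L : R) (m : nat).
Implicit Types (k : 'I_m -> nat) (y : 'rV[R]_m) (i j : 'I_m).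

(** The Neumann eigenfunctions of the cube are products of cosines. *)
Definition mode k y : R := \prod_j cos ((k j)%:R * (pi / L * y ord0 j)).

Definition eigenvalue k : R := \sum_j ((k j)%:R * (pi / L)) ^+ 2.

Definition mode1 k i y : R := - ((k i)%:R * (pi / L)) *
  sin ((k i)%:R * (pi / L * y ord0 i)) *
  \prod_(j | j != i) cos ((k j)%:R * (pi / L * y ord0 j)).

Definition mode2 k i y : R := - ((k i)%:R * (pi / L)) ^+ 2 * mode k y.

Lemma mode_le1 k y : `|mode k y| <= 1.
Proof.
rewrite /mode normr_prod; apply: prodr_ile1 => j _.
by rewrite normr_ge0 cos_max.
Qed.

Lemma sum_mode2 k y : \sum_i mode2 k i y = - eigenvalue k * mode k y.
Proof.
rewrite /eigenvalue -sumrN mulr_suml; apply: eq_bigr => i _.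
by rewrite /mode2 mulNr.
Qed.

Let cofactor_invariant k i y (h : R) :
  \prod_(j | j != i) cos ((k j)%:R * (pi / L * (h *: unit_vec i + y) ord0 j)) =
  \prod_(j | j != i) cos ((k j)%:R * (pi / L * y ord0 j)).
Proof.
by apply: eq_bigr => j ji; rewrite coord_line (negPf ji) add0r.
Qed.

Lemma is_rel_derive_coord (A : set 'rV[R]_m) i y :
  is_rel_derive A (unit_vec i) (fun z : 'rV[R]_m => z ord0 i) y 1.
Proof.
apply/cvgrPdist_lt => e e0; apply: (near_increments _ _ _ _ _ ltr01) => h h0 _ _.
by rewrite coord_line eqxx addrK mulVf// subrr normr0.
Qed.

Lemma is_rel_derive_mode A k i y :
  is_rel_derive A (unit_vec i) (mode k) y (mode1 k i y).
Proof.
pose q (z : 'rV[R]_m) := \prod_(j | j != i) cos ((k j)%:R * (pi / L * z ord0 j)).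
pose f (t : R) := cos ((k i)%:R * (pi / L * t)).
have fd (t : R) : is_derive t 1 f
    (- ((k i)%:R * (pi / L)) * sin ((k i)%:R * (pi / L * t))).
  by rewrite /f; apply: is_derive_eq; rewrite /GRing.scale /=; ring.
have -> : mode k = fun z => f (z ord0 i) * q z.
  by apply/funext => z; rewrite /mode (bigD1 i).
apply: is_rel_derive_eq (is_rel_deriveM _ _ _ _ _ _ _
  (is_rel_derive_comp _ _ _ _ _ _ _ (fd (y ord0 i)) (is_rel_derive_coord A i y))
  (is_rel_derive_invariant _ _ q y (cofactor_invariant k i y))) _.
by rewrite mulr0 addr0 mulr1.
Qed.

Lemma is_rel_derive_mode1 A k i y :
  is_rel_derive A (unit_vec i) (mode1 k i) y (mode2 k i y).
Proof.
pose q (z : 'rV[R]_m) := \prod_(j | j != i) cos ((k j)%:R * (pi / L * z ord0 j)).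
pose w := (k i)%:R * (pi / L).
pose f (t : R) := - w * sin ((k i)%:R * (pi / L * t)).
have fd (t : R) : is_derive t 1 f
    (- w ^+ 2 * cos ((k i)%:R * (pi / L * t))).
  by rewrite /f /w; apply: is_derive_eq; rewrite /GRing.scale /=; ring.
apply: is_rel_derive_eq (is_rel_deriveM _ _ _ _ _ _ _
  (is_rel_derive_comp _ _ _ _ _ _ _ (fd (y ord0 i)) (is_rel_derive_coord A i y))
  (is_rel_derive_invariant _ _ q y (cofactor_invariant k i y))) _.
by rewrite mulr0 addr0 mulr1 /mode2 /mode (bigD1 i)//= /q /w; ring.
Qed.

Lemma mode1_neumann k i y : L != 0 -> y ord0 i = 0 \/ y ord0 i = L ->
  mode1 k i y = 0.
Proof.
move=> L0 yi; rewrite /mode1; have -> : sin ((k i)%:R * (pi / L * y ord0 i)) = 0.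
  case: yi => ->; first by rewrite !mulr0 sin0.
  by rewrite divfK// sin_nat_pi.
by rewrite mulr0 mul0r.
Qed.

Lemma continuous_mode k : continuous (mode k).
Proof.
have H (r : seq 'I_m) : continuous (fun z : 'rV[R]_m =>
    \prod_(j <- r) cos ((k j)%:R * (pi / L * z ord0 j))).
  elim: r => [|j r IH] y.
    rewrite (_ : (fun z => _) = cst 1); first exact: cst_continuous.
    by apply/funext => z; rewrite big_nil.
  rewrite (_ : (fun z => _) = fun z : 'rV[R]_m =>
      cos ((k j)%:R * (pi / L * z ord0 j)) *
      \prod_(i <- r) cos ((k i)%:R * (pi / L * z ord0 i))); last first.
    by apply/funext => z; rewrite big_cons.
  have cj : {for y, continuous (fun z : 'rV[R]_m =>
      cos ((k j)%:R * (pi / L * z ord0 j)))}.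
    apply: (@continuous_comp _ _ _ (fun z : 'rV[R]_m => z ord0 j)
      (fun t : R => cos ((k j)%:R * (pi / L * t)))).
      exact: coord_continuous.
    by apply: differentiable_continuous; apply/derivable1_diffP.
  exact: cvgM cj (IH y).
exact: H.
Qed.

Lemma eigenvalue_lower k : 0 < L -> (exists j, (0 < k j)%N) ->
  (pi / L) ^+ 2 <= eigenvalue k.
Proof.
move=> L0 [j kj]; rewrite /eigenvalue (bigD1 j)//=.
have kk : 1 <= (k j)%:R :> R by rewrite ler1n.
apply: (@le_trans _ _ (((k j)%:R * (pi / L)) ^+ 2)).
  have p0 : 0 <= pi / L by rewrite divr_ge0 ?pi_ge0// ltW.
  have pk : pi / L <= (k j)%:R * (pi / L) by rewrite ler_peMl.
  by rewrite !expr2; apply: ler_pM.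
by rewrite lerDl sumr_ge0// => i _; exact: sqr_ge0.
Qed.

End modes.

Section box_approximation.
Context {R : realType} (L : R).
Hypothesis L_gt0 : 0 < L.

Definition coordinate_lipschitz m (g : 'rV[R]_m -> R) (Lam : R) : Prop :=
  forall i y h, box L y -> box L (h *: unit_vec i + y) ->
    `|g (h *: unit_vec i + y) - g y| <= Lam * `|h|.

Definition box_mean m (g : 'rV[R]_m -> R) : R :=
  (box_volume L m)^-1 * box_integral L g.

(** The bound [C] is chosen before the accuracy [e]: it controls the size of
    the corrector, which must not grow when the approximation improves. *)
Definition mode_approximable m (g : 'rV[R]_m -> R) : Prop :=
  exists2 C : R, 0 <= C & forall e : R, 0 < e ->
  exists (I : finType) (P : pred I) (ga : I -> R) (k : I -> 'I_m -> nat),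
  [/\ forall i, P i -> exists j, (0 < k i j)%N,
      forall y, box L y -> `|g y - box_mean m g -
        \sum_(i | P i) ga i * mode L m (k i) y| <= e &
      \sum_(i | P i) `|ga i| / eigenvalue L m (k i) <= C].

Lemma row_mx_scalarE n (t : R) (A : 'rV[R]_n) (i : 'I_n.+1) :
  (row_mx t%:M A : 'rV[R]_n.+1) ord0 i = if unlift ord0 i is Some j then A ord0 j else t.
Proof.
rewrite mxE; case: (@splitP 1 n i) => j ij.
  have -> : i = ord0 by apply: val_inj => /=; rewrite ij; case: j {ij} => [[]].
  by rewrite unlift_none mxE (ord1 j) /= ?mulr1n.
by have -> : i = lift ord0 j; [exact: val_inj|rewrite liftK].
Qed.

Lemma mode_approximable1 (g : 'rV[R]_1 -> R) Lam :
  coordinate_lipschitz 1 g Lam -> mode_approximable 1 g.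
Proof.
move=> gL; pose pt (t : R) : 'rV[R]_1 := row_mx t%:M (0 : 'rV_0).
have I1 (i : 'I_1) : i = ord0 by apply: val_inj; case: i => [[]].
have ptE t i : pt t ord0 i = t.
  by rewrite row_mx_scalarE; case: (unlift ord0 i) => [[]|].
have pt_box t : 0 <= t <= L -> box L (pt t) by move=> tL i _; rewrite ptE.
have ptK (y : 'rV[R]_1) : pt (y ord0 ord0) = y.
  by apply/rowP => i; rewrite ptE (I1 i).
have FL : lipschitz_on L (fun t => g (pt t)) Lam.
  move=> x y xL yL; have E : pt x = (x - y) *: unit_vec ord0 + pt y.
    by apply/rowP => i; rewrite coord_line !ptE (I1 i) eqxx subrK.
  rewrite E; apply: gL; first exact: pt_box.
  by rewrite -E; exact: pt_box.
have [C C0 H] := one_variable_approximation L L_gt0 _ _ FL.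
exists C => // e e0; have [n [ga [H1 H2]]] := H e e0.
exists 'I_n.+1, (fun k : 'I_n.+1 => (0 < k)%N), (fun k : 'I_n.+1 => ga k),
  (fun (k : 'I_n.+1) _ => k : nat); split.
- by move=> k k0; exists ord0.
- move=> y yL; have := H1 (y ord0 ord0) (yL ord0 isT).
  rewrite ptK /box_mean /box_volume expr1 /=.
  congr (`|_ - _| <= _); apply: eq_bigr => k _.
  by rewrite /mode big_ord1.
- apply: le_trans H2; rewrite le_eqVlt; apply/orP; left; apply/eqP.
  by apply: eq_bigr => k _; rewrite /eigenvalue big_ord1.
Qed.

Lemma mode_approximable2 (g : 'rV[R]_2 -> R) Lam :
  coordinate_lipschitz 2 g Lam -> mode_approximable 2 g.
Proof.
move=> gL.
pose pt (s t : R) : 'rV[R]_2 := row_mx s%:M (row_mx t%:M (0 : 'rV_0)).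
have pt0 s t : pt s t ord0 ord0 = s.
  by rewrite row_mx_scalarE unlift_none.
have pt1 s t : pt s t ord0 ord_max = t.
  rewrite row_mx_scalarE (_ : ord_max = lift ord0 (ord0 : 'I_1)); last exact: val_inj.
  by rewrite liftK row_mx_scalarE unlift_none.
have I2 (i : 'I_2) : i = ord0 \/ i = ord_max.
  by case: i => [[|[|i]] Hi] //; [left|right]; exact: val_inj.
have pt_box s t : 0 <= s <= L -> 0 <= t <= L -> box L (pt s t).
  by move=> sL tL i _; case: (I2 i) => ->; rewrite ?pt0 ?pt1.
have ptK (y : 'rV[R]_2) : pt (y ord0 ord0) (y ord0 ord_max) = y.
  by apply/rowP => i; case: (I2 i) => ->; rewrite ?pt0 ?pt1.
have GL1 x : 0 <= x <= L -> lipschitz_on L (fun t => g (pt x t)) Lam.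
  move=> xL t t' tL tL'.
  have E : pt x t = (t - t') *: unit_vec ord_max + pt x t'.
    apply/rowP => i; rewrite coord_line.
    by case: (I2 i) => ->; rewrite ?pt0 ?pt1 ?eqxx ?subrK// add0r.
  rewrite E; apply: gL; first exact: pt_box.
  by rewrite -E; exact: pt_box.
have GL2 t : 0 <= t <= L -> lipschitz_on L (fun x => g (pt x t)) Lam.
  move=> tL x x' xL xL'.
  have E : pt x t = (x - x') *: unit_vec ord0 + pt x' t.
    apply/rowP => i; rewrite coord_line.
    by case: (I2 i) => ->; rewrite ?pt0 ?pt1 ?eqxx ?subrK// add0r.
  rewrite E; apply: gL; first exact: pt_box.
  by rewrite -E; exact: pt_box.
have [C C0 H] := two_variable_approximation L L_gt0 (fun x t => g (pt x t)) Lam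
  GL1 GL2.
exists C => // e e0; have [n [ga [H1 H2]]] := H e e0.
exists ('I_n.+1 * 'I_n.+1)%type, (fun p : 'I_n.+1 * 'I_n.+1 => (0 < maxn p.1 p.2)%N),
  (fun p : 'I_n.+1 * 'I_n.+1 => ga p.1 p.2),
  (fun (p : 'I_n.+1 * 'I_n.+1) i => if i == ord0 then p.1 : nat else p.2 : nat); split.
- move=> [k l] /=; rewrite leq_max => /orP[k0|l0]; first by exists ord0.
  by exists ord_max.
- move=> y yL; have := H1 (y ord0 ord0) (y ord0 ord_max) (yL ord0 isT) (yL ord_max isT).
  rewrite ptK /box_mean /box_volume /=.
  congr (`|_ - _| <= _); apply: eq_bigr => p _.
  by rewrite /mode big_ord_recl big_ord1 /= (_ : lift ord0 ord0 = ord_max)//;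
    exact: val_inj.
- apply: le_trans H2; rewrite le_eqVlt; apply/orP; left; apply/eqP.
  by apply: eq_bigr => p _; rewrite /eigenvalue big_ord_recl big_ord1.
Qed.

End box_approximation.

(** * The cell problem and the equation of the front *)

Section cell_problem_facts.
Context {R : realType} (L : R) (m : nat).
Hypothesis L_gt0 : 0 < L.
Implicit Types (y : 'rV[R]_m) (u chi b : 'rV[R]_m -> R).
Local Notation Omega := (@box R L m).

Lemma compact_box : compact Omega.
Proof.
have -> : Omega = [set x : 'rV[R]_m | forall i, (`[0, L]%classic : set R) (x ord0 i)].
  apply/seteqP; split => x /=; first by move=> xL i; rewrite /= in_itv/= xL.
  by move=> xL i _; have := xL i; rewrite /= in_itv.
by apply: (@rV_compact R m (fun=> `[0, L]%classic)) => i; exact: segment_compact.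
Qed.

Lemma box_bounded u : {within Omega, continuous u} ->
  exists K, forall y, Omega y -> `|u y| <= K.
Proof.
move=> cu; have /compact_bounded [M [_ HM]] := continuous_compact cu compact_box.
exists (M + 1) => y yL; apply: (HM (M + 1)); first by lra.
by exists y.
Qed.

Lemma box_bounded_family (I : finType) (u : I -> 'rV[R]_m -> R) :
  (forall i, {within Omega, continuous (u i)}) ->
  exists2 K : R, 0 <= K & forall i y, Omega y -> `|u i y| <= K.
Proof.
move=> cu; have [K HK] := choice (fun i => box_bounded _ (cu i)).
exists (\sum_i `|K i|); first by rewrite sumr_ge0.
move=> i y yL; apply: le_trans (HK i y yL) _; apply: le_trans (ler_norm _) _.
by rewrite (bigD1 i)//= lerDl sumr_ge0.
Qed.

(** The Lipschitz bound for |grad chi|^2 is what makes its cosine coefficients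
    decay. *)
Set Implicit Arguments.
Record cell_data b chi (chi1 chi2 : 'I_m -> 'rV[R]_m -> R) (X : R) : Prop :=
  CellData {
  cell_cont : {within Omega, continuous chi};
  cell_derive : forall i y, Omega y ->
    is_rel_derive Omega (unit_vec i) chi y (chi1 i y);
  cell_derive2 : forall i y, Omega y ->
    is_rel_derive Omega (unit_vec i) (chi1 i) y (chi2 i y);
  cell_neumann : forall i y, Omega y -> y ord0 i = 0 \/ y ord0 i = L ->
    chi1 i y = 0;
  cell_eq : forall y, Omega y -> \sum_i chi2 i y = - b y;
  cell_ge0 : 0 <= X;
  cell_bound : forall y, Omega y -> `|chi y| <= X;
  cell_source : forall y, Omega y -> `|b y| <= X;
  cell_energy : forall y, Omega y -> `|\sum_i chi1 i y ^+ 2| <= X;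
  cell_lipschitz : coordinate_lipschitz L m (fun y => \sum_i chi1 i y ^+ 2) X }.
Unset Implicit Arguments.

Lemma cell_problem_data b chi : cell_problem L b chi ->
  exists (chi2 : 'I_m -> 'rV[R]_m -> R) (X : R),
    cell_data b chi (fun i => partial Omega i chi) chi2 X.
Proof.
move=> [[cchi H1] chieq chiN _].
have unitv i : unit_vecs (@unit_vec R m i) by exists i.
have chi1_derive i y : Omega y ->
    is_rel_derive Omega (unit_vec i) chi y (partial Omega i chi y).
  by move=> yL; have [H _] := H1 _ (unitv i); exact: H.
have cchi1 i : {within Omega, continuous (partial Omega i chi)}.
  by have [_ []] := H1 _ (unitv i).
pose chi12 i j := partial Omega j (partial Omega i chi).
have chi12_derive i j y : Omega y ->
    is_rel_derive Omega (unit_vec j) (partial Omega i chi) y (chi12 i j y).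
  by move=> yL; have [_ [_ H]] := H1 _ (unitv i); have [H' _] := H _ (unitv j); exact: H'.
have cchi12 i j : {within Omega, continuous (chi12 i j)}.
  by have [_ [_ H]] := H1 _ (unitv i); have [_ []] := H _ (unitv j).
have [K0 HK0] := box_bounded _ cchi.
have [K1 K1_ge0 HK1] := box_bounded_family _ _ cchi1.
have [K2 K2_ge0 HK2] := box_bounded_family ('I_m * 'I_m)%type
  (fun p => chi12 p.1 p.2) (fun p => cchi12 p.1 p.2).
pose X := `|K0| + m%:R * K2 + m%:R * K1 ^+ 2 + m%:R * (2 * K1 * K2).
have mK2 : 0 <= m%:R * K2 by rewrite mulr_ge0.
have mK1 : 0 <= m%:R * K1 ^+ 2 by rewrite mulr_ge0 ?sqr_ge0.
have mK12 : 0 <= m%:R * (2 * K1 * K2) by rewrite mulr_ge0// !mulr_ge0.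
have K0n : 0 <= `|K0| by [].
have sum_le (F : 'I_m -> R) (K : R) : (forall i, `|F i| <= K) ->
    `|\sum_i F i| <= m%:R * K.
  move=> FK; apply: le_trans (ler_norm_sum _ _ _) _.
  apply: (@le_trans _ _ (\sum_(i < m) K)); first exact: ler_sum.
  by rewrite sumr_const card_ord mulr_natl.
have lap y : Omega y -> \sum_i chi12 i i y = - b y.
  by move=> yL; rewrite -(chieq _ yL) opprK.
exists (fun i => chi12 i i), X; split => //.
- by move=> i y yL; exact: chi12_derive.
- by move=> i y yL yi; exact: chiN.
- by rewrite /X; lra.
- move=> y yL; apply: le_trans (HK0 y yL) _; have := ler_norm K0.
  by rewrite /X; lra.
- move=> y yL; rewrite -normrN -lap//.
  apply: le_trans (sum_le _ K2 _) _; last by rewrite /X; lra.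
  by move=> i; exact: (HK2 (i, i)).
- move=> y yL; apply: le_trans (sum_le _ (K1 ^+ 2) _) _; last by rewrite /X; lra.
  by move=> i; rewrite normrX lerXn2r ?nnegrE//; exact: HK1.
- move=> i y h yL hyL.
  apply: (rel_lipschitz Omega (unit_vec i) (fun z => \sum_j partial Omega j chi z ^+ 2)
    (fun z => \sum_j (chi12 j i z * partial Omega j chi z +
       partial Omega j chi z * chi12 j i z)) y h X).
  + move=> s /andP[s1 s2] j jm; rewrite coord_line.
    have /andP[a1 a2] := yL j jm; have := hyL j jm; rewrite coord_line.
    case: ifP => _; last by rewrite add0r a1.
    move=> /andP[a3 a4]; move: s1 s2.
    by have [h0|h0] := leP 0 h => s1 s2; apply/andP; split; lra.
  + move=> z zL; rewrite (_ : (fun w => \sum_j partial Omega j chi w ^+ 2) =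
      fun w => \sum_j partial Omega j chi w * partial Omega j chi w).
      apply: is_rel_derive_sum => j _.
      by apply: is_rel_deriveM; exact: chi12_derive.
    by apply/funext => w; apply: eq_bigr => j _; rewrite expr2.
  + move=> z zL; apply: le_trans (sum_le _ (2 * K1 * K2) _) _; last by rewrite /X; lra.
    move=> j; have a1 := HK1 j z zL; have a2 := HK2 (j, i) z zL.
    have : `|partial Omega j chi z| * `|chi12 j i z| <= K1 * K2 by exact: ler_pM.
    by move=> H; apply: le_trans (ler_normD _ _) _; rewrite !normrM; lra.
Qed.

End cell_problem_facts.

Section front_equation.
Context {R : realType} (L : R) (m : nat).
Hypothesis L_gt0 : 0 < L.
Local Notation D := (@cylinder R L m).
Local Notation e0 := (@unit_vec R m.+1 ord0).

Lemma coord_le_norm k (x : 'rV[R]_k) j : `|x ord0 j| <= `|x|.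
Proof.
rewrite {2}/Num.Def.normr /= mx_normrE.
exact: (le_bigmax _ (fun ij : 'I_1 * 'I_k => `|x ij.1 ij.2|) (ord0, j)).
Qed.

Lemma cross_section_norm (x y : 'rV[R]_m.+1) :
  `|cross_section x - cross_section y| <= `|x - y|.
Proof.
have [->|zn0] := eqVneq (cross_section x - cross_section y) 0.
  by rewrite normr0.
have /mx_norm_neq0[[i j] E] : mx_norm (cross_section x - cross_section y) != 0.
  by apply: contra zn0 => /eqP/mx_norm_eq0 ->.
rewrite {1}/Num.Def.normr /= E /= (_ : i = ord0); last first.
  by apply: val_inj; case: i {E} => [[]].
have := coord_le_norm _ (x - y) (lift ord0 j).
by rewrite !mxE.
Qed.

(** A front solves the travelling wave equation: along the moving frame the
    time derivative is the derivative in the direction of propagation. *)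
Lemma shear_front_equation f (b : 'rV[R]_m -> R) (delta c : R) Phi :
  shear_front L f delta b c Phi ->
  exists Phi1 Phi2, [/\ smooth_neumann L m Phi Phi1 Phi2, front_limits L m Phi &
    forall x, D x ->
      wave_operator m f (fun y => delta * b y - c) Phi Phi1 Phi2 x = 0].
Proof.
move=> [[CPhi Phit PhiN] Phi01 PhiNy Phiy].
pose u t := fun x : 'rV[R]_m.+1 => Phi (x + (c * t) *: e0).
have u0 : u 0 = Phi by apply/funext => x; rewrite /u mulr0 scale0r addr0.
have CP := CPhi 0; have PN := PhiN 0; have Pt := Phit 0.
rewrite -/(u 0) u0 in CP PN Pt.
have [cPhi H1] := CP.
have unitv i : unit_vecs (@unit_vec R m.+1 i) by exists i.
have Phi1_derive i x : D x ->
    is_rel_derive D (unit_vec i) Phi x (partial D i Phi x).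
  by move=> Dx; have [H _] := H1 _ (unitv i); exact: H.
have Phi2_derive i x : D x -> is_rel_derive D (unit_vec i) (partial D i Phi) x
    (partial D i (partial D i Phi) x).
  by move=> Dx; have [_ [_ H]] := H1 _ (unitv i); have [H' _] := H _ (unitv i); exact: H'.
exists (fun i => partial D i Phi), (fun i => partial D i (partial D i Phi)); split.
- split => //.
- split => // e e_gt0; have [A [_ HA]] := PhiNy e e_gt0.
  have [B [_ HB]] := Phiy e e_gt0.
  exists (Num.max (- A) B + 1) => x Dx.
  have a1 : - A <= Num.max (- A) B by rewrite le_max lexx.
  have a2 : B <= Num.max (- A) B by rewrite le_max lexx orbT.
  split=> xX.
    have xA : x ord0 ord0 < A by lra.
    by have := HA _ xA x Dx erefl; rewrite ltr_norml => /andP[].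
  have xB : B < x ord0 ord0 by lra.
  by have := HB _ xB x Dx erefl; rewrite ltr_norml => /andP[]; lra.
- move=> x Dx; have [_ E] := Pt x Dx.
  have Phil : is_derive (0 : R) 1 (fun s : R => Phi (s *: e0 + x)) (partial D ord0 Phi x).
    apply: (@is_rel_derive_line _ _ D e0 Phi x _ (- 1) 1).
    - by apply/andP; split; lra.
    - by move=> s _; exact: cylinder_shift.
    - by rewrite scale0r add0r; exact: Phi1_derive.
  have ct : is_derive (0 : R) 1 (fun t : R => c * t) c.
    by apply: is_derive_eq; rewrite /GRing.scale /=; ring.
  have Phil' : is_derive (c * 0) 1 (fun s : R => Phi (s *: e0 + x))
    (partial D ord0 Phi x) by rewrite mulr0.
  have H := @is_derive1_comp R (fun s : R => Phi (s *: e0 + x)) (fun t => c * t) 0 _ _ Phil' ct.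
  have ut : derive1 (fun t => Phi (x + (c * t) *: e0)) 0 = c * partial D ord0 Phi x.
    have E1 : (fun s : R => Phi (s *: e0 + x)) \o (fun t => c * t) =
        fun t => Phi (x + (c * t) *: e0) by apply/funext => t /=; rewrite addrC.
    rewrite E1 in H; rewrite derive1E; have [_ ->] := H.
    by rewrite /GRing.scale /=; ring.
  rewrite ut /laplacian /= mulr0 scale0r addr0 in E; rewrite /wave_operator.
  by move: E; set S := \sum_i _; lra.
Qed.

(** Changing the speed of the moving frame adds a multiple of the slope to the
    wave operator.  If [|c - cs|] were larger than [r], this would give the wave
    operator of [v] a sign, and the front and [v] would violate the comparison
    principle. *)
Lemma speed_bound f b (delta c cs r : R) Phi v v1 v2 : stable_ends f ->
  shear_front L f delta b c Phi ->
  smooth_neumann L m v v1 v2 -> front_limits L m v ->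
  (forall x, D x -> 0 < v1 ord0 x) ->
  (forall x, D x -> `|wave_operator m f (fun y => delta * b y - cs) v v1 v2 x| <=
     r * v1 ord0 x) ->
  `|c - cs| <= r.
Proof.
move=> [eta eta0 [f0 f1]] /shear_front_equation[Phi1 [Phi2 [sPhi lPhi EPhi]]].
move=> sv lv v1_gt0 vr.
have Ec x : wave_operator m f (fun y => delta * b y - c) v v1 v2 x =
    wave_operator m f (fun y => delta * b y - cs) v v1 v2 x + (cs - c) * v1 ord0 x.
  by rewrite /wave_operator; ring.
rewrite ler_norml; apply/andP; split; rewrite leNgt; apply/negP => cr.
- apply: (sliding L m f (fun y => delta * b y - c) eta Phi _ _ v _ _ L_gt0 eta0
    f0 f1 sPhi sv lPhi lv) => x y Dx Dy _.
  rewrite EPhi// Ec; have := lerNnormlW (vr y Dy).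
  have : 0 < (cs - c - r) * v1 ord0 y by rewrite mulr_gt0 ?v1_gt0//; lra.
  by lra.
- apply: (sliding L m f (fun y => delta * b y - c) eta v _ _ Phi _ _ L_gt0 eta0
    f0 f1 sv sPhi lv lPhi) => x y Dx Dy _.
  rewrite EPhi// Ec; have := ler_normlW (vr x Dx).
  have : 0 < (c - cs - r) * v1 ord0 x by rewrite mulr_gt0 ?v1_gt0//; lra.
  by lra.
Qed.

End front_equation.

(** * The corrected test function *)

Section corrector_modes.
Context {R : realType}.
Implicit Types (s : R).

(** The corrector for a single mode.  Its leading part is V'' / lam; by the
    profile equation differentiated twice, what V'' / lam leaves over is again
    of order V' / lam, so that the remainder and, in spite of the large
    coefficient lam, its derivative are of this order as well. *)
Lemma mode_corrector f (f1 f2 : R -> R) (K Q om cb ab : R) :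
  regular_reaction f f1 f2 K -> 0 < om -> exists2 Cw : R, 0 <= Cw &
  forall a cs V V1 V2 V3 V4 lam,
  front_profile f f1 f2 a cs Q V V1 V2 V3 V4 ->
  1 <= a -> `|cs| <= cb -> a - 1 <= ab -> om <= lam -> (a - 1) * Q <= lam / 2 ->
  exists W W1 W2 : R -> R, [/\ forall s, is_derive s 1 W (W1 s),
    forall s, is_derive s 1 W1 (W2 s),
    forall s, W2 s - cs * W1 s + (f1 (V s) - lam) * W s = - V2 s,
    forall s, `|W s| <= Cw / lam * V1 s &
    forall s, `|W1 s| <= Cw / lam * V1 s].
Proof.
move=> freg om0.
pose A0 := (`|ab| + K) * `|Q|.
pose kap := `|cb| + 2 * `|Q| + `|K| + 1.
exists (`|Q| + 2 * `|A0| / om + (8 + (6 * kap + 4 * `|K|) / om) * `|A0|).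
  have h1 : 0 <= 2 * `|A0| / om by rewrite divr_ge0 ?mulr_ge0// ltW.
  have k0 : 0 <= kap by rewrite /kap !addr_ge0 ?mulr_ge0.
  have h2 : 0 <= (6 * kap + 4 * `|K|) / om.
    by rewrite divr_ge0 ?addr_ge0 ?mulr_ge0// ltW.
  have h3 : 0 <= (8 + (6 * kap + 4 * `|K|) / om) * `|A0|.
    by rewrite mulr_ge0// addr_ge0.
  by have := normr_ge0 Q; lra.
move=> a cs V V1 V2 V3 V4 lam Vf a1 cscb aab omlam alam.
have [VV1 V1V2 V2V3 V3V4 E0 E1 E2 V0 V1_ V1_gt0 V1Q V2Q V3Q V4Q _ _ _] := Vf.
have [fd f1d fK f2K f2c] := freg.
have V01 s : 0 < V s < 1 by rewrite V0 V1_.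
have Q0 : 0 < Q by apply: lt_le_trans (V1Q 0).
have K0 : 0 <= K := le_trans (normr_ge0 _) (fK _ (V01 0)).
have lam0 : 0 < lam by exact: lt_le_trans omlam.
have ab0 : 0 <= ab by lra.
have cb0 : 0 <= cb := le_trans (normr_ge0 _) cscb.
have A0_ge0 : 0 <= A0 by rewrite /A0 mulr_ge0// addr_ge0.
have kapE : kap = cb + 2 * Q + K + 1.
  by rewrite /kap (ger0_norm cb0) (gtr0_norm Q0) (ger0_norm K0).
have A0E : A0 = (ab + K) * Q by rewrite /A0 (ger0_norm ab0) (gtr0_norm Q0).
rewrite (gtr0_norm Q0) (ger0_norm A0_ge0) (ger0_norm K0).
pose G s := V4 s - cs * V3 s + f1 (V s) * V2 s.
have GE s : G s = - ((a - 1) * V4 s + f2 (V s) * V1 s ^+ 2).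
  by have := E2 s; rewrite /G; lra.
have Gle s : `|G s| <= A0 * V1 s.
  rewrite GE normrN A0E; apply: le_trans (ler_normD _ _) _.
  rewrite (_ : (ab + K) * Q * V1 s = ab * (Q * V1 s) + K * (Q * V1 s)); last by ring.
  rewrite !normrM; apply: lerD.
    by rewrite (ger0_norm (_ : 0 <= a - 1)) ?subr_ge0//; apply: ler_pM; rewrite ?subr_ge0.
  apply: ler_pM => //; first exact: f2K.
  by rewrite !(gtr0_norm (V1_gt0 s)) ler_pM2r.
have a0 : a != 0 by rewrite gt_eqF//; lra.
have cV s : {for s, continuous V} := derivative_continuous _ _ _ (VV1 s).
have cV1 s : {for s, continuous V1} := derivative_continuous _ _ _ (V1V2 s).
have cV2 s : {for s, continuous V2} := derivative_continuous _ _ _ (V2V3 s).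
have cV3 s : {for s, continuous V3} := derivative_continuous _ _ _ (V3V4 s).
have cf1 s : {for s, continuous (fun s => f1 (V s))}.
  apply: (@continuous_comp _ _ _ V f1); first exact: cV.
  exact: derivative_continuous (f1d _ (V01 s)).
have cf2 s : {for s, continuous (fun s => f2 (V s))}.
  by apply: (@continuous_comp _ _ _ V f2); [exact: cV|exact: f2c].
have cG : continuous G.
  have -> : G = fun s => - ((a - 1) * (a^-1 * (cs * V3 s - f1 (V s) * V2 s -
      f2 (V s) * (V1 s * V1 s))) + f2 (V s) * (V1 s * V1 s)).
    apply/funext => s; rewrite GE expr2; congr (- (_ * _ + _)).
    by have := E2 s; rewrite expr2 => E; apply: (mulfI a0); rewrite mulVKf//; lra.
  have cq s : {for s, continuous (fun s => f2 (V s) * (V1 s * V1 s))}.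
    by apply: cvgM; [exact: cf2|apply: cvgM; exact: cV1].
  move=> s; apply: cvgN; apply: cvgD; last exact: cq.
  apply: cvgM; first exact: cvg_cst.
  apply: cvgM; first exact: cvg_cst.
  apply: cvgB; last exact: cq.
  apply: cvgB; first by apply: cvgM; [exact: cvg_cst|exact: cV3].
  by apply: cvgM; [exact: cf1|exact: cV2].
pose F s := - lam^-1 * G s.
have cF : continuous F by move=> s; apply: cvgM; [exact: cvg_cst|exact: cG].
have Fle s : `|F s| <= A0 / lam * V1 s.
  rewrite /F normrM normrN normfV (gtr0_norm lam0) mulrC mulrAC.
  by rewrite ler_pM2r ?invr_gt0.
have super s : V3 s - cs * V2 s + (f1 (V s) - lam) * V1 s <= - (lam / 2) * V1 s.
  have : - ((a - 1) * V3 s) <= lam / 2 * V1 s.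
    apply: le_trans (_ : `|- ((a - 1) * V3 s)| <= _); first exact: ler_norm.
    rewrite normrN normrM (ger0_norm (_ : 0 <= a - 1)) ?subr_ge0//.
    apply: (@le_trans _ _ ((a - 1) * (Q * V1 s))).
      by rewrite ler_wpM2l ?subr_ge0.
    by rewrite mulrA ler_pM2r.
  by have := E1 s; lra.
have A1 : 0 <= A0 / lam by rewrite divr_ge0// ltW.
have [w [w1 [w2 [wd w1d wE wle w1le]]]] := corrector_solution cs Q K lam (A0 / lam)
  Q V1 V2 V3 (fun s => f1 (V s)) F (ltW Q0) K0 lam0 A1 V1V2 V2V3 V1_gt0 V1Q V2Q
  super cf1 (fun s => fK _ (V01 s)) cF Fle.
have ilam : 0 < lam^-1 by rewrite invr_gt0.
have lam_om : lam^-1 <= om^-1 by rewrite lef_pV2.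
exists (fun s => lam^-1 * V2 s + w s), (fun s => lam^-1 * V3 s + w1 s),
  (fun s => lam^-1 * V4 s + w2 s); split.
- move=> s; have h1 := V2V3 s; have h2 := wd s.
  by apply: is_derive_eq; rewrite /GRing.scale /=; ring.
- move=> s; have h1 := V3V4 s; have h2 := w1d s.
  by apply: is_derive_eq; rewrite /GRing.scale /=; ring.
- move=> s; have := wE s; rewrite /F /G => E.
  have : lam * (lam^-1 * V2 s) = V2 s by rewrite mulVKf// gt_eqF.
  by lra.
- move=> s; apply: le_trans (ler_normD _ _) _.
  have p1 : `|lam^-1 * V2 s| <= Q / lam * V1 s.
    by rewrite normrM (gtr0_norm ilam) mulrAC mulrC ler_pM2r.
  have p2 : 2 * (A0 / lam) / lam <= 2 * A0 / om / lam.
    by rewrite ler_pM2r// mulrA ler_wpM2l// mulr_ge0.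
  have p3 : 2 * (A0 / lam) / lam * V1 s <= 2 * A0 / om / lam * V1 s.
    by rewrite ler_pM2r.
  have p4 : 0 <= (8 + (6 * kap + 4 * K) / om) * A0 / lam * V1 s.
    rewrite mulr_ge0 ?(ltW (V1_gt0 s))// divr_ge0 ?(ltW lam0)// mulr_ge0//.
    rewrite addr_ge0// divr_ge0 ?(ltW om0)// addr_ge0 ?mulr_ge0//.
    by rewrite kapE !addr_ge0 ?mulr_ge0// ltW.
  by have := wle s; lra.
- move=> s; apply: le_trans (ler_normD _ _) _.
  have p1 : `|lam^-1 * V3 s| <= Q / lam * V1 s.
    by rewrite normrM (gtr0_norm ilam) mulrAC mulrC ler_pM2r.
  have k1 : `|cs| + 2 * Q + K + 1 <= kap by rewrite kapE; lra.
  have p2 : (6 * (`|cs| + 2 * Q + K + 1) + 4 * K) / lam <= (6 * kap + 4 * K) / om.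
    apply: ler_pM => //; last by lra.
      by have := normr_ge0 cs; lra.
    exact: ltW.
  have p3 : (8 + (6 * (`|cs| + 2 * Q + K + 1) + 4 * K) / lam) * (A0 / lam) * V1 s <=
      (8 + (6 * kap + 4 * K) / om) * (A0 / lam) * V1 s.
    by rewrite ler_pM2r// ler_wpM2r// lerD2l.
  have p4 : 0 <= 2 * A0 / om / lam * V1 s.
    apply: mulr_ge0 (ltW (V1_gt0 s)); apply: divr_ge0 (ltW lam0).
    by apply: divr_ge0 (ltW om0); apply: mulr_ge0.
  by have := w1le s; lra.
Qed.

End corrector_modes.

Section cylinder_derivatives.
Context {R : realType} (L : R) (m : nat).
Implicit Types (x : 'rV[R]_m.+1) (u : 'rV[R]_m -> R).
Local Notation D := (@cylinder R L m).
Local Notation Omega := (@box R L m).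

Lemma cross_section_lift (h : R) (j : 'I_m) x :
  cross_section (h *: unit_vec (lift ord0 j) + x) =
  h *: unit_vec j + cross_section x.
Proof.
apply/rowP => i; rewrite mxE coord_line [RHS]coord_line mxE.
by rewrite (inj_eq (@lift_inj _ _)).
Qed.

Lemma is_rel_derive_cross u j x d :
  is_rel_derive Omega (unit_vec j) u (cross_section x) d ->
  is_rel_derive D (unit_vec (lift ord0 j)) (fun y => u (cross_section y)) x d.
Proof.
move=> ud; apply/cvgrPdist_lt => e e_gt0.
move/cvgrPdist_lt : ud => /(_ e e_gt0) /increments_near[r r0 H].
apply: (near_increments _ _ _ _ _ r0) => h hn0 hr Dh.
have := H h hn0 hr; rewrite !cross_section_lift; apply.
by rewrite -cross_section_lift; exact: cross_section_box.
Qed.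

Lemma continuous_cross u : {within Omega, continuous u} ->
  {within D, continuous (fun x => u (cross_section x))}.
Proof.
move=> /within_continuousP cu; apply/within_continuousP => x Dx e e_gt0.
have [r r0 H] := cu _ (cross_section_box _ _ _ Dx) e e_gt0; exists r => // y Dy xy.
apply: H; first exact: cross_section_box.
exact: le_lt_trans (cross_section_norm _ _ _) xy.
Qed.

End cylinder_derivatives.

Lemma distance_between {R : realType} (a b t : R) :
  Num.min a b <= t <= Num.max a b -> `|t - b| <= `|b - a|.
Proof.
have n1 := ler_norm (b - a); have n2 := ler_norm (a - b); rewrite distrC in n2.
by have [ab|ab] := leP a b => /andP[t1 t2]; rewrite ler_norml; apply/andP; split; lra.
Qed.

Section test_function.
Context {R : realType} (L : R) (m : nat).
Hypothesis L_gt0 : 0 < L.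
Implicit Types (x : 'rV[R]_m.+1).
Local Notation D := (@cylinder R L m).
Local Notation Omega := (@box R L m).

Variables (b chi : 'rV[R]_m -> R) (chi1 chi2 : 'I_m -> 'rV[R]_m -> R) (X : R).
Hypothesis chi_data : cell_data L b chi chi1 chi2 X.

Variables (f f1 f2 : R -> R) (K a cs Q : R) (V V1 V2 V3 V4 : R -> R).
Hypothesis reaction : regular_reaction f f1 f2 K.
Hypothesis profile : front_profile f f1 f2 a cs Q V V1 V2 V3 V4.

Variables (I : finType) (P : pred I) (ga : I -> R) (k : I -> 'I_m -> nat).
Variables (W W1 W2 : I -> R -> R) (w : I -> R) (S : R).
Hypothesis W_derive : forall i (s : R), P i -> is_derive s 1 (W i) (W1 i s).
Hypothesis W1_derive : forall i (s : R), P i -> is_derive s 1 (W1 i) (W2 i s).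
Hypothesis W_eq : forall i s, P i ->
  W2 i s - cs * W1 i s + (f1 (V s) - eigenvalue L m (k i)) * W i s = - V2 s.
Hypothesis W_bound : forall i s, P i -> `|W i s| <= w i * V1 s.
Hypothesis W1_bound : forall i s, P i -> `|W1 i s| <= w i * V1 s.
Hypothesis S_bound : \sum_(i | P i) `|ga i| * w i <= S.

Variables (delta m0 e : R).
Hypothesis delta_gt0 : 0 < delta.
Hypothesis diffusion : a = 1 + delta ^+ 2 * m0.

(** The front is bent by the shear: to first order in delta, its level sets
    are the graphs of - delta chi. *)
Definition phase x : R := x ord0 ord0 + delta * chi (cross_section x).

Definition phase1 (i : 'I_m.+1) x : R :=
  if unlift ord0 i is Some j then delta * chi1 j (cross_section x) else 1.

Definition phase2 (i : 'I_m.+1) x : R :=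
  if unlift ord0 i is Some j then delta * chi2 j (cross_section x) else 0.

Definition mode_sum (G : I -> R -> R) x : R :=
  \sum_(i | P i) ga i * (mode L m (k i) (cross_section x) * G i (x ord0 ord0)).

Definition corrector1 (i : 'I_m.+1) x : R :=
  if unlift ord0 i is Some j then
    \sum_(q | P q) ga q * (mode1 L m (k q) j (cross_section x) * W q (x ord0 ord0))
  else mode_sum W1 x.

Definition corrector2 (i : 'I_m.+1) x : R :=
  if unlift ord0 i is Some j then
    \sum_(q | P q) ga q * (mode2 L m (k q) j (cross_section x) * W q (x ord0 ord0))
  else mode_sum W2 x.

Definition test x : R := V (phase x) + delta ^+ 2 * mode_sum W x.

Definition test1 i x : R := V1 (phase x) * phase1 i x + delta ^+ 2 * corrector1 i x.

Definition test2 i x : R :=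
  V2 (phase x) * phase1 i x * phase1 i x + V1 (phase x) * phase2 i x +
  delta ^+ 2 * corrector2 i x.

Let axis_derive x : is_rel_derive D (unit_vec ord0) (fun y => y ord0 ord0) x 1.
Proof. exact: is_rel_derive_coord. Qed.

Let cross_axis (u : 'rV[R]_m -> R) x :
  is_rel_derive D (unit_vec ord0) (fun y => u (cross_section y)) x 0.
Proof. by apply: is_rel_derive_invariant => h; rewrite cross_section_shift. Qed.

Let axis_cross (G : R -> R) j x :
  is_rel_derive D (unit_vec (lift ord0 j)) (fun y => G (y ord0 ord0)) x 0.
Proof. by apply: is_rel_derive_invariant => h; rewrite coord_line /= add0r. Qed.

Lemma phase_derive i x : D x -> is_rel_derive D (unit_vec i) phase x (phase1 i x).
Proof.
move=> Dx; rewrite /phase1; case: unliftP => [j ->|->].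
  rewrite -[X in is_rel_derive _ _ _ _ X]add0r; apply: is_rel_deriveD.
    exact: (axis_cross id).
  apply: is_rel_deriveZ; apply: is_rel_derive_cross.
  by apply: (cell_derive chi_data); exact: cross_section_box.
rewrite -[X in is_rel_derive _ _ _ _ X]addr0; apply: is_rel_deriveD => //.
exact: (cross_axis (fun y => delta * chi y)).
Qed.

Lemma phase1_derive i x : D x ->
  is_rel_derive D (unit_vec i) (phase1 i) x (phase2 i x).
Proof.
move=> Dx; rewrite /phase1 /phase2; case: unliftP => [j ->|->].
  apply: is_rel_deriveZ; apply: is_rel_derive_cross.
  by apply: (cell_derive2 chi_data); exact: cross_section_box.
exact: is_rel_derive_cst.
Qed.

Let mode_sum_axis G G1 x : (forall i s, P i -> is_derive (s : R) 1 (G i) (G1 i s)) ->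
  is_rel_derive D (unit_vec ord0) (mode_sum G) x (mode_sum G1 x).
Proof.
move=> GG1; apply: is_rel_derive_sum => i Pi; apply: is_rel_deriveZ.
apply: is_rel_derive_eq (is_rel_deriveM _ _ _ _ _ _ _ (cross_axis (mode L m (k i)) x)
  (is_rel_derive_comp _ _ _ _ _ _ _ (GG1 i (x ord0 ord0) Pi) (axis_derive x))) _.
by rewrite mul0r add0r mulr1.
Qed.

Lemma corrector_derive i x : is_rel_derive D (unit_vec i) (mode_sum W) x (corrector1 i x).
Proof.
rewrite /corrector1; case: unliftP => [j ->|->]; last exact: mode_sum_axis.
apply: is_rel_derive_sum => q Pq; apply: is_rel_deriveZ.
apply: is_rel_derive_eq (is_rel_deriveM _ _ _ _ _ _ _
  (is_rel_derive_cross L m (mode L m (k q)) j x _ (is_rel_derive_mode _ _ _ _ _ _))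
  (axis_cross (W q) j x)) _.
by rewrite mulr0 addr0.
Qed.

Lemma corrector1_derive i x :
  is_rel_derive D (unit_vec i) (corrector1 i) x (corrector2 i x).
Proof.
rewrite /corrector1 /corrector2; case: unliftP => [j ->|->]; last exact: mode_sum_axis.
apply: is_rel_derive_sum => q Pq; apply: is_rel_deriveZ.
apply: is_rel_derive_eq (is_rel_deriveM _ _ _ _ _ _ _
  (is_rel_derive_cross L m (mode1 L m (k q) j) j x _ (is_rel_derive_mode1 _ _ _ _ _ _))
  (axis_cross (W q) j x)) _.
by rewrite mulr0 addr0.
Qed.

Let continuous_axis (G : R -> R) : continuous G ->
  {within D, continuous (fun x => G (x ord0 ord0))}.
Proof.
move=> cG; apply: continuous_subspaceT => x.
apply: (@continuous_comp _ _ _ (fun y : 'rV[R]_m.+1 => y ord0 ord0) G).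
  exact: coord_continuous.
exact: cG.
Qed.

Lemma continuous_phase : {within D, continuous phase}.
Proof.
move=> x; apply: cvgD; first by apply: (continuous_axis id) => y; exact: cvg_id.
apply: cvgM; first exact: cvg_cst.
exact: (continuous_cross _ _ _ (cell_cont chi_data)).
Qed.

Lemma continuous_mode_sum : {within D, continuous (mode_sum W)}.
Proof.
have H (r : seq I) : {within D, continuous (fun x => \sum_(i <- r | P i)
    ga i * (mode L m (k i) (cross_section x) * W i (x ord0 ord0)))}.
  elim: r => [|i r IH].
    rewrite (_ : (fun x => _) = cst 0); first by move=> x; exact: cvg_cst.
    by apply/funext => x; rewrite big_nil.
  have [Pi|/negPf Pi] := boolP (P i); last first.
    rewrite (_ : (fun x => _) = fun x => \sum_(i <- r | P i)
        ga i * (mode L m (k i) (cross_section x) * W i (x ord0 ord0)))//.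
    by apply/funext => x; rewrite big_cons Pi.
  rewrite (_ : (fun x => _) = fun x =>
      ga i * (mode L m (k i) (cross_section x) * W i (x ord0 ord0)) +
      \sum_(i <- r | P i)
        ga i * (mode L m (k i) (cross_section x) * W i (x ord0 ord0))); last first.
    by apply/funext => x; rewrite big_cons Pi.
  move=> x; apply: cvgD; last exact: IH.
  apply: cvgM; first exact: cvg_cst.
  apply: cvgM.
    by apply: continuous_cross; apply: continuous_subspaceT; exact: continuous_mode.
  by apply: continuous_axis => s; exact: derivative_continuous (W_derive i s Pi).
exact: H.
Qed.

Lemma test_smooth : smooth_neumann L m test test1 test2.
Proof.
split.
- move=> x; apply: cvgD; last first.
    by apply: cvgM; [exact: cvg_cst|exact: continuous_mode_sum].
  apply: continuous_comp; first exact: continuous_phase.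
  apply: (@derivative_continuous _ V).
  exact: (profile_derive profile).
- move=> i x Dx; apply: is_rel_deriveD; last first.
    by apply: is_rel_deriveZ; exact: corrector_derive.
  apply: (is_rel_derive_comp D _ V).
    exact: (profile_derive profile).
  exact: phase_derive.
- move=> i x Dx; apply: is_rel_deriveD; last first.
    by apply: is_rel_deriveZ; exact: corrector1_derive.
  have H : is_rel_derive D (unit_vec i) (fun y => V1 (phase y)) x
      (V2 (phase x) * phase1 i x).
    apply: (is_rel_derive_comp D _ V1).
      exact: (profile_derive1 profile).
    exact: phase_derive.
  exact: is_rel_deriveM H (phase1_derive _ _ Dx).
- move=> i x; rewrite /test1 /phase1 /corrector1; case: unliftP => [j ->|->]; last first.
    by rewrite eqxx.
  move=> _ Dx xj; have yj : cross_section x ord0 j = 0 \/ cross_section x ord0 j = L.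
    by rewrite mxE.
  rewrite (cell_neumann chi_data) ?mulr0 ?add0r//; last exact: cross_section_box.
  rewrite big1 ?mulr0// => q _; rewrite mode1_neumann ?mul0r ?mulr0//.
  by rewrite gt_eqF.
Qed.

Let g (y : 'rV[R]_m) : R := \sum_i chi1 i y ^+ 2.

(** The residual of the test function: the terms of order delta cancel by the
    cell problem, the mean of the terms of order delta^2 is absorbed in the
    diffusion coefficient [a] of the profile, and their oscillating part in
    the corrector. *)
Lemma test_residual x : D x ->
  wave_operator m f (fun y => delta * b y - cs) test test1 test2 x =
  delta ^+ 2 * (g (cross_section x) - m0) * (V2 (phase x) - V2 (x ord0 ord0)) +
  delta ^+ 2 * (g (cross_section x) - m0 -
    \sum_(i | P i) ga i * mode L m (k i) (cross_section x)) * V2 (x ord0 ord0) +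
  delta ^+ 3 * (b (cross_section x) * mode_sum W1 x) +
  (f (test x) - f (V (phase x)) - f1 (V (x ord0 ord0)) * (delta ^+ 2 * mode_sum W x)).
Proof.
move=> Dx; set y := cross_section x; set s := x ord0 ord0.
have yL : Omega y by exact: cross_section_box.
have E1 : \sum_i test2 i x = V2 (phase x) * (1 + delta ^+ 2 * g y) -
    V1 (phase x) * (delta * b y) + delta ^+ 2 * \sum_i corrector2 i x.
  rewrite /test2 big_split/= -mulr_sumr; congr (_ + _); rewrite big_split/=.
  congr (_ + _).
    rewrite big_ord_recl /phase1 unlift_none !mulr1 mulrDr mulr1; congr (_ + _).
    rewrite /g 2!mulr_sumr; apply: eq_bigr => j _; rewrite liftK -/y; ring.
  rewrite big_ord_recl /phase2 unlift_none mulr0 add0r -mulrN -mulrN.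
  rewrite -(cell_eq chi_data)// 2!mulr_sumr.
  by apply: eq_bigr => j _; rewrite liftK.
have E2 : \sum_i corrector2 i x =
    mode_sum (fun i s => W2 i s - eigenvalue L m (k i) * W i s) x.
  rewrite big_ord_recl {1}/corrector2 unlift_none.
  rewrite (eq_bigr (fun j => \sum_(q | P q) ga q * (mode2 L m (k q) j y * W q s))); last first.
    by move=> j _; rewrite /corrector2 liftK.
  rewrite exchange_big/= -big_split/=; apply: eq_bigr => q _.
  rewrite -mulr_sumr -mulr_suml sum_mode2 -/y -/s; ring.
have E3 : mode_sum (fun i s => W2 i s - eigenvalue L m (k i) * W i s) x =
    cs * mode_sum W1 x - f1 (V s) * mode_sum W x -
    (\sum_(i | P i) ga i * mode L m (k i) y) * V2 s.
  rewrite /mode_sum mulr_suml !mulr_sumr -!sumrB; apply: eq_bigr => i Pi.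
  rewrite -/y -/s; have := W_eq i s Pi => E.
  have -> : W2 i s - eigenvalue L m (k i) * W i s = cs * W1 i s - f1 (V s) * W i s - V2 s.
    by lra.
  ring.
have := profile_eq profile (phase x) => E4.
rewrite diffusion in E4.
rewrite /wave_operator E1 E2 E3 /test1 /phase1 /corrector1 unlift_none -/y.
rewrite -[LHS]subr0 -E4; ring.
Qed.

Variable H : R.
Hypothesis H_bound : expR (Q * (delta * X)) <= H.
Hypothesis approx_small : forall y, Omega y -> `|g y - m0 -
  \sum_(i | P i) ga i * mode L m (k i) y| <= e.
Hypothesis delta_small : delta ^+ 2 * (S * H) * (Q + 1) <= 2^-1.

Let V1_gt0 s : 0 < V1 s.
Proof. exact: (profile_incr profile). Qed.

Let V01 s : 0 < V s < 1.
Proof.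
by rewrite (profile_gt0 profile)
  (profile_lt1 profile).
Qed.

Let Q_gt0 : 0 < Q.
Proof.
exact: lt_le_trans (V1_gt0 0) (profile_bound1 profile 0).
Qed.

Let X_ge0 : 0 <= X.
Proof. exact: (cell_ge0 chi_data). Qed.

Let K_ge0 : 0 <= K.
Proof. exact: le_trans (normr_ge0 _) (reaction_bound reaction _ (V01 0)). Qed.

Let H_gt0 : 0 < H.
Proof. exact: lt_le_trans (expR_gt0 _) H_bound. Qed.

Lemma phase_near x : D x -> `|phase x - x ord0 ord0| <= delta * X.
Proof.
move=> Dx; rewrite /phase addrAC subrr add0r normrM (gtr0_norm delta_gt0).
rewrite ler_pM2l//; apply: (cell_bound chi_data).
exact: cross_section_box.
Qed.

Lemma slope_near (s t : R) : `|t - s| <= delta * X -> V1 t <= H * V1 s.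
Proof.
move=> ts; apply: (@le_trans _ _ (expR (Q * `|t - s|) * V1 s)).
  apply: (log_derivative_harnack V1 V2).
    exact: (profile_derive1 profile).
  exact: (profile_bound2 profile).
rewrite ler_pM2r//; apply: le_trans H_bound.
by rewrite ler_expR ler_pM2l.
Qed.

Lemma mode_sum_bound (G : I -> R -> R) x : D x ->
  (forall i s, P i -> `|G i s| <= w i * V1 s) ->
  `|mode_sum G x| <= S * H * V1 (phase x).
Proof.
move=> Dx Gw; rewrite -mulrA.
have sH : V1 (x ord0 ord0) <= H * V1 (phase x).
  by apply: slope_near; rewrite distrC; exact: phase_near.
apply: (@le_trans _ _ ((\sum_(i | P i) `|ga i| * w i) * V1 (x ord0 ord0))).
  rewrite mulr_suml; apply: le_trans (ler_norm_sum _ _ _) _.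
  apply: ler_sum => i Pi; rewrite normrM -mulrA ler_wpM2l// normrM.
  apply: le_trans (Gw i _ Pi); rewrite ler_piMl//; exact: mode_le1.
have S0 : 0 <= \sum_(i | P i) `|ga i| * w i.
  apply: sumr_ge0 => i Pi; rewrite mulr_ge0//.
  by rewrite -(pmulr_lge0 _ (V1_gt0 0)) (le_trans _ (Gw i 0 Pi)).
apply: ler_pM => //; exact: ltW.
Qed.

Let S_ge0 : 0 <= S.
Proof.
apply: le_trans S_bound; apply: sumr_ge0 => i Pi; rewrite mulr_ge0//.
by rewrite -(pmulr_lge0 _ (V1_gt0 0)) (le_trans _ (W_bound i 0 Pi)).
Qed.

Let SH_small : delta ^+ 2 * (S * H) <= 2^-1 /\ delta ^+ 2 * (S * H) * Q <= 2^-1.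
Proof.
have h : 0 <= delta ^+ 2 * (S * H).
  by apply: mulr_ge0 (sqr_ge0 _) (mulr_ge0 S_ge0 (ltW H_gt0)).
have h' : 0 <= delta ^+ 2 * (S * H) * Q by apply: mulr_ge0 h (ltW Q_gt0).
by have := delta_small; rewrite mulrDr mulr1; split; lra.
Qed.

(** This keeps the test function strictly between 0 and 1, where the reaction
    term is differentiable, and gives it the limits of the front. *)
Lemma test_between x : D x ->
  `|test x - V (phase x)| <= V (phase x) / 2 /\
  `|test x - V (phase x)| <= (1 - V (phase x)) / 2.
Proof.
move=> Dx; rewrite /test addrAC subrr add0r normrM (ger0_norm (sqr_ge0 _)).
have le := ler_wpM2l (sqr_ge0 delta) (mode_sum_bound W x Dx W_bound).
have [_ small] := SH_small.
have SH0 : 0 <= delta ^+ 2 * (S * H).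
  by apply: mulr_ge0 (sqr_ge0 _) (mulr_ge0 S_ge0 (ltW H_gt0)).
have left := profile_left profile (phase x).
have right := profile_right profile (phase x).
have /andP[v0 v1] := V01 (phase x).
rewrite mulrA in le.
have l1 := ler_wpM2l SH0 left; have l2 := ler_wpM2l SH0 right.
rewrite mulrA in l1; rewrite mulrA in l2.
have s1 := ler_wpM2r (ltW v0) small.
have s2 : delta ^+ 2 * (S * H) * Q * (1 - V (phase x)) <= 2^-1 * (1 - V (phase x)).
  by apply: ler_wpM2r small; lra.
by split; lra.
Qed.

Lemma test_limits : front_limits L m test.
Proof.
have bounds x : D x -> V (phase x) / 2 <= test x <= 3 / 2 * V (phase x) /\
    1 - test x <= 3 / 2 * (1 - V (phase x)) /\ (1 - V (phase x)) / 2 <= 1 - test x.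
  move=> Dx; have [] := test_between x Dx; rewrite !ler_norml => /andP[a1 a2] /andP[a3 a4].
  by split; [apply/andP; split; lra|split; lra].
split=> [x Dx|r r0].
  have [/andP[a1 a2] [a3 a4]] := bounds x Dx; have /andP[v0 v1] := V01 (phase x).
  by apply/andP; split; lra.
have r2 : 0 < r / 2 by rewrite divr_gt0.
have [Y HY] := profile_limits profile _ r2.
exists (Y + delta * X) => x Dx; have := phase_near x Dx; rewrite ler_norml => /andP[p1 p2].
have [/andP[a1 a2] [a3 a4]] := bounds x Dx; have [l1 l2] := HY (phase x).
split=> xY.
  have {}l1 : V (phase x) < r / 2 by apply: l1; lra.
  by lra.
have {}l2 : 1 - r / 2 < V (phase x) by apply: l2; lra.
by lra.
Qed.

Lemma test_slope x : D x -> V1 (phase x) / 2 <= test1 ord0 x.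
Proof.
move=> Dx; rewrite /test1 /phase1 /corrector1 unlift_none mulr1.
have := ler_wpM2l (sqr_ge0 delta) (mode_sum_bound W1 x Dx W1_bound).
have [small _] := SH_small.
have := ler_wpM2r (ltW (V1_gt0 (phase x))) small.
rewrite !mulrA => l1 l2.
have : `|delta ^+ 2 * mode_sum W1 x| <= V1 (phase x) / 2.
  by rewrite normrM (ger0_norm (sqr_ge0 _)); lra.
by rewrite ler_norml => /andP[]; lra.
Qed.

Let residual_rate : R := (X + `|m0|) * (Q * H * (delta * X)) + e * (Q * H) +
  delta * X * (S * H) + S * H * (K * (delta ^+ 2 * (S * H) * Q + Q * (delta * X))).

Lemma test_residual_bound x : D x ->
  `|wave_operator m f (fun y => delta * b y - cs) test test1 test2 x| <=
  delta ^+ 2 * residual_rate * V1 (phase x).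
Proof.
move=> Dx; rewrite test_residual//; set y := cross_section x; set s := x ord0 ord0.
have yL : Omega y by exact: cross_section_box.
have T0 := V1_gt0 (phase x).
have d2 : 0 <= delta ^+ 2 := sqr_ge0 _.
have dX : 0 <= delta * X by exact: mulr_ge0 (ltW delta_gt0) X_ge0.
have near := phase_near x Dx.
have sH : V1 s <= H * V1 (phase x) by apply: slope_near; rewrite distrC.
have V1Q t : V1 t <= Q := profile_bound1 profile t.
have V2_near : `|V2 (phase x) - V2 s| <= Q * H * V1 (phase x) * (delta * X).
  apply: (@le_trans _ _ (Q * H * V1 (phase x) * `|phase x - s|)).
    apply: (derivative_lipschitz V2 V3).
      exact: (profile_derive2 profile).
    move=> t; rewrite -mulrA => tb.
    apply: le_trans (profile_bound3 profile t) _.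
    rewrite ler_pM2l//; apply: slope_near; apply: le_trans near.
    exact: (distance_between s).
  by rewrite ler_wpM2l// !mulr_ge0// ltW.
have V2_s : `|V2 s| <= Q * H * V1 (phase x).
  apply: le_trans (profile_bound2 profile s) _.
  by rewrite -mulrA ler_pM2l.
have C0 := mode_sum_bound W x Dx W_bound; have C1 := mode_sum_bound W1 x Dx W1_bound.
have V_near : `|V (phase x) - V s| <= Q * (delta * X).
  apply: (@le_trans _ _ (Q * `|phase x - s|)).
    apply: (derivative_lipschitz V V1).
      exact: (profile_derive profile).
    by move=> t _; rewrite gtr0_norm.
  by rewrite ler_pM2l.
have t01 : 0 < test x < 1.
  have [] := test_between x Dx; rewrite !ler_norml => /andP[a1 a2] /andP[a3 a4].
  by have /andP[v0 v1] := V01 (phase x); apply/andP; split; lra.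
have /andP[t0 t1] := t01; have /andP[v0 v1] := V01 (phase x).
have testE : test x - V (phase x) = delta ^+ 2 * mode_sum W x.
  by rewrite /test addrAC subrr add0r.
have small : `|test x - V (phase x)| <= delta ^+ 2 * (S * H) * Q.
  rewrite testE normrM (ger0_norm d2) -mulrA ler_wpM2l//.
  apply: le_trans C0 _; rewrite ler_wpM2l// mulr_ge0//; exact: ltW.
have [z zb fz] : exists2 z, Num.min (V (phase x)) (test x) <= z <=
    Num.max (V (phase x)) (test x) & f (test x) - f (V (phase x)) =
    f1 z * (test x - V (phase x)).
  apply: mean_value_between => z /andP[z1 z2]; apply: (reaction_derive reaction).
  rewrite (lt_le_trans _ z1) ?(le_lt_trans z2) ?gt_max ?lt_min ?v0 ?v1//.
have [z01 zn] : 0 < z < 1 /\ `|z - V (phase x)| <= `|test x - V (phase x)|.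
  move: zb => /andP[z1 z2]; split.
    by rewrite (lt_le_trans _ z1) ?(le_lt_trans z2) ?gt_max ?lt_min ?v0 ?v1.
  by rewrite [leRHS]distrC; apply: distance_between; rewrite minC maxC z1.
have f1z : `|f1 z - f1 (V s)| <= K * (delta ^+ 2 * (S * H) * Q + Q * (delta * X)).
  have [r rb ->] : exists2 r, Num.min (V s) z <= r <= Num.max (V s) z &
      f1 z - f1 (V s) = f2 r * (z - V s).
    apply: mean_value_between => r /andP[r1 r2]; apply: (reaction_derive2 reaction).
    have /andP[u0 u1] := V01 s; have /andP[z0 z1] := z01.
    by rewrite (lt_le_trans _ r1) ?(le_lt_trans r2) ?gt_max ?lt_min ?u0 ?u1.
  rewrite normrM; apply: ler_pM => //.
    apply: (reaction_bound2 reaction); move: rb => /andP[r1 r2].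
    have /andP[u0 u1] := V01 s; have /andP[z0 z1] := z01.
    by rewrite (lt_le_trans _ r1) ?(le_lt_trans r2) ?gt_max ?lt_min ?u0 ?u1.
  have -> : z - V s = (z - V (phase x)) + (V (phase x) - V s) by ring.
  by apply: le_trans (ler_normD _ _) _; apply: lerD => //; apply: le_trans small.
have g_le : `|g y - m0| <= X + `|m0|.
  apply: le_trans (ler_normB _ _) _; rewrite lerD2r.
  exact: (cell_energy chi_data).
rewrite fz testE.
have -> : f1 z * (delta ^+ 2 * mode_sum W x) -
    f1 (V s) * (delta ^+ 2 * mode_sum W x) =
    delta ^+ 2 * ((f1 z - f1 (V s)) * mode_sum W x) by ring.
rewrite -!(mulrA (delta ^+ 2)) (_ : delta ^+ 3 = delta ^+ 2 * delta); last by ring.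
rewrite -(mulrA (delta ^+ 2)) -!mulrDr normrM (ger0_norm d2) ler_wpM2l//.
have B1 : `|(g y - m0) * (V2 (phase x) - V2 s)| <=
    (X + `|m0|) * (Q * H * V1 (phase x) * (delta * X)).
  by rewrite normrM ler_pM.
have B2 : `|(g y - m0 - \sum_(i | P i) ga i * mode L m (k i) y) * V2 s| <=
    e * (Q * H * V1 (phase x)).
  by rewrite normrM ler_pM// approx_small.
have B3 : `|delta * (b y * mode_sum W1 x)| <= delta * (X * (S * H * V1 (phase x))).
  rewrite normrM (gtr0_norm delta_gt0) ler_pM2l// normrM ler_pM//.
  exact: (cell_source chi_data).
have B4 : `|(f1 z - f1 (V s)) * mode_sum W x| <=
    K * (delta ^+ 2 * (S * H) * Q + Q * (delta * X)) * (S * H * V1 (phase x)).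
  by rewrite normrM ler_pM.
apply: le_trans (ler_normD _ _) _; apply: le_trans (lerD (ler_normD _ _) (lexx _)) _.
apply: le_trans (lerD (lerD (ler_normD _ _) (lexx _)) (lexx _)) _.
apply: le_trans (lerD (lerD (lerD B1 B2) B3) B4) _.
by rewrite le_eqVlt; apply/orP; left; apply/eqP; rewrite /residual_rate; ring.
Qed.

Theorem test_speed c Phi : stable_ends f -> shear_front L f delta b c Phi ->
  `|c - cs| <= 2 * delta ^+ 2 * residual_rate.
Proof.
move=> ends front; apply: (speed_bound L m L_gt0 f b delta c cs _ Phi _ _ _ ends front
  test_smooth test_limits).
  by move=> x Dx; apply: lt_le_trans (test_slope x Dx); rewrite divr_gt0.
move=> x Dx; have H1 := test_residual_bound x Dx; apply: le_trans (H1) _.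
have r0 : 0 <= delta ^+ 2 * residual_rate.
  by rewrite -(pmulr_lge0 _ (V1_gt0 (phase x))); exact: le_trans H1.
have := ler_wpM2l r0 (test_slope x Dx); lra.
Qed.

End test_function.

(** * The expansion of the speed *)

Section speed_expansion.
Context {R : realType} (L : R) (m : nat).
Hypothesis L_gt0 : 0 < L.

Lemma box_integral_ge0 n (g : 'rV[R]_n -> R) : (forall y, 0 <= g y) ->
  0 <= box_integral L g.
Proof.
elim: n g => [|n IH] g g0 //=.
by apply: Rintegral_ge0 => t _; apply: IH.
Qed.

(** The square root s of 1 + t satisfies 1 + t / 2 - s = (s - 1)^2 / 2; with
    t = delta^2 m0 this expands the speed c0 s of the stretched planar front. *)
Lemma sqrt_expansion (t : R) : 0 <= t ->
  1 <= Num.sqrt (1 + t) <= 1 + t /\ `|Num.sqrt (1 + t) - (1 + t / 2)| <= t ^+ 2.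
Proof.
move=> t0; set s := Num.sqrt (1 + t).
have sE : s ^+ 2 = 1 + t by rewrite sqr_sqrtr//; lra.
have s1 : 1 <= s by rewrite -sqrtr1 ler_wsqrtr//; lra.
have st : (s - 1) * 2 <= t.
  have -> : t = (s - 1) * (s + 1) by rewrite -(addKr 1 t) -sE; ring.
  by rewrite ler_wpM2l//; lra.
split; first by apply/andP; split; lra.
have -> : s - (1 + t / 2) = - ((s - 1) ^+ 2 / 2).
  by rewrite -(addKr 1 t) -sE; field.
rewrite normrN ger0_norm ?divr_ge0 ?sqr_ge0//.
have : (s - 1) ^+ 2 <= t ^+ 2 by rewrite ler_sqr ?nnegrE//; lra.
by have := sqr_ge0 (s - 1); lra.
Qed.

(** For small delta the corrector for the accuracy delta gives an error of
    order delta^3; for larger delta the front without a corrector gives an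
    error of order delta^2, which is then sufficient. *)
Theorem expansion_of_speed (f U : R -> R) (c0 : R) (b chi : 'rV[R]_m -> R)
    (c : R -> R) (d : R) :
  combustion f \/ bistable f -> planar_front f c0 U -> cell_problem L b chi ->
  shear_front_speed L f b c -> mode_approximable L m (sqr_gradient (box L) chi) ->
  quadratic_expansion L chi c0 c d.
Proof.
move=> fcb Uf cp speed [Cg Cg0 approx].
have [f1 [f2 [K [freg ends]]]] := reaction_of_front f U c0 fcb Uf.
have [Q Q0 prof] := planar_front_profile _ _ _ _ _ _ freg Uf.
have [chi2 [X cell]] := cell_problem_data L m b chi cp.
set g := sqr_gradient (box L) chi in approx.
set m0 := box_mean L m g in approx.
have m0_ge0 : 0 <= m0.
  rewrite /m0 /box_mean mulr_ge0 ?invr_ge0 ?exprn_ge0 ?(ltW L_gt0)//.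
  by apply: box_integral_ge0 => y; apply: sumr_ge0 => i _; exact: sqr_ge0.
have meanE : mean_energy L chi = m0 / 2.
  by rewrite /mean_energy /m0 /box_mean -/g invfM; ring.
have X0 : 0 <= X := cell_ge0 cell.
have K0 : 0 <= K.
  have half : 0 < (2^-1 : R) < 1 by apply/andP; split; lra.
  exact: le_trans (normr_ge0 _) (reaction_bound freg _ half).
pose om : R := (pi / L) ^+ 2.
have om0 : 0 < om by rewrite exprn_gt0// divr_gt0// pi_gt0.
have [Cw Cw0 corr] :=
  mode_corrector f f1 f2 K Q om (`|c0| * (1 + m0)) m0 freg om0.
pose H1 := expR (Q * X); pose H2 := expR (Q * (d * X)).
pose S := Cw * Cg.
have S0 : 0 <= S by exact: mulr_ge0.
have [H10 H20] : 0 < H1 /\ 0 < H2 by rewrite !expR_gt0.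
pose Z := 2 * (S * H1) * (Q + 1) + 2 * (m0 * Q) / om.
have Z1 : 0 <= 2 * (S * H1) * (Q + 1).
  apply: mulr_ge0; last by lra.
  by apply: mulr_ge0 => //; apply: mulr_ge0 => //; exact: ltW.
have Z2 : 0 <= 2 * (m0 * Q) / om.
  apply: divr_ge0 (ltW om0); apply: mulr_ge0 => //; apply: mulr_ge0 => //.
  exact: ltW.
pose B1 := 2 * ((X + m0) * (Q * H1 * X) + Q * H1 + X * (S * H1) +
  S * H1 * (K * (S * H1 * Q + Q * X))).
pose B2 := 2 * ((X + m0) * (Q * H2 * X) + (X + m0) * (Q * H2) * (1 + Z)).
pose B3 := `|c0| * m0 ^+ 2 * `|d|.
have [QH1 QH2] : 0 <= Q * H1 /\ 0 <= Q * H2 by rewrite !mulr_ge0// ltW.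
have SH1 : 0 <= S * H1 by apply: mulr_ge0 => //; exact: ltW.
have B10 : 0 <= B1.
  apply: mulr_ge0 => //; rewrite !addr_ge0//.
  - by apply: mulr_ge0; [lra|apply: mulr_ge0].
  - by apply: mulr_ge0.
  - apply: mulr_ge0 => //; apply: mulr_ge0 => //; apply: addr_ge0.
      by apply: mulr_ge0 => //; exact: ltW.
    by apply: mulr_ge0 => //; exact: ltW.
have B20 : 0 <= B2.
  apply: mulr_ge0 => //; apply: addr_ge0.
    by apply: mulr_ge0; [lra|apply: mulr_ge0].
  apply: mulr_ge0; last by rewrite /Z; lra.
  by apply: mulr_ge0 => //; lra.
exists (B1 + B2 + B3) => delta delta0 deltad.
have d0 : 0 < d := lt_le_trans delta0 deltad.
have [_ /(_ erefl)[Phi front]] := speed delta delta0 (c delta).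
pose t := delta ^+ 2 * m0.
have t0 : 0 <= t by exact: mulr_ge0 (sqr_ge0 _) m0_ge0.
have [/andP[sg1 sg2] sgE] := sqrt_expansion t t0.
set sg := Num.sqrt (1 + t) in sg1 sg2 sgE.
have sgsq : sg ^+ 2 = 1 + delta ^+ 2 * m0 by rewrite sqr_sqrtr//; lra.
have [V [V1 [V2 [V3 [V4 Vf]]]]] := prof sg sg1.
have planar : `|c0 * sg - (c0 + c0 * delta ^+ 2 * mean_energy L chi)| <= B3 * delta ^+ 3.
  rewrite meanE (_ : _ - _ = c0 * (sg - (1 + t / 2))); last by rewrite /t; field.
  rewrite normrM /B3 (gtr0_norm d0).
  apply: (@le_trans _ _ (`|c0| * t ^+ 2)); first by rewrite ler_wpM2l.
  have -> : `|c0| * m0 ^+ 2 * d * delta ^+ 3 = `|c0| * (m0 ^+ 2 * delta ^+ 3 * d) by ring.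
  have -> : t ^+ 2 = m0 ^+ 2 * delta ^+ 3 * delta by rewrite /t; ring.
  by rewrite !ler_wpM2l// mulr_ge0 ?sqr_ge0// exprn_ge0// ltW.
suff dist : `|c delta - c0 * sg| <= (B1 + B2) * delta ^+ 3.
  have -> : c delta - (c0 + c0 * delta ^+ 2 * mean_energy L chi) =
    (c delta - c0 * sg) + (c0 * sg - (c0 + c0 * delta ^+ 2 * mean_energy L chi)) by ring.
  by apply: le_trans (ler_normD _ _) _; rewrite [in leRHS]mulrDl lerD.
have [d2 d3] : 0 <= delta ^+ 2 /\ 0 <= delta ^+ 3 by rewrite !exprn_ge0// ltW.
have [small|large] := leP (delta * (1 + Z)) 1.
- apply: (@le_trans _ _ (B1 * delta ^+ 3)); last by rewrite ler_wpM2r// lerDl.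
  have Zd0 : 0 <= delta * Z by apply: mulr_ge0; [exact: ltW|rewrite /Z; lra].
  have delta1 : delta <= 1 by move: small; rewrite mulrDr mulr1; lra.
  have d2d : delta ^+ 2 <= delta by rewrite expr2 ger_pMr.
  have d2Z : delta ^+ 2 * Z <= 1.
    apply: (@le_trans _ _ (delta * Z)); last by move: small; rewrite mulrDr mulr1; lra.
    by rewrite ler_wpM2r// /Z; lra.
  have tm0 : t <= m0 by rewrite /t ler_piMl//; lra.
  have tQ : t * Q <= om / 2.
    have : delta ^+ 2 * (2 * (m0 * Q) / om) <= 1.
      by apply: le_trans d2Z; rewrite ler_wpM2l// /Z; lra.
    by rewrite mulrA ler_pdivrMr// mul1r /t; lra.
  have [I [P [ga [k [k0 ga_approx ga_sum]]]]] := approx delta delta0.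
  have modes i : exists W : (R -> R) * (R -> R) * (R -> R), P i ->
      [/\ forall s : R, is_derive s 1 W.1.1 (W.1.2 s),
        forall s : R, is_derive s 1 W.1.2 (W.2 s),
        forall s, W.2 s - c0 * sg * W.1.2 s +
          (f1 (V s) - eigenvalue L m (k i)) * W.1.1 s = - V2 s,
        forall s, `|W.1.1 s| <= Cw / eigenvalue L m (k i) * V1 s &
        forall s, `|W.1.2 s| <= Cw / eigenvalue L m (k i) * V1 s].
    have [Pi|nPi] := boolP (P i); last by exists (id, id, id).
    have omk : om <= eigenvalue L m (k i) by apply: eigenvalue_lower; [|exact: k0].
    have [||||w [w1 [w2 w_spec]]] := corr _ _ V V1 V2 V3 V4 _ Vf _ _ _ omk.
    + by rewrite sgsq -/t lerDl.
    + rewrite normrM ler_wpM2l// ger0_norm; lra.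
    + by rewrite sgsq -/t; lra.
    + by rewrite sgsq -/t addrAC subrr add0r; lra.
    + by exists (w, w1, w2).
  have [W W_spec] := choice modes.
  apply: le_trans (test_speed L m L_gt0 b chi _ chi2 X cell f f1 f2 K _ _ Q V V1 V2 V3 V4
    freg Vf I P ga k (fun i => (W i).1.1) (fun i => (W i).1.2) (fun i => (W i).2)
    (fun i => Cw / eigenvalue L m (k i)) S _ _ _ _ _ _ delta m0 delta delta0 sgsq H1
    _ ga_approx _ (c delta) Phi ends front) _.
  + by move=> i s /W_spec[].
  + by move=> i s /W_spec[].
  + by move=> i s /W_spec[].
  + by move=> i s /W_spec[].
  + by move=> i s /W_spec[].
  + rewrite /S; apply: le_trans (ler_wpM2l Cw0 ga_sum).
    rewrite mulr_sumr le_eqVlt; apply/orP; left; apply/eqP.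
    by apply: eq_bigr => i _; ring.
  + by rewrite ler_expR ler_pM2l// ler_piMl.
  + have : delta ^+ 2 * (2 * (S * H1) * (Q + 1)) <= 1.
      by apply: le_trans d2Z; rewrite ler_wpM2l// /Z; lra.
    by lra.
  + rewrite (ger0_norm m0_ge0).
    have -> : B1 * delta ^+ 3 = 2 * delta ^+ 2 * ((X + m0) * (Q * H1 * (delta * X)) +
      delta * (Q * H1) + delta * X * (S * H1) +
      S * H1 * (K * (delta * (S * H1) * Q + Q * (delta * X)))) by rewrite /B1; ring.
    apply: ler_wpM2l; first exact: mulr_ge0.
    rewrite lerD2l; apply: ler_wpM2l => //; apply: ler_wpM2l => //; rewrite lerD2r.
    by apply: ler_wpM2r; [exact: ltW|exact: ler_wpM2r].
- apply: (@le_trans _ _ (B2 * delta ^+ 3)); last by rewrite ler_wpM2r// lerDr.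
  apply: le_trans (test_speed L m L_gt0 b chi _ chi2 X cell f f1 f2 K _ _ Q V V1 V2 V3 V4
    freg Vf bool pred0 (fun=> 0) (fun _ _ => 0%N) (fun=> id) (fun=> id) (fun=> id)
    (fun=> 0) 0 _ _ _ _ _ _ delta m0 (X + m0) delta0 sgsq H2
    _ _ _ (c delta) Phi ends front) _ => //.
  + by rewrite big_pred0.
  + by rewrite ler_expR ler_pM2l// ler_wpM2r.
  + move=> y yL; rewrite [X in _ - X]big_pred0// subr0; apply: le_trans (ler_normB _ _) _.
    rewrite (ger0_norm m0_ge0) lerD2r; exact: (cell_energy cell).
  + by rewrite mul0r mulr0 mul0r invr_ge0.
  + rewrite (ger0_norm m0_ge0) mul0r !mulr0 mul0r !addr0.
    have -> : B2 * delta ^+ 3 = 2 * delta ^+ 2 * ((X + m0) * (Q * H2 * (delta * X)) +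
      (X + m0) * (Q * H2) * (delta * (1 + Z))) by rewrite /B2; ring.
    apply: ler_wpM2l; first exact: mulr_ge0.
    rewrite lerD2l; apply: ler_peMr; last exact: ltW.
    by apply: mulr_ge0 => //; exact: addr_ge0.
Qed.

End speed_expansion.

Theorem proposition2p1 (R : realType) (n : nat) (L p : R)
    (hn : n = 2%N \/ n = 3%N) (hL : 0 < L) (hp : 0 < p < 1) :
  exists (d0 : (R -> R) -> R -> R) (C : (R -> R) -> R),
    (forall U r, 0 < d0 U r) /\ (forall U, 0 < C U) /\
    forall (f U : R -> R) (c0 : R) (b chi : 'rV[R]_n.-1 -> R) (c : R -> R),
      combustion f \/ bistable f ->
      planar_front f c0 U ->
      holder_continuous L p b ->
      (box_volume L n.-1)^-1 * box_integral L b = 0 ->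
      cell_problem L b chi ->
      shear_front_speed L f b c ->
      quadratic_expansion L chi c0 c (d0 U (shear_norm L p b)) /\
      ((exists2 y, box L y & b y <> 0) ->
       let alpha := - mean_energy L chi in
       quadratic_expansion L chi c0 c
         (Num.sqrt (Num.min (2 * `|alpha|)^-1
                            (2 * C U * shear_norm L p b ^+ 2)^-1))).
Proof.
exists (fun _ _ => 1), (fun _ => 1); split; [by []|split; [by []|]].
move=> f U c0 b chi c fcb Uf _ _ cp speed.
suff expansion d : quadratic_expansion L chi c0 c d by [].
have [chi2 [X cell]] := cell_problem_data L n.-1 b chi cp.
have lip := cell_lipschitz cell.
apply: (expansion_of_speed L n.-1 hL f U c0 b chi c d fcb Uf cp speed).
case: hn chi b c cp speed chi2 cell lip => -> chi b c cp speed chi2 cell lip.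
  exact: (mode_approximable1 L hL _ X lip).
exact: (mode_approximable2 L hL _ X lip).
Qed.
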